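(* Let $K$ be an algebraically closed field and let $A$ be a sincere, piecewise hereditary finite dimensional $K$-algebra. Then the strong global dimension of $A$ is at most $3$.
   Context: All algebras are finite dimensional basic associative $K$-algebras; modules are finite dimensional right modules; $D^b$ denotes the bounded derived category. $A$ is sincere if there is an indecomposable $A$-module $M$ such that every simple $A$-module is a composition factor of $M$. Piecewise hereditary: an abelian $K$-category $\mathcal{H}$ is hereditary if $\operatorname{Ext}^n_{\mathcal H}(X,Y)=0$ for all objects $X,Y$ and all $n\ge 2$. An object $T\in\mathcal H$ is tilting if $\operatorname{Ext}^1_{\mathcal H}(T,T)=0$ and $\operatorname{Hom}_{\mathcal H}(T,X)=0=\operatorname{Ext}^1_{\mathcal H}(T,X)$ implies $X=0$. All hereditary categories considered have split idempotents, finite dimensional Hom spaces and a tilting object. An algebra $A$ is piecewise hereditary if $D^b(\operatorname{mod}A)$ is triangle equivalent to $D^b(\mathcal H)$ for such a hereditary abelian category $\mathcal H$. Strong global dimension: let $\mathcal P_A$ be the category of finite dimensional projective $A$-modules and $K^b(\mathcal P_A)$ the bounded homotopy category. A bounded complex $P=(P^i,d^i)$ of projectives is radical if the image of each differential $d^i:P^i\to P^{i+1}$ lies in the radical of $P^{i+1}$; every object of $K^b(\mathcal P_A)$ is isomorphic to a radical complex, unique up to isomorphism of complexes. For a nonzero object $P$, represented by a radical complex, let $r\le s$ be such that $P^i=0$ for $i<r$ and for $i>s$, with $P^r\neq0\neq P^s$; the length of $P$ is $\operatorname{l}(P)=s-r$. The strong global dimension of $A$ is $\sup\{\operatorname{l}(P)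 : P\in K^b(\mathcal P_A)\text{ indecomposable}\}$. *)

(* Defs.v *)
From HB Require Import structures.
From mathcomp Require Import all_boot all_order all_algebra all_field.
From mathcomp Require Import boolp zify.

Set Implicit Arguments.
Unset Strict Implicit.
Unset Printing Implicit Defensive.

Import GRing.Theory.
Local Open Scope ring_scope.

Record klin (K : fieldType) := KLin {
  obj :> Type;
  hom : obj -> obj -> lmodType K;
  comp : forall X Y Z : obj, hom X Y -> hom Y Z -> hom X Z;
  idm : forall X : obj, hom X X;
  zobj : obj;
  compA : forall X Y Z T (f : hom X Y) (g : hom Y Z) (h : hom Z T),
    comp (comp f g) h = comp f (comp g h);
  comp1m : forall X Y (f : hom X Y), comp (idm X) f = f;
  compm1 : forall X Y (f : hom X Y), comp f (idm Y) = f;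
  compDl : forall X Y Z (f g : hom X Y) (h : hom Y Z),
    comp (f + g) h = comp f h + comp g h;
  compDr : forall X Y Z (f : hom X Y) (g h : hom Y Z),
    comp f (g + h) = comp f g + comp f h;
  compZl : forall X Y Z (a : K) (f : hom X Y) (g : hom Y Z),
    comp (a *: f) g = a *: comp f g;
  compZr : forall X Y Z (a : K) (f : hom X Y) (g : hom Y Z),
    comp f (a *: g) = a *: comp f g;
  zobjP : idm zobj = 0
}.

Arguments hom {K k} X Y.
Arguments comp {K k X Y Z} f g.
Arguments idm {K k} X.
Arguments zobj {K} k.

(* Diagrammatic order: [f \> g] is "first f, then g". *)
Notation "f \> g" := (comp f g) (at level 45, left associativity).

Section LinearCategory.
Variables (K : fieldType) (C : klin K).
Implicit Types X Y Z W : C.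

Lemma comp0m X Y Z (g : hom Y Z) : (0 : hom X Y) \> g = 0.
Proof. by rewrite -(scale0r (0 : hom X Y)) compZl scale0r. Qed.

Lemma compm0 X Y Z (f : hom X Y) : f \> (0 : hom Y Z) = 0.
Proof. by rewrite -(scale0r (0 : hom Y Z)) compZr scale0r. Qed.

Lemma compNl X Y Z (f : hom X Y) (g : hom Y Z) : (- f) \> g = - (f \> g).
Proof. by rewrite -scaleN1r compZl scaleN1r. Qed.

Lemma compNr X Y Z (f : hom X Y) (g : hom Y Z) : f \> (- g) = - (f \> g).
Proof. by rewrite -scaleN1r compZr scaleN1r. Qed.

Definition is_zero X : Prop := idm X = 0.

Definition is_iso X Y (f : hom X Y) : Prop :=
  exists g : hom Y X, f \> g = idm X /\ g \> f = idm Y.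

Definition isomorphic X Y : Prop := exists f : hom X Y, is_iso f.

Definition mono X Y (f : hom X Y) : Prop :=
  forall W (g h : hom W X), g \> f = h \> f -> g = h.

Definition epi X Y (f : hom X Y) : Prop :=
  forall W (g h : hom Y W), f \> g = f \> h -> g = h.

Definition is_kernel Z X Y (k : hom Z X) (f : hom X Y) : Prop :=
  k \> f = 0 /\
  forall W (g : hom W X), g \> f = 0 -> exists! u : hom W Z, u \> k = g.

Definition is_cokernel X Y Z (p : hom Y Z) (f : hom X Y) : Prop :=
  f \> p = 0 /\
  forall W (g : hom Y W), f \> g = 0 -> exists! u : hom Z W, p \> u = g.

Definition is_biprod X Y S (i1 : hom X S) (i2 : hom Y S)
    (p1 : hom S X) (p2 : hom S Y) : Prop :=
  [/\ i1 \> p1 = idm X, i2 \> p2 = idm Y, i1 \> p2 = 0, i2 \> p1 = 0 &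
      p1 \> i1 + p2 \> i2 = idm S].

Definition indecomposable X : Prop :=
  ~ is_zero X /\
  forall Y Z (i1 : hom Y X) (i2 : hom Z X) (p1 : hom X Y) (p2 : hom X Z),
    is_biprod i1 i2 p1 p2 -> is_zero Y \/ is_zero Z.

Definition split_idempotents : Prop :=
  forall X (e : hom X X), e \> e = e ->
    exists Y (r : hom X Y) (s : hom Y X), r \> s = e /\ s \> r = idm Y.

Definition hom_finite : Prop :=
  forall X Y, exists n (b : 'I_n -> hom X Y),
    forall f : hom X Y, exists c : 'I_n -> K, f = \sum_(i < n) c i *: b i.

Definition abelian : Prop :=
  [/\ forall X Y, exists S (i1 : hom X S) (i2 : hom Y S) p1 p2,
        is_biprod i1 i2 p1 p2,
      forall X Y (f : hom X Y), exists Z (k : hom Z X), is_kernel k f,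
      forall X Y (f : hom X Y), exists Z (p : hom Y Z), is_cokernel p f,
      forall X Y (f : hom X Y), mono f ->
        exists Z (g : hom Y Z), is_kernel f g &
      forall X Y (f : hom X Y), epi f ->
        exists Z (g : hom Z X), is_cokernel f g].

Record cpx := Cpx {
  cobj :> int -> C;
  diff : forall i : int, hom (cobj i) (cobj (i + 1));
  diffK : forall i, diff i \> diff (i + 1) = 0;
  cpx_bounded :
    exists r s : int, forall i, ~~ ((r <= i) && (i <= s)) -> is_zero (cobj i)
}.

Record chom (X Y : cpx) := CHom {
  cmap :> forall i : int, hom (X i) (Y i);
  cmapP : forall i, diff X i \> cmap (i + 1) = cmap i \> diff Y i
}.

Program Definition cscalar (X : cpx) (a : K) : chom X X :=
  @CHom X X (fun i => a *: idm (X i)) _.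
Next Obligation. by rewrite compZr compZl compm1 comp1m. Qed.

Program Definition cid (X : cpx) : chom X X :=
  @CHom X X (fun i => idm (X i)) _.
Next Obligation. by rewrite compm1 comp1m. Qed.

Program Definition czero (X Y : cpx) : chom X Y := @CHom X Y (fun i => 0) _.
Next Obligation. by rewrite comp0m compm0. Qed.

Program Definition ccomp (X Y Z : cpx) (f : chom X Y) (g : chom Y Z) :
  chom X Z := @CHom X Z (fun i => f i \> g i) _.
Next Obligation. by rewrite -compA cmapP !compA cmapP. Qed.

Program Definition shift (X : cpx) : cpx :=
  @Cpx (fun i => X (i + 1)) (fun i => - diff X (i + 1)) _ _.
Next Obligation. by rewrite compNl compNr diffK !oppr0. Qed.
Next Obligation.
have [r [s rsP]] := cpx_bounded X.
exists (r - 1), (s - 1) => i Hi; apply: rsP; lia.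
Qed.

Program Definition cshift (X Y : cpx) (f : chom X Y) :
  chom (shift X) (shift Y) := @CHom (shift X) (shift Y) (fun i => f (i + 1)) _.
Next Obligation. by rewrite compNl compNr cmapP. Qed.

Program Definition stalk (X : C) : cpx :=
  @Cpx (fun i => if i == 0 then X else zobj C) (fun i => 0) _ _.
Next Obligation. exact: comp0m. Qed.
Next Obligation.
exists 0, 0 => i Hi; have /negbTE-> : i != 0 by lia.
exact: zobjP.
Qed.

(* The arguments need not be chain maps, so that sums of chain maps may be
   written degreewise.  The homotopy component h i goes from degree i + 1 to
   degree i; since every integer is of the form i + 1, the condition covers
   all degrees. *)
Definition homotopic (X Y : cpx) (f g : forall i, hom (X i) (Y i)) : Prop :=
  exists h : forall i : int, hom (X (i + 1)) (Y i),
    forall i, f (i + 1) - g (i + 1) =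
              diff X (i + 1) \> h (i + 1) + h i \> diff Y i.

(* A cohomology object of X in degree i + 1: the cokernel [coh] of the map
   from X i to the kernel [cocycles] of the differential out of X (i + 1). *)
Record cohomology (X : cpx) (i : int) := Cohomology {
  cocycles : C;
  coh : C;
  coh_incl : hom cocycles (X (i + 1));
  coh_bd : hom (X i) cocycles;
  coh_proj : hom cocycles coh;
  coh_inclP : is_kernel coh_incl (diff X (i + 1));
  coh_bdP : coh_bd \> coh_incl = diff X i;
  coh_projP : is_cokernel coh_proj coh_bd
}.

(* In an abelian category [h] exists and is unique for any choice of the
   cohomology objects, and whether it is invertible does not depend on them. *)
Definition coh_iso (X Y : cpx) (f : chom X Y) (i : int) : Prop :=
  exists (HX : cohomology X i) (HY : cohomology Y i)
         (z : hom (cocycles HX) (cocycles HY)) (h : hom (coh HX) (coh HY)),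
    [/\ z \> coh_incl HY = coh_incl HX \> f (i + 1),
        coh_proj HX \> h = z \> coh_proj HY & is_iso h].

Definition qis (X Y : cpx) (f : chom X Y) : Prop := forall i, coh_iso f i.

Lemma kernel_opp Z X Y (k : hom Z X) (f : hom X Y) :
  is_kernel k f -> is_kernel k (- f).
Proof.
case=> kf kP; split; first by rewrite compNr kf oppr0.
move=> W g; rewrite compNr => /eqP; rewrite oppr_eq0 => /eqP; exact: kP.
Qed.

Lemma cokernel_opp X Y Z (p : hom Y Z) (f : hom X Y) :
  is_cokernel p f -> is_cokernel p (- f).
Proof.
case=> fp pP; split; first by rewrite compNl fp oppr0.
move=> W g; rewrite compNl => /eqP; rewrite oppr_eq0 => /eqP; exact: pP.
Qed.

Lemma shift_cohomology_subproof (X : cpx) (i : int) (H : cohomology X (i + 1)) :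
  - coh_bd H \> coh_incl H = diff (shift X) i.
Proof. by rewrite compNl coh_bdP. Qed.

Definition shift_cohomology (X : cpx) (i : int) (H : cohomology X (i + 1)) :
    cohomology (shift X) i :=
  @Cohomology (shift X) i (cocycles H) (coh H) (coh_incl H) (- coh_bd H)
    (coh_proj H) (kernel_opp (coh_inclP H)) (shift_cohomology_subproof H)
    (cokernel_opp (coh_projP H)).

Lemma qis_shift (X Y : cpx) (f : chom X Y) : qis f -> qis (cshift f).
Proof.
move=> fq i; have [HX [HY [z [h zhP]]]] := fq (i + 1).
by exists (shift_cohomology HX), (shift_cohomology HY), z, h.
Qed.

(* The mapping cone: in degree i it is the biproduct of X (i + 1) and Y i,
   with differential (x, y) |-> (- d x, f x + d y); [v] is the inclusion of Y
   and [w] the projection onto X[1]. *)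
Definition is_cone (X Y : cpx) (f : chom X Y) (Z : cpx)
    (v : chom Y Z) (w : chom Z (shift X)) : Prop :=
  exists (j : forall i : int, hom (X (i + 1)) (Z i))
         (q : forall i : int, hom (Z i) (Y i)),
    (forall i, is_biprod (j i) (v i) (w i) (q i)) /\
    (forall i, diff Z i = w i \> (- diff X (i + 1)) \> j (i + 1)
                        + w i \> f (i + 1) \> v (i + 1)
                        + q i \> diff Y i \> v (i + 1)).

(* Morphisms of the bounded derived category are formal composites of chain
   maps and of inverses of quasi-isomorphisms, taken up to the congruence
   [deq]: this is the localization at the quasi-isomorphisms of the bounded
   homotopy category (chain maps up to homotopy). *)
Inductive dhom : cpx -> cpx -> Type :=
| DMor (X Y : cpx) (f : chom X Y) : dhom X Y
| DInv (X Y : cpx) (s : chom X Y) (sq : qis s) : dhom Y X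
| DComp (X Y Z : cpx) (f : dhom X Y) (g : dhom Y Z) : dhom X Z.

Inductive deq : forall X Y : cpx, dhom X Y -> dhom X Y -> Prop :=
| deq_refl (X Y : cpx) (f : dhom X Y) : deq f f
| deq_sym (X Y : cpx) (f g : dhom X Y) : deq f g -> deq g f
| deq_trans (X Y : cpx) (f g h : dhom X Y) : deq f g -> deq g h -> deq f h
| deq_comp (X Y Z : cpx) (f f' : dhom X Y) (g g' : dhom Y Z) :
    deq f f' -> deq g g' -> deq (DComp f g) (DComp f' g')
| deq_compA (X Y Z T : cpx) (f : dhom X Y) (g : dhom Y Z) (h : dhom Z T) :
    deq (DComp (DComp f g) h) (DComp f (DComp g h))
| deq_comp1m (X Y : cpx) (f : dhom X Y) : deq (DComp (DMor (cid X)) f) f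
| deq_compm1 (X Y : cpx) (f : dhom X Y) : deq (DComp f (DMor (cid Y))) f
| deq_mor (X Y Z : cpx) (f : chom X Y) (g : chom Y Z) :
    deq (DComp (DMor f) (DMor g)) (DMor (ccomp f g))
| deq_homotopic (X Y : cpx) (f g : chom X Y) :
    homotopic f g -> deq (DMor f) (DMor g)
| deq_morV (X Y : cpx) (s : chom X Y) (sq : qis s) :
    deq (DComp (DMor s) (DInv sq)) (DMor (cid X))
| deq_Vmor (X Y : cpx) (s : chom X Y) (sq : qis s) :
    deq (DComp (DInv sq) (DMor s)) (DMor (cid Y)).

Fixpoint dshift (X Y : cpx) (f : dhom X Y) : dhom (shift X) (shift Y) :=
  match f with
  | DMor X Y f => DMor (cshift f)
  | DInv X Y s sq => DInv (qis_shift sq)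
  | DComp X Y Z f g => DComp (dshift f) (dshift g)
  end.

Definition dscale (X Y : cpx) (a : K) (f : dhom X Y) : dhom X Y :=
  DComp f (DMor (cscalar Y a)).

Definition d_iso (X Y : cpx) (f : dhom X Y) : Prop :=
  exists g : dhom Y X,
    deq (DComp f g) (DMor (cid X)) /\ deq (DComp g f) (DMor (cid Y)).

Definition distinguished (X Y Z : cpx)
    (u : dhom X Y) (v : dhom Y Z) (w : dhom Z (shift X)) : Prop :=
  exists (X' Y' Z' : cpx) (u' : chom X' Y') (v' : chom Y' Z')
         (w' : chom Z' (shift X')) (a : dhom X X') (b : dhom Y Y')
         (c : dhom Z Z'),
    [/\ is_cone u' v' w',
        [/\ d_iso a, d_iso b & d_iso c],
        deq (DComp u b) (DComp a (DMor u')),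
        deq (DComp v c) (DComp b (DMor v')) &
        deq (DComp w (dshift a)) (DComp c (DMor w'))].

(* Ext^n(X, Y) = Hom(X, Y[n]) in the bounded derived category; no enough
   projectives or injectives are assumed. *)
Definition Ext (n : nat) (X Y : C) : Type :=
  dhom (stalk X) (iter n shift (stalk Y)).

Definition Ext_vanishes (n : nat) (X Y : C) : Prop :=
  forall f : Ext n X Y, deq f (DMor (czero _ _)).

Definition hereditary : Prop :=
  forall X Y (n : nat), (2 <= n)%N -> Ext_vanishes n X Y.

Definition tilting (T : C) : Prop :=
  Ext_vanishes 1 T T /\
  forall X, (forall f : hom T X, f = 0) -> Ext_vanishes 1 T X -> is_zero X.

End LinearCategory.

Arguments DMor {K C X Y} f.
Arguments cid {K C} X.

(* K-linear triangle functors.  Additivity is not listed among the fields: it is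
   automatic for the equivalences below, since they preserve biproducts. *)
Record triangle_functor (K : fieldType) (C D : klin K) := TriangleFunctor {
  tobj :> cpx C -> cpx D;
  tmap : forall X Y : cpx C, dhom X Y -> dhom (tobj X) (tobj Y);
  tmap_deq : forall (X Y : cpx C) (f g : dhom X Y),
    deq f g -> deq (tmap f) (tmap g);
  tmap_id : forall X : cpx C, deq (tmap (DMor (cid X))) (DMor (cid (tobj X)));
  tmap_comp : forall (X Y Z : cpx C) (f : dhom X Y) (g : dhom Y Z),
    deq (tmap (DComp f g)) (DComp (tmap f) (tmap g));
  tmap_scale : forall (X Y : cpx C) (a : K) (f : dhom X Y),
    deq (tmap (dscale a f)) (dscale a (tmap f));
  tshift : forall X : cpx C, dhom (tobj (shift X)) (shift (tobj X));
  tshift_iso : forall X : cpx C, d_iso (tshift X);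
  tshift_nat : forall (X Y : cpx C) (f : dhom X Y),
    deq (DComp (tmap (dshift f)) (tshift Y))
        (DComp (tshift X) (dshift (tmap f)));
  tmap_distinguished : forall (X Y Z : cpx C)
      (u : dhom X Y) (v : dhom Y Z) (w : dhom Z (shift X)),
    distinguished u v w ->
    distinguished (tmap u) (tmap v) (DComp (tmap w) (tshift X))
}.

Definition triangle_equivalence (K : fieldType) (C D : klin K)
    (F : triangle_functor C D) : Prop :=
  [/\ forall (X Y : cpx C) (f g : dhom X Y),
        deq (tmap F f) (tmap F g) -> deq f g,
      forall (X Y : cpx C) (g : dhom (F X) (F Y)),
        exists f : dhom X Y, deq (tmap F f) g &
      forall Y : cpx D, exists (X : cpx C) (g : dhom (F X) Y), d_iso g].

Definition triangle_equivalent (K : fieldType) (C D : klin K) : Prop :=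
  exists F : triangle_functor C D, triangle_equivalence F.

Record rmod (K : fieldType) (A : falgType K) := RMod {
  mcar :> vectType K;
  mact : mcar -> A -> mcar;
  mact1 : forall x, mact x 1 = x;
  mactM : forall x a b, mact x (a * b) = mact (mact x a) b;
  mactDl : forall x y a, mact (x + y) a = mact x a + mact y a;
  mactDr : forall x a b, mact x (a + b) = mact x a + mact x b;
  mactZl : forall (k : K) x a, mact (k *: x) a = k *: mact x a;
  mactZr : forall (k : K) x a, mact x (k *: a) = k *: mact x a
}.

Section Modules.
Variables (K : fieldType) (A : falgType K).
Implicit Types M N S P : rmod A.

Definition is_mhom M N : {pred 'Hom(M, N)} :=
  fun f => `[< forall x a, f (mact x a) = mact (f x) a >].

Lemma mact0 M a : mact (0 : M) a = 0.
Proof. by rewrite -(scale0r (0 : M)) mactZl !scale0r. Qed.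

Lemma is_mhom_submod M N : submod_closed (@is_mhom M N).
Proof.
split; first by apply/asboolP => x a; rewrite !lfunE mact0.
move=> k f g /asboolP fP /asboolP gP; apply/asboolP => x a.
by rewrite !lfunE /= !lfunE /= fP gP mactDl mactZl.
Qed.

HB.instance Definition _ M N :=
  GRing.isSubmodClosed.Build K 'Hom(M, N) (@is_mhom M N) (is_mhom_submod M N).

Record mhom M N := MHom { mhom_val :> 'Hom(M, N); _ : mhom_val \in @is_mhom M N }.

HB.instance Definition _ M N := [isSub of mhom M N for @mhom_val M N].
HB.instance Definition _ M N := [Choice of mhom M N by <:].
HB.instance Definition _ M N := [SubChoice_isSubLmodule of mhom M N by <:].

Lemma mhomP M N (f : mhom M N) x a : f (mact x a) = mact (f x) a.
Proof. by case: f => f /= /asboolP ->. Qed.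

Lemma mhom_eq M N (f g : mhom M N) : (forall x, f x = g x) -> f = g.
Proof. by move=> fg; apply/val_inj/lfunP. Qed.

Lemma mcomp_subproof M N P (f : mhom M N) (g : mhom N P) :
  (mhom_val g \o mhom_val f)%VF \in @is_mhom M P.
Proof. by apply/asboolP => x a; rewrite !lfunE /= !mhomP. Qed.

Definition mcomp M N P (f : mhom M N) (g : mhom N P) : mhom M P :=
  MHom (mcomp_subproof f g).

Lemma mid_subproof M : (\1%VF : 'End(M)) \in @is_mhom M M.
Proof. by apply/asboolP => x a; rewrite !lfunE. Qed.

Definition mid M : mhom M M := MHom (mid_subproof M).

Definition mzero : rmod A.
Proof.
by refine (@RMod K A 'rV[K]_0 (fun x _ => x) _ _ _ _ _ _) => *;
  apply/rowP => -[].
Defined.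

Definition modcat : klin K.
Proof.
refine (@KLin K (rmod A) (fun M N => mhom M N) mcomp mid mzero
          _ _ _ _ _ _ _ _).
- by move=> *; apply: mhom_eq => x; rewrite !lfunE /= !lfunE.
- by move=> *; apply: mhom_eq => x; rewrite !lfunE /= !lfunE.
- by move=> *; apply: mhom_eq => x; rewrite !lfunE /= !lfunE.
- by move=> *; apply: mhom_eq => x; rewrite !lfunE /= !lfunE /= linearD.
- by move=> *; apply: mhom_eq => x; rewrite !lfunE /= !lfunE.
- by move=> *; apply: mhom_eq => x; rewrite !lfunE /= !lfunE /= linearZ.
- by move=> *; apply: mhom_eq => x; rewrite !lfunE /= !lfunE.
- by apply: mhom_eq => x; apply/rowP => -[].
Defined.

Definition regular_mod : rmod A.
Proof.
refine (@RMod K A A (fun x a => x * a) _ _ _ _ _ _).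
- exact: mulr1.
- exact: mulrA.
- exact: mulrDl.
- exact: mulrDr.
- by move=> *; rewrite scalerAl.
- by move=> *; rewrite scalerAr.
Defined.

Definition submodule M (U : {vspace M}) : Prop :=
  forall x a, x \in U -> mact x a \in U.

Definition simple_mod S : Prop :=
  (fullv : {vspace S}) <> 0%VS /\
  forall U : {vspace S}, submodule U -> U = 0%VS \/ U = fullv.

(* The submodule quotient V / U is isomorphic to S: there is a linear map on M
   whose restriction to V is a surjective module morphism to S with kernel U. *)
Definition subquotient M (U V : {vspace M}) S : Prop :=
  [/\ submodule U, submodule V, (U <= V)%VS &
      exists g : 'Hom(M, S),
        [/\ forall x a, x \in V -> g (mact x a) = mact (g x) a,
            (g @: V)%VS = fullv & (lker g :&: V)%VS = U]].

Definition composition_series M (n : nat) (U : nat -> {vspace M}) : Prop :=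
  [/\ U 0%N = 0%VS, U n = fullv &
      forall i, (i < n)%N ->
        exists S, simple_mod S /\ subquotient (U i) (U i.+1) S].

Definition composition_factor M S : Prop :=
  exists n (U : nat -> {vspace M}),
    composition_series n U /\
    exists2 i, (i < n)%N & subquotient (U i) (U i.+1) S.

Definition sincere : Prop :=
  exists M : modcat, indecomposable M /\
    forall S, simple_mod S -> composition_factor M S.

(* A is basic: the regular module is a direct sum of pairwise nonisomorphic
   indecomposable modules. *)
Definition basic : Prop :=
  exists n (P : 'I_n -> modcat)
         (e : forall i, @hom K modcat (P i) regular_mod)
         (p : forall i, @hom K modcat regular_mod (P i)),
    [/\ forall i, indecomposable (P i),
        forall i, e i \> p i = idm (P i),
        forall i j, i <> j -> e i \> p j = 0,
        \sum_(i < n) (p i \> e i) = idm (regular_mod : modcat) &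
        forall i j, isomorphic (P i) (P j) -> i = j].

Definition piecewise_hereditary : Prop :=
  exists H : klin K,
    [/\ abelian H, hereditary H, split_idempotents H, hom_finite H &
        (exists T : H, tilting T) /\ triangle_equivalent modcat H].

Definition projective P : Prop :=
  forall M N (g : mhom M N) (f : mhom P N),
    (forall y, exists x, g x = y) -> exists h : mhom P M, mcomp h g = f.

Definition maximal_submodule M (U : {vspace M}) : Prop :=
  [/\ submodule U, U <> fullv &
      forall V : {vspace M}, submodule V -> (U <= V)%VS -> V = U \/ V = fullv].

Definition in_radical M (x : M) : Prop :=
  forall U : {vspace M}, maximal_submodule U -> x \in U.

Definition proj_cpx (P : cpx modcat) : Prop := forall i, projective (P i).

Definition radical_cpx (P : cpx modcat) : Prop :=
  forall i (x : (P i : rmod A)),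
    in_radical (mhom_val (diff P i : mhom (P i) (P (i + 1))) x).

Definition Kb_zero (P : cpx modcat) : Prop := homotopic (cid P) (czero P P).

Definition Kb_isomorphic (P Q : cpx modcat) : Prop :=
  exists (f : chom P Q) (g : chom Q P),
    homotopic (ccomp f g) (cid P) /\ homotopic (ccomp g f) (cid Q).

Definition Kb_indecomposable (P : cpx modcat) : Prop :=
  ~ Kb_zero P /\
  forall (Q R : cpx modcat), proj_cpx Q -> proj_cpx R ->
  forall (i1 : chom Q P) (i2 : chom R P) (p1 : chom P Q) (p2 : chom P R),
    homotopic (ccomp i1 p1) (cid Q) ->
    homotopic (ccomp i2 p2) (cid R) ->
    homotopic (ccomp i1 p2) (czero Q R) ->
    homotopic (ccomp i2 p1) (czero R Q) ->
    homotopic (fun i => ccomp p1 i1 i + ccomp p2 i2 i) (cid P) ->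
    Kb_zero Q \/ Kb_zero R.

(* The length of P is read off any radical complex Q isomorphic to P in the
   homotopy category. *)
Definition has_length (P : cpx modcat) (l : nat) : Prop :=
  exists Q : cpx modcat,
    [/\ proj_cpx Q, radical_cpx Q, Kb_isomorphic P Q &
        exists r s : int,
          [/\ r <= s, forall i, i < r \/ s < i -> is_zero (Q i),
              ~ is_zero (Q r), ~ is_zero (Q s) & s - r = l%:Z]].

Definition indec_length (l : nat) : Prop :=
  exists P : cpx modcat,
    [/\ proj_cpx P, Kb_indecomposable P & has_length P l].

Lemma asbool_ex (Q : nat -> Prop) : (exists n, Q n) -> exists n, `[< Q n >].
Proof. by case=> n /asboolP Qn; exists n. Qed.

(* The supremum of the lengths; [None] stands for infinity. *)
Definition strong_gldim : option nat :=
  if pselect (exists n, forall l, indec_length l -> (l <= n)%N) is left bnd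
  then Some (ex_minn (asbool_ex bnd)) else None.

End Modules.

(* Main.v *)
Require Import Defs.
From HB Require Import structures.
From mathcomp Require Import all_boot all_order all_algebra all_field.
From mathcomp Require Import boolp zify ring.
Require Import Defs.

Set Implicit Arguments.
Unset Strict Implicit.
Unset Printing Implicit Defensive.

Import GRing.Theory Num.Theory.
Local Open Scope ring_scope.

(* Let F be an equivalence from the bounded derived category of A to that of a
   hereditary abelian category H.  In the latter every object is a direct sum
   of shifted objects of H, so an object whose only idempotent endomorphisms
   are 0 and 1 is concentrated in a single degree, and a nonzero morphism from
   degree n to degree k forces k <= n <= k + 1.  Let m be the degree of F M for
   a sincere indecomposable module M, and t i that of F (P i) for the
   indecomposable projectives P i: as Hom (P i, M) <> 0, every t i is m or
   m + 1.  Let Q be an indecomposable radical complex living exactly in degrees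
   r to s, and q the degree of F Q.  Some P i placed in degree s maps nontrivially
   to Q, so q <= t i + s <= q + 1, and Q maps nontrivially to some P j placed in
   degree r, so t j + r <= q <= t j + r + 1; hence s - r <= 2 + t j - t i <= 3. *)

(** * Abelian categories *)

(** A morphism of the derived category is a formal composite modulo a congruence, so that two of
    them differ cannot be read off; a calculus of fractions yields an actual homotopy from any
    derivation of [deq]. The category H comes with neither elements nor enough projectives: diagrams
    are chased with generalized elements that may be refined along epimorphisms, and Ext vanishing,
    given for stalk complexes only, is spread to bounded complexes by peeling off one term at a
    time. The splitting of objects of the derived category of H is used in this form: if all
    idempotents are trivial, the top cohomology, being a direct summand, is everything. On the
    module side, indecomposability is stated in the homotopy category. Complexes of projectives
    embed fully faithfully in the derived category, and an idempotent up to homotopy is replaced by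
    a strict one through a polynomial in it, which can then be split degree by degree. *)

Section Abelian.
Variables (K : fieldType) (C : klin K).
Implicit Types X Y Z W V : C.

Lemma compBl X Y Z (f g : hom X Y) (h : hom Y Z) :
  (f - g) \> h = f \> h - g \> h.
Proof. by rewrite compDl compNl. Qed.

Lemma compBr X Y Z (f : hom X Y) (g h : hom Y Z) :
  f \> (g - h) = f \> g - f \> h.
Proof. by rewrite compDr compNr. Qed.

Lemma is_zero_src X Y (f : hom X Y) : is_zero X -> f = 0.
Proof. by move=> X0; rewrite -(comp1m f) X0 comp0m. Qed.

Lemma is_zero_tgt X Y (f : hom X Y) : is_zero Y -> f = 0.
Proof. by move=> Y0; rewrite -(compm1 f) Y0 compm0. Qed.

Lemma mono_eq0 X Y (f : hom X Y) W (g : hom W X) :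
  mono f -> g \> f = 0 -> g = 0.
Proof. by move=> fm gf; apply: fm; rewrite gf comp0m. Qed.

Lemma epi_eq0 X Y (f : hom X Y) W (g : hom Y W) :
  epi f -> f \> g = 0 -> g = 0.
Proof. by move=> fe gf; apply: fe; rewrite gf compm0. Qed.

Lemma monoI X Y (f : hom X Y) :
  (forall W (g : hom W X), g \> f = 0 -> g = 0) -> mono f.
Proof.
move=> f0 W g h gh; apply/eqP; rewrite -subr_eq0; apply/eqP/f0.
by rewrite compBl gh subrr.
Qed.

Lemma epiI X Y (f : hom X Y) :
  (forall W (g : hom Y W), f \> g = 0 -> g = 0) -> epi f.
Proof.
move=> f0 W g h gh; apply/eqP; rewrite -subr_eq0; apply/eqP/f0.
by rewrite compBr gh subrr.
Qed.

Lemma epi_id X : epi (idm X).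
Proof. by move=> W g h; rewrite !comp1m. Qed.

Lemma epi_comp X Y Z (f : hom X Y) (g : hom Y Z) :
  epi f -> epi g -> epi (f \> g).
Proof. by move=> fe ge W u v; rewrite !compA => /fe /ge. Qed.

Lemma is_iso_id X : is_iso (idm X).
Proof. by exists (idm X); rewrite comp1m. Qed.

Lemma is_iso_mono X Y (f : hom X Y) : is_iso f -> mono f.
Proof.
case=> g [fg _]; apply: monoI => W h hf.
by rewrite -(compm1 h) -fg -compA hf comp0m.
Qed.

Lemma is_iso_epi X Y (f : hom X Y) : is_iso f -> epi f.
Proof.
case=> g [_ gf]; apply: epiI => W h hf.
by rewrite -(comp1m h) -gf compA hf compm0.
Qed.

Lemma is_iso_zero X Y (f : hom X Y) : is_zero X -> is_zero Y -> is_iso f.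
Proof.
move=> X0 Y0; exists 0; rewrite comp0m compm0; split; exact: esym.
Qed.

Lemma kernel_mono Z X Y (k : hom Z X) (f : hom X Y) : is_kernel k f -> mono k.
Proof.
case=> kf kP W g h gh.
have [u [_ uq]] := kP _ (h \> k) (etrans (compA _ _ _) (etrans (f_equal _ kf) (compm0 _ _))).
by rewrite -(uq g gh) -(uq h).
Qed.

Lemma kernel_lift Z X Y (k : hom Z X) (f : hom X Y) W (g : hom W X) :
  is_kernel k f -> g \> f = 0 -> exists u : hom W Z, u \> k = g.
Proof. by case=> _ kP /kP [u [ug _]]; exists u. Qed.

Lemma cokernel_epi X Y Z (p : hom Y Z) (f : hom X Y) : is_cokernel p f -> epi p.
Proof.
case=> fp pP W g h gh.
have fph : f \> (p \> h) = 0 by rewrite -compA fp comp0m.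
by have [u [_ uq]] := pP _ _ fph; rewrite -(uq g gh) -(uq h).
Qed.

Lemma cokernel_desc X Y Z (p : hom Y Z) (f : hom X Y) W (g : hom Y W) :
  is_cokernel p f -> f \> g = 0 -> exists u : hom Z W, p \> u = g.
Proof. by case=> _ pP /pP [u [ug _]]; exists u. Qed.

Hypothesis abC : abelian C.

Lemma biprod_ex X Y : exists S (i1 : hom X S) (i2 : hom Y S) p1 p2,
  is_biprod i1 i2 p1 p2.
Proof. by case: abC. Qed.

Lemma kernel_ex X Y (f : hom X Y) : exists Z (k : hom Z X), is_kernel k f.
Proof. by case: abC. Qed.

Lemma cokernel_ex X Y (f : hom X Y) : exists Z (p : hom Y Z), is_cokernel p f.
Proof. by case: abC. Qed.

(** The axiom only makes [e] a cokernel of some [h]; since [h] is killed by [e], it factors through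
    any kernel [k], so [e] is a cokernel of [k] too. *)
Lemma epi_desc X Y (e : hom X Y) Z (k : hom Z X) W (g : hom X W) :
  epi e -> is_kernel k e -> k \> g = 0 -> exists u : hom Y W, e \> u = g.
Proof.
move=> ee kP kg; have [_ _ _ _ /(_ _ _ e ee) [Z' [h hP]]] := abC.
apply: (cokernel_desc hP).
by have [u <-] := kernel_lift kP hP.1; rewrite compA kg compm0.
Qed.

Lemma mono_lift X Y (m : hom X Y) Z (p : hom Y Z) W (y : hom W Y) :
  mono m -> is_cokernel p m -> y \> p = 0 -> exists x : hom W X, x \> m = y.
Proof.
move=> mm pP yp; have [_ _ _ /(_ _ _ m mm) [Z' [h hP]] _] := abC.
apply: (kernel_lift hP).
by have [u <-] := cokernel_desc pP hP.1; rewrite -compA yp comp0m.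
Qed.

Lemma mono_epi_iso X Y (f : hom X Y) : mono f -> epi f -> is_iso f.
Proof.
move=> fm fe; have [Z [p pP]] := cokernel_ex f.
have p0 : p = 0 by apply: (epi_eq0 fe); case: pP.
have [g gf] := mono_lift fm pP (etrans (comp1m p) p0).
exists g; split=> //; apply: fm; by rewrite compA gf compm1 comp1m.
Qed.

(** The pullback is the kernel of [f] on the biproduct, and [f] is epi because [e] is. A [w] killed
    by the leg to [Y] makes [p2 \> w] factor through [f] by some [u]; restricting to the summand [X]
    gives [e \> u = 0], so [u] and [w] vanish. *)
Lemma epi_pullback X Y Z (e : hom X Z) (g : hom Y Z) : epi e ->
  exists V (e' : hom V Y) (g' : hom V X), epi e' /\ e' \> g = g' \> e.
Proof.
move=> ee; have [S [i1 [i2 [p1 [p2 [i1p1 i2p2 i1p2 i2p1 ipS]]]]]] := biprod_ex X Y.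
pose f := p1 \> e - p2 \> g.
have fe : epi f.
  apply: epiI => W h fh; apply: (epi_eq0 ee).
  by rewrite -[RHS](compm0 W i1) -fh -compA /f compBr -!compA i1p1 i1p2 comp1m comp0m subr0.
have [V [k kP]] := kernel_ex f.
exists V, (k \> p2), (k \> p1); split; last first.
  apply/eqP; rewrite eq_sym -subr_eq0 !compA -compBr; apply/eqP; exact: kP.1.
apply: epiI => W w kw.
rewrite compA in kw; have [u fu] := epi_desc fe kP kw.
have u0 : u = 0.
  apply: (epi_eq0 ee); rewrite -[RHS](comp0m X w) -i1p2 compA -fu -compA.
  by rewrite /f compBr -!compA i1p1 i1p2 comp1m comp0m subr0.
by rewrite -(comp1m w) -i2p2 compA -fu u0 !compm0.
Qed.

(* A morphism [W -> Y] plays the role of an element of [Y]; existence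
   statements hold after passing to an epimorphism onto [W]. *)
Definition exact_at X Y Z (f : hom X Y) (g : hom Y Z) :=
  forall W (y : hom W Y), y \> g = 0 ->
  exists V (e : hom V W) (x : hom V X), epi e /\ e \> y = x \> f.

(** Since [f] factors as [q \> m] with [m] a kernel of [p], it suffices that [q] is epi. If [q]
    kills [g], then [f] factors through the subobject [k \> m]; its cokernel [c] kills [f], so
    factors through [p] and kills [m]. Hence [k] has a section and [g = 0]. *)
Lemma cokernel_exact X Y Z (f : hom X Y) (p : hom Y Z) :
  is_cokernel p f -> exact_at f p.
Proof.
move=> pP W y yp; have [I [m mP]] := kernel_ex p.
have mm := kernel_mono mP.
have [q qm] := kernel_lift mP pP.1.
have [z zm] := kernel_lift mP yp.
suff qe : epi q.
  have [V [e [x [ee ex]]]] := epi_pullback z qe.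
  by exists V, e, x; split=> //; rewrite -zm -qm -!compA ex.
apply: epiI => T g qg.
have [Z' [k kP]] := kernel_ex g.
have km : mono (k \> m).
  by apply: monoI => U h; rewrite -compA => /(mono_eq0 mm) /(mono_eq0 (kernel_mono kP)).
have [Q [c cP]] := cokernel_ex (k \> m).
have [u uk] := kernel_lift kP qg.
have fc : f \> c = 0 by rewrite -qm -uk (compA u) compA cP.1 compm0.
have [v pv] := cokernel_desc pP fc.
have mc : m \> c = 0 by rewrite -pv -compA mP.1 comp0m.
have [x xkm] := mono_lift km cP mc.
have xk : x \> k = idm I by apply: mm; rewrite compA xkm comp1m.
by rewrite -(comp1m g) -xk compA kP.1 compm0.
Qed.

End Abelian.

(** * Complexes and mapping cones *)

(** Reflection for identities in an additive group: two expressions agree once every atom has the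
    same integer coefficient in both. *)
Inductive zexpr := ZVar of nat | ZAdd of zexpr & zexpr | ZOpp of zexpr | ZZero.

Fixpoint zeval (V : zmodType) (env : seq V) (e : zexpr) : V :=
  match e with
  | ZVar k => env`_k
  | ZAdd e1 e2 => zeval env e1 + zeval env e2
  | ZOpp e1 => - zeval env e1
  | ZZero => 0
  end.

Fixpoint zcoef (e : zexpr) (k : nat) : int :=
  match e with
  | ZVar l => if l == k then 1 else 0
  | ZAdd e1 e2 => zcoef e1 k + zcoef e2 k
  | ZOpp e1 => - zcoef e1 k
  | ZZero => 0
  end.

Lemma zevalE (V : zmodType) (env : seq V) e :
  zeval env e = \sum_(k < size env) env`_k *~ zcoef e k.
Proof.
elim: e => [l|e1 IH1 e2 IH2|e1 IH1|] /=.
- have [ls|ls] := ltnP l (size env).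
    rewrite (bigD1 (Ordinal ls)) //= eqxx big1 ?addr0 // => k kl.
    by case: eqP => [lk|//]; case/eqP: kl; apply: val_inj; rewrite /= lk.
  rewrite nth_default // big1 // => k _.
  by case: eqP => // lk; move: ls (ltn_ord k); rewrite lk leqNgt => /negP.
- by rewrite IH1 IH2 -big_split; apply: eq_bigr => k _; rewrite mulrzDr.
- by rewrite IH1 -sumrN; apply: eq_bigr => k _; rewrite mulrNz.
- by rewrite big1.
Qed.

Lemma zeval_eq (V : zmodType) (env : seq V) e1 e2 :
  all (fun k => zcoef e1 k == zcoef e2 k) (iota 0 (size env)) ->
  zeval env e1 = zeval env e2.
Proof.
move=> /allP e12; rewrite !zevalE; apply: eq_bigr => k _.
by rewrite (eqP (e12 k _)) // mem_iota ltn_ord.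
Qed.

(* Atoms are compared up to conversion: a hom-group carries several convertible
   but syntactically different additive structures. *)
Ltac zindex t env :=
  match env with
  | ?a :: ?env' =>
    match constr:(Set) with
    | _ => let _ := constr:(erefl : a = t) in constr:(O)
    | _ => let k := zindex t env' in constr:(S k)
    end
  end.
Ltac zatoms env t :=
  lazymatch t with
  | @Algebra.add _ ?a ?b => let env1 := zatoms env a in zatoms env1 b
  | @Algebra.opp _ ?a => zatoms env a
  | @Algebra.zero _ => env
  | _ => match constr:(Set) with
         | _ => let _ := zindex t env in env
         | _ => constr:(t :: env)
         end
  end.
Ltac zreify env t :=
  lazymatch t with
  | @Algebra.add _ ?a ?b =>
      let x := zreify env a in let y := zreify env b in constr:(ZAdd x y)
  | @Algebra.opp _ ?a => let x := zreify env a in constr:(ZOpp x)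
  | @Algebra.zero _ => constr:(ZZero)
  | _ => let k := zindex t env in constr:(ZVar k)
  end.
Ltac zmod :=
  lazymatch goal with
  | |- @eq ?T ?a ?b =>
    let env0 := zatoms (@nil T) a in
    let env := zatoms env0 b in
    let x := zreify env a in
    let y := zreify env b in
    refine (@zeval_eq _ env x y _); vm_compute; reflexivity
  end.

(** * Transport along equalities of degrees *)

Section Transport.
Variables (K : fieldType) (C : klin K).

(** Degrees such as [i - 1 + 1] and [i] are equal without being convertible; a cast turned into a
    morphism can be composed and moved around by naturality. *)
Definition tr (O : int -> C) i j (e : i = j) : hom (O i) (O j) :=
  ecast k (hom (O i) (O k)) e (idm (O i)).

Lemma tr_nat (O O' : int -> C) (f : forall i, hom (O i) (O' i)) i j (e : i = j) :
  f i \> tr O' e = tr O e \> f j.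
Proof. by case: j / e; rewrite /tr /= compm1 comp1m. Qed.

Lemma tr_comp (O : int -> C) i j k (e : i = j) (e' : j = k) :
  tr O e \> tr O e' = tr O (etrans e e').
Proof. by case: k / e'; case: j / e; rewrite /tr /= compm1. Qed.

Lemma tr_id (O : int -> C) i (e : i = i) : tr O e = idm (O i).
Proof. by rewrite (eq_irrelevance e (erefl i)). Qed.

Lemma tr_iso (O : int -> C) i j (e : i = j) : is_iso (tr O e).
Proof. by case: j / e; exact: is_iso_id. Qed.

Lemma int_succ (j : int) : exists i, j = i + 1.
Proof. by exists (j - 1); rewrite subrK. Qed.

(** The components of a homotopy start in degrees of the form [i + 1], so chain maps built from them
    are first known only there. *)
Lemma unshift_family (O O' : int -> C) (g : forall i, hom (O (i + 1)) (O' (i + 1))) :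
  exists g' : forall j, hom (O j) (O' j), forall i, g' (i + 1) = g i.
Proof.
pose e (j : int) : j - 1 + 1 = j := subrK 1 j.
exists (fun j => ecast k (hom (O k) (O' k)) (e j) (g (j - 1))) => i.
move: (e (i + 1)); have -> : i + 1 - 1 = i by rewrite addrK.
by move=> e1; rewrite (eq_irrelevance e1 (erefl (i + 1))).
Qed.

Variables X Y : cpx C.

Definition dif i j (e : i + 1 = j) : hom (X i) (X j) := diff X i \> tr X e.

Lemma difE i : dif (erefl (i + 1)) = diff X i.
Proof. exact: compm1. Qed.

Lemma dif_tr i j k (e : i + 1 = j) (e' : j = k) :
  dif e \> tr X e' = dif (etrans e e').
Proof. by rewrite /dif compA tr_comp. Qed.

Lemma tr_dif i i' j (e : i = i') (e1 : i' + 1 = j) (e2 : i + 1 = j) :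
  tr X e \> dif e1 = dif e2.
Proof.
case: i' / e e1 => e1; rewrite (eq_irrelevance e1 e2).
by rewrite tr_id comp1m.
Qed.

End Transport.

Lemma dif_dif (K : fieldType) (C : klin K) (X : cpx C) i j k
    (e : i + 1 = j) (e' : j + 1 = k) : dif X e \> dif X e' = 0.
Proof. by case: k / e'; case: j / e; rewrite !difE diffK. Qed.

Lemma dif_nat (K : fieldType) (C : klin K) (X Y : cpx C) (f : chom X Y) i j
    (e : i + 1 = j) : dif X e \> f j = f i \> dif Y e.
Proof. by case: j / e; rewrite !difE cmapP. Qed.

(** * Chain homotopies *)

Section Homotopy.
Variables (K : fieldType) (C : klin K).
Implicit Types X Y Z W : cpx C.

Lemma homot_eq X Y (f g : chom X Y) : (forall i, f i = g i) -> homotopic f g.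
Proof.
by move=> fg; exists (fun=> 0) => i; rewrite fg subrr compm0 comp0m addr0.
Qed.

Lemma homot_refl X Y (f : chom X Y) : homotopic f f.
Proof. exact: homot_eq. Qed.

Lemma homot_sym X Y (f g : chom X Y) : homotopic f g -> homotopic g f.
Proof.
case=> h hP; exists (fun i => - h i) => i.
by rewrite compNr compNl -opprD -hP opprB.
Qed.

Lemma homot_trans X Y (f g h : chom X Y) :
  homotopic f g -> homotopic g h -> homotopic f h.
Proof.
case=> k kP [l lP]; exists (fun i => k i + l i) => i.
by rewrite compDr compDl addrACA -kP -lP addrA subrK.
Qed.

Lemma homot_compl X Y Z (f : chom X Y) (g h : chom Y Z) :
  homotopic g h -> homotopic (ccomp f g) (ccomp f h).
Proof.
case=> k kP; exists (fun i => f (i + 1) \> k i) => i /=.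
by rewrite -compBr kP compDr -!compA cmapP.
Qed.

Lemma homot_compr X Y Z (f g : chom X Y) (h : chom Y Z) :
  homotopic f g -> homotopic (ccomp f h) (ccomp g h).
Proof.
case=> k kP; exists (fun i => k i \> h i) => i /=.
by rewrite -compBl kP compDl !compA cmapP.
Qed.

Lemma homot_compA X Y Z W (f : chom X Y) (g : chom Y Z) (h : chom Z W) :
  homotopic (ccomp (ccomp f g) h) (ccomp f (ccomp g h)).
Proof. by apply: homot_eq => i /=; rewrite compA. Qed.

Lemma homot_comp0l X Y Z (f : chom X Y) (g : chom Y Z) :
  homotopic f (czero X Y) -> homotopic (ccomp f g) (czero X Z).
Proof.
move=> f0; apply: homot_trans (homot_compr g f0) _.
by apply: homot_eq => i /=; rewrite comp0m.
Qed.

Lemma homot_comp0r X Y Z (f : chom X Y) (g : chom Y Z) :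
  homotopic g (czero Y Z) -> homotopic (ccomp f g) (czero X Z).
Proof.
move=> g0; apply: homot_trans (homot_compl f g0) _.
by apply: homot_eq => i /=; rewrite compm0.
Qed.

Lemma homot_shift X Y (f g : chom X Y) :
  homotopic f g -> homotopic (cshift f) (cshift g).
Proof.
case=> h hP; exists (fun i => - h (i + 1)) => i /=.
by rewrite hP compNl !compNr opprK compNl opprK.
Qed.

End Homotopy.

(** * Mapping cones *)

Section Cone.
Variables (K : fieldType) (C : klin K).
Hypothesis abC : abelian C.
Implicit Types X Y Z W : cpx C.

Record biproduct (O O' : C) := Biproduct {
  bsum : C;
  binl : hom O bsum;
  binr : hom O' bsum;
  bprl : hom bsum O;
  bprr : hom bsum O';
  biproductP : is_biprod binl binr bprl bprr
}.

Lemma biproduct_ex (O O' : C) : exists B : biproduct O O', True.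
Proof.
have [S [i1 [i2 [p1 [p2 SP]]]]] := biprod_ex abC O O'.
by exists (Biproduct SP).
Qed.

Lemma cone_ex X Y (f : chom X Y) : exists Z v w, @is_cone K C X Y f Z v w.
Proof.
pose B i := sval (boolp.cid (biproduct_ex (X (i + 1)) (Y i))).
pose S i := bsum (B i).
pose j i : hom (X (i + 1)) (S i) := binl (B i).
pose v i : hom (Y i) (S i) := binr (B i).
pose w i : hom (S i) (X (i + 1)) := bprl (B i).
pose q i : hom (S i) (Y i) := bprr (B i).
have SP i : is_biprod (j i) (v i) (w i) (q i) := biproductP (B i).
have jw i : j i \> w i = idm _ by case: (SP i).
have vq i : v i \> q i = idm _ by case: (SP i).
have jq i : j i \> q i = 0 by case: (SP i).
have vw i : v i \> w i = 0 by case: (SP i).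
have id_S i : w i \> j i + q i \> v i = idm _ by case: (SP i).
pose d i : hom (S i) (S (i + 1)) := w i \> (- diff X (i + 1)) \> j (i + 1)
    + w i \> f (i + 1) \> v (i + 1) + q i \> diff Y i \> v (i + 1).
have dw i : d i \> w (i + 1) = w i \> - diff X (i + 1).
  by rewrite /d !compDl !compA jw vw compm1 !compm0 !addr0.
have dq i : d i \> q (i + 1) = w i \> f (i + 1) + q i \> diff Y i.
  by rewrite /d !compDl !compA jq vq !compm1 !compm0 add0r.
have vd i : v i \> d i = diff Y i \> v (i + 1).
  by rewrite /d !compDr -!compA vw vq !comp0m comp1m !add0r.
have dd i : d i \> d (i + 1) = 0.
  rewrite {2}/d !compDr -!compA !dw dq !compDl !compNr !compNl !compA.
  rewrite -!(compA (diff _ _)) !diffK !comp0m !compm0 !oppr0 cmapP !compA.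
  by rewrite add0r addr0 addNr.
have bnd : exists r s : int, forall i, ~~ ((r <= i) && (i <= s)) -> is_zero (S i).
  have [r [s rs]] := cpx_bounded X; have [r' [s' rs']] := cpx_bounded Y.
  exists (Num.min (r - 1) r'), (Num.max s s') => i iP.
  have X0 : is_zero (X (i + 1)) by apply: rs; lia.
  have Y0 : is_zero (Y i) by apply: rs'; lia.
  by rewrite /is_zero -id_S (is_zero_tgt (w i) X0) (is_zero_tgt (q i) Y0)
    !comp0m addr0.
pose Z := Cpx dd bnd.
have vP i : diff Y i \> v (i + 1) = v i \> diff Z i by rewrite vd.
have wP i : diff Z i \> w (i + 1) = w i \> diff (shift X) i by rewrite dw.
by exists Z, (@CHom _ _ Y Z v vP), (@CHom _ _ Z (shift X) w wP), j, q; split.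
Qed.

Section ConeTheory.
Variables (X Y Z : cpx C) (f : chom X Y) (v : chom Y Z) (w : chom Z (shift X)).
Variables (j : forall i : int, hom (X (i + 1)) (Z i)).
Variables (q : forall i : int, hom (Z i) (Y i)).
Hypothesis biP : forall i, is_biprod (j i) (v i) (w i) (q i).
Hypothesis dP : forall i, diff Z i = w i \> (- diff X (i + 1)) \> j (i + 1)
  + w i \> f (i + 1) \> v (i + 1) + q i \> diff Y i \> v (i + 1).

Lemma cone_jw i : j i \> w i = idm _. Proof. by case: (biP i). Qed.
Lemma cone_vq i : v i \> q i = idm _. Proof. by case: (biP i). Qed.
Lemma cone_jq i : j i \> q i = 0. Proof. by case: (biP i). Qed.
Lemma cone_vw i : v i \> w i = 0. Proof. by case: (biP i). Qed.
Lemma cone_id i : w i \> j i + q i \> v i = idm _. Proof. by case: (biP i). Qed.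

Lemma cone_elt i (U : C) (z : hom U (Z i)) : z = z \> w i \> j i + z \> q i \> v i.
Proof. by rewrite !compA -compDr cone_id compm1. Qed.

Lemma cone_dq i : diff Z i \> q (i + 1) = w i \> f (i + 1) + q i \> diff Y i.
Proof.
by rewrite dP !compDl !compA cone_jq cone_vq !compm1 !compm0 add0r.
Qed.

Lemma cone_jd i : j i \> diff Z i =
  f (i + 1) \> v (i + 1) - diff X (i + 1) \> j (i + 1).
Proof.
rewrite dP !compDr -!compA cone_jw cone_jq !comp0m !comp1m addr0 [LHS]addrC.
by rewrite compNl.
Qed.

Lemma cone_dw i : diff Z i \> w (i + 1) = - (w i \> diff X (i + 1)).
Proof. by rewrite cmapP /= compNr. Qed.

Lemma cone_vd i : v i \> diff Z i = diff Y i \> v (i + 1).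
Proof. by rewrite cmapP. Qed.

(** Exactness of Hom(W, -) at [Y] in the cone triangle: the [w] component of the null homotopy is
    the lift [g], its [q] component the homotopy from [a] to [ccomp g f]. *)
Lemma cone_lift W (a : chom W Y) : homotopic (ccomp a v) (czero W Z) ->
  exists g : chom W X, homotopic a (ccomp g f).
Proof.
case=> h /= hP.
have {}hP i : a (i + 1) \> v (i + 1) = diff W (i + 1) \> h (i + 1) + h i \> diff Z i.
  by rewrite -hP subr0.
have [g gP] := unshift_family (fun i => h i \> w i).
have gC i : diff W i \> g (i + 1) = g i \> diff X i.
  have [{}i ->] := int_succ i; rewrite !gP.
  have := f_equal (comp^~ (w (i + 1))) (hP i).
  rewrite compA cone_vw compm0 compDl !compA cone_dw compNr => /eqP.
  by rewrite eq_sym subr_eq0 => /eqP.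
exists (CHom gC), (fun i => h i \> q i) => i /=.
rewrite gP -[a _]compm1 -cone_vq -compA hP compDl !compA cone_dq compDr.
zmod.
Qed.

(** Exactness of Hom(W, -) at [Z]. The [q] component of [s] fails to be a chain map by
    [s \> w \> f]; subtracting [k \> f] repairs this. *)
Lemma cone_colift W (s : chom W Z) : homotopic (ccomp s w) (czero W (shift X)) ->
  exists t : chom W Y, homotopic s (ccomp t v).
Proof.
case=> k /= kP.
have {}kP i : s (i + 1) \> w (i + 1) =
    diff W (i + 1) \> k (i + 1) - k i \> diff X (i + 1).
  by rewrite -compNr -kP subr0.
have [t tP] := unshift_family (fun i => s (i + 1) \> q (i + 1) - k i \> f (i + 1)).
have tC i : diff W i \> t (i + 1) = t i \> diff Y i.
  have [{}i ->] := int_succ i; rewrite !tP !compBr !compBl -!compA cmapP.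
  rewrite (compA _ (diff Z _)) cone_dq compDr -compA kP compBl !compA /= cmapP.
  zmod.
exists (CHom tC), (fun i => k i \> j i) => i /=.
rewrite tP {1}[s _]cone_elt kP compBl compBl !compA cone_jd compBr.
zmod.
Qed.

Definition acyclic X := forall i, exact_at (diff X i) (diff X (i + 1)).

(** The two clauses are injectivity and surjectivity on the cohomology in degree [i + 1], written
    with generalized elements. *)
Definition qisE X Y (f : chom X Y) := forall i,
  (forall (W : C) (x : hom W (X (i + 1))) (y : hom W (Y i)),
     x \> diff X (i + 1) = 0 -> x \> f (i + 1) = y \> diff Y i ->
     exists V (e : hom V W) (x' : hom V (X i)), epi e /\ e \> x = x' \> diff X i) /\
  (forall (W : C) (y : hom W (Y (i + 1))), y \> diff Y (i + 1) = 0 ->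
     exists V (e : hom V W) (x : hom V (X (i + 1))) (y' : hom V (Y i)),
     [/\ epi e, x \> diff X (i + 1) = 0 & e \> y = x \> f (i + 1) + y' \> diff Y i]).

(** For a cocycle (x, y) of the cone, [x] is a cocycle whose image bounds [- y], so injectivity
    bounds [x] by some [x']. Then [y] corrected by [x' \> f] is a cocycle of [Y], which surjectivity
    writes as the image of a cocycle [x''] plus a boundary. *)
Lemma cone_acyclic : qisE f -> acyclic Z.
Proof.
move=> fq i W z zd.
set x := z \> w (i + 1); set y := z \> q (i + 1).
have xd : x \> diff X (i + 1 + 1) = 0.
  by apply/eqP; rewrite -oppr_eq0 /x compA -compNr -cone_dw -compA zd comp0m.
have xy : x \> f (i + 1 + 1) = (- y) \> diff Y (i + 1).
  apply/eqP; rewrite -subr_eq0 compNl opprK /x /y !compA -compDr -cone_dq.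
  by rewrite -compA zd comp0m.
have zE : z = x \> j (i + 1) + y \> v (i + 1) by exact: cone_elt.
clearbody x y.
have [V [e [x' [ee ex]]]] := (fq (i + 1)).1 _ _ _ xd xy.
have cyc : (e \> y + x' \> f (i + 1)) \> diff Y (i + 1) = 0.
  rewrite compDl !compA -cmapP -(compA x') -ex compA xy compNl compNr.
  zmod.
have [V' [e' [x'' [y'' [ee' x''d yx]]]]] := (fq i).2 _ _ cyc.
exists V', (e' \> e), ((x'' - e' \> x') \> j i + y'' \> v i); split.
  exact: epi_comp.
rewrite compDl !compA cone_jd cone_vd compBr -!compA !compBl x''d.
rewrite !(compA e') -ex -compA; rewrite compDr in yx.
rewrite (_ : y'' \> diff Y i = e' \> (e \> y) + e' \> (x' \> f (i + 1)) - x'' \> f (i + 1));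
  last by rewrite yx addrAC subrr add0r.
rewrite zE !compDr !compBl !compDl !compA comp0m.
zmod.
Qed.

(** The kernel of [w] is [Y]: lifting along [w] leaves error terms that are cocycles of [Y], and
    these are boundaries by acyclicity. *)
Lemma cone_proj_qis : acyclic Y -> qisE w.
Proof.
move=> Yac i; split=> [W z x zd zx | W x xd].
  pose z1 := z - x \> j i \> diff Z i.
  have z1w : z1 \> w (i + 1) = 0.
    rewrite /z1 compBl zx (compA _ (diff Z i)) cone_dw /=.
    rewrite !compNr !compA -(compA (j i)) cone_jw comp1m; zmod.
  have z1E : z1 = z1 \> q (i + 1) \> v (i + 1) by rewrite {1}[z1]cone_elt z1w comp0m add0r.
  have z1d : z1 \> q (i + 1) \> diff Y (i + 1) = 0.
    have : z1 \> (diff Z (i + 1) \> q (i + 1 + 1)) = 0.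
      by rewrite -compA /z1 compBl zd (compA _ (diff Z i)) diffK compm0 subr0 comp0m.
    by rewrite cone_dq compDr -!compA z1w comp0m add0r.
  have [V [e [y [ee ey]]]] := Yac _ _ _ z1d.
  exists V, e, (e \> x \> j i + y \> v i); split=> //.
  rewrite compDl (compA y) cone_vd -compA -ey !compA -(compA z1) -z1E.
  by rewrite -compDr /z1; congr (e \> _); rewrite !compA; zmod.
have {}xd : x \> diff X (i + 1 + 1) = 0.
  by move: xd => /=; rewrite compNr => /eqP; rewrite oppr_eq0 => /eqP.
have xfd : x \> f (i + 1 + 1) \> diff Y (i + 1 + 1) = 0.
  by rewrite compA -(cmapP f) -compA xd comp0m.
have [V [e [y [ee ey]]]] := Yac (i + 1) _ _ xfd.
exists V, e, (e \> x \> j (i + 1) - y \> v (i + 1)), 0; split=> //.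
  rewrite compBl (compA y) cone_vd -(compA y) -ey (compA _ (j _)) cone_jd compBr.
  rewrite -(compA _ (diff X _)) (compA e x (diff X _)) xd compm0 comp0m !compA.
  zmod.
by rewrite comp0m addr0 compBl !compA cone_jw cone_vw !compm1 compm0 subr0.
Qed.

(** By [cone_dq], the failure of [q] to be a chain map is exactly [w] followed by [f], so [q] is the
    null homotopy. *)
Lemma cone_null : homotopic (ccomp w (cshift f)) (czero Z (shift Y)).
Proof.
exists (fun i => q (i + 1)) => i /=.
by rewrite subr0 cone_dq compNr addrK.
Qed.

End ConeTheory.
End Cone.

(** * Quasi-isomorphisms and the Ore condition *)

Section Qis.
Variables (K : fieldType) (C : klin K).
Hypothesis abC : abelian C.
Implicit Types X Y Z W : cpx C.

Lemma cohomology_ex X i : exists H : cohomology X i, True.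
Proof.
have [Z [k kP]] := kernel_ex abC (diff X (i + 1)).
have [b bk] := kernel_lift kP (diffK X i).
have [H [p pP]] := cokernel_ex abC b.
by exists (Cohomology kP bk pP).
Qed.

(** Eliminates the existentially chosen cohomology objects of [qis]. Conversely, the induced map on
    any chosen cohomology objects is shown to be mono and epi. *)
Lemma qisP X Y (f : chom X Y) : qis f <-> qisE f.
Proof.
split=> [fq i | fq i].
  have [HX [HY [z [h [zi ph [g [hg gh]]]]]]] := fq i.
  have Zm := kernel_mono (coh_inclP HY).
  split=> [W x y xd xy | W y yd].
    have [x1 x1E] := kernel_lift (coh_inclP HX) xd.
    have x1z : x1 \> z = y \> coh_bd HY.
      by apply: Zm; rewrite compA zi -compA x1E xy compA coh_bdP.
    have x1p : x1 \> coh_proj HX = 0.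
      rewrite -[LHS]compm1 -hg -compA (compA x1) ph -(compA x1) x1z !compA.
      by rewrite -(compA (coh_bd HY)) (coh_projP HY).1 comp0m compm0.
    have [V [e [x' [ee ex]]]] := cokernel_exact abC (coh_projP HX) x1p.
    by exists V, e, x'; split=> //; rewrite -x1E -compA ex compA coh_bdP.
  have [y1 y1E] := kernel_lift (coh_inclP HY) yd.
  have [V [e [x1 [ee ex]]]] :=
    epi_pullback abC (y1 \> coh_proj HY \> g) (cokernel_epi (coh_projP HX)).
  have d0 : (e \> y1 - x1 \> z) \> coh_proj HY = 0.
    rewrite compBl (compA x1) -ph -(compA x1) -ex !compA gh compm1.
    by rewrite subrr.
  have [V' [e' [y' [ee' ey]]]] := cokernel_exact abC (coh_projP HY) d0.
  exists V', (e' \> e), (e' \> x1 \> coh_incl HX), y'; split.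
  - exact: epi_comp.
  - by rewrite !compA (coh_inclP HX).1 !compm0.
  - rewrite -(coh_bdP HY) -(compA y') -ey -y1E compBr compBl !compA zi.
    zmod.
have [HX _] := cohomology_ex X i; have [HY _] := cohomology_ex Y i.
exists HX, HY.
have [z zi] : exists z, z \> coh_incl HY = coh_incl HX \> f (i + 1).
  apply: kernel_lift (coh_inclP HY) _.
  by rewrite compA -cmapP -compA (coh_inclP HX).1 comp0m.
have Zm := kernel_mono (coh_inclP HY).
have Xm := kernel_mono (coh_inclP HX).
have bz : coh_bd HX \> z = f i \> coh_bd HY.
  by apply: Zm; rewrite !compA zi -compA !coh_bdP cmapP.
have [h ph] : exists h, coh_proj HX \> h = z \> coh_proj HY.
  apply: cokernel_desc (coh_projP HX) _.
  by rewrite -compA bz compA (coh_projP HY).1 compm0.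
exists z, h; split=> //; apply: mono_epi_iso => //.
  apply: monoI => W c ch.
  have [V [e [x [ee ex]]]] := epi_pullback abC c (cokernel_epi (coh_projP HX)).
  have xz : x \> z \> coh_proj HY = 0.
    by rewrite compA -ph -compA -ex compA ch compm0.
  have [V1 [e1 [y [ee1 ey]]]] := cokernel_exact abC (coh_projP HY) xz.
  have cyc : (e1 \> x \> coh_incl HX) \> diff X (i + 1) = 0.
    by rewrite !compA (coh_inclP HX).1 !compm0.
  have eqf : (e1 \> x \> coh_incl HX) \> f (i + 1) = y \> diff Y i.
    by rewrite compA -zi -(coh_bdP HY) -(compA y) -ey !compA.
  have [V2 [e2 [x' [ee2 ex']]]] := (fq i).1 _ _ _ cyc eqf.
  have {}ex' : e2 \> (e1 \> x) = x' \> coh_bd HX.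
    by apply: Xm; rewrite !compA coh_bdP -ex' !compA.
  apply: (epi_eq0 ee); apply: (epi_eq0 ee1); apply: (epi_eq0 ee2).
  by rewrite ex -(compA e1) -compA ex' compA (coh_projP HX).1 compm0.
apply: epiI => W g hg; apply: (epi_eq0 (cokernel_epi (coh_projP HY))).
have [V [e [x [y' [ee xd ey]]]]] := (fq i).2 _ _ (coh_inclP HY).1.
have [x1 x1E] := kernel_lift (coh_inclP HX) xd.
have eE : e = x1 \> z + y' \> coh_bd HY.
  by apply: Zm; rewrite ey compDl !compA coh_bdP zi -x1E compA.
apply: (epi_eq0 ee).
rewrite -compA eE !compDl (compA y') (coh_projP HY).1 compm0 comp0m addr0.
by rewrite (compA x1) -ph !compA hg !compm0.
Qed.

Lemma qisE_homotopic X Y (f g : chom X Y) : homotopic f g -> qisE f -> qisE g.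
Proof.
case=> h hP fq i; split=> [W x y xd xy | W y yd].
  have xf : x \> f (i + 1) = (x \> h i + y) \> diff Y i.
    rewrite compDl -xy; apply/eqP; rewrite -subr_eq -compBr hP compDr -compA xd.
    by rewrite comp0m add0r compA.
  exact: (fq i).1 xd xf.
have [V [e [x [y' [ee xd ey]]]]] := (fq i).2 _ _ yd.
exists V, e, x, (y' + x \> h i); split=> //.
rewrite ey compDl compA -[h i \> _](addKr (diff X (i + 1) \> h (i + 1))) -hP.
by rewrite compDr compNr -(compA x) xd comp0m compBr; zmod.
Qed.

Lemma qisE_comp X Y Z (f : chom X Y) (g : chom Y Z) :
  qisE f -> qisE g -> qisE (ccomp f g).
Proof.
move=> fq gq i; split=> [W x z xd /= xz | W z zd].
  have xfd : x \> f (i + 1) \> diff Y (i + 1) = 0.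
    by rewrite compA -cmapP -compA xd comp0m.
  rewrite -compA in xz; have [V [e [y [ee ey]]]] := (gq i).1 _ _ _ xfd xz.
  have exd : e \> x \> diff X (i + 1) = 0 by rewrite compA xd compm0.
  rewrite -compA in ey; have [V' [e' [x' [ee' ex]]]] := (fq i).1 _ _ _ exd ey.
  by exists V', (e' \> e), x'; split; [exact: epi_comp | rewrite compA].
have [V [e [y [z' [ee yd ez]]]]] := (gq i).2 _ _ zd.
have [V' [e' [x [y' [ee' xd ey]]]]] := (fq i).2 _ _ yd.
exists V', (e' \> e), x, (y' \> g i + e' \> z'); split=> //; first exact: epi_comp.
rewrite compA ez compDr -compA ey !compDl !compA /= cmapP.
zmod.
Qed.

Lemma qisE_left X Y Z (f : chom X Y) (g : chom Y Z) :
  qisE (ccomp f g) -> qisE g -> qisE f.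
Proof.
move=> fgq gq i; split=> [W x y xd xy | W y yd].
  have xz : x \> ccomp f g (i + 1) = (y \> g i) \> diff Z i.
    by rewrite /= -compA xy !compA cmapP.
  exact: (fgq i).1 xd xz.
have ygd : y \> g (i + 1) \> diff Z (i + 1) = 0.
  by rewrite compA -cmapP -compA yd comp0m.
have [V [e [x [z [ee xd /= ey]]]]] := (fgq i).2 _ _ ygd.
have d0 : (e \> y - x \> f (i + 1)) \> diff Y (i + 1) = 0.
  by rewrite compBl !compA yd -cmapP -(compA x) xd comp0m compm0 subr0.
have dg : (e \> y - x \> f (i + 1)) \> g (i + 1) = z \> diff Z i.
  by rewrite compBl !compA ey; zmod.
have [V' [e' [y' [ee' ey']]]] := (gq i).1 _ _ _ d0 dg.
exists V', (e' \> e), (e' \> x), y'; split; first exact: epi_comp.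
  by rewrite compA xd compm0.
by rewrite -ey' compBr !compA; zmod.
Qed.

Lemma ciso_qisE X Y (f : chom X Y) : (forall i, is_iso (f i)) -> qisE f.
Proof.
move=> fi i; split=> [W x y xd xy | W y yd].
  have [g [fg gf]] := fi i; exists W, (idm W), (y \> g); split; first exact: epi_id.
  rewrite comp1m; apply: (is_iso_mono (fi (i + 1))).
  by rewrite xy !compA cmapP -(compA g) gf comp1m.
have [g [fg gf]] := fi (i + 1).
exists W, (idm W), (y \> g), 0; split; first exact: epi_id.
  apply: (is_iso_mono (fi (i + 1 + 1))).
  by rewrite !compA cmapP -(compA g) gf comp1m yd comp0m.
by rewrite comp1m compA gf compm1 comp0m addr0.
Qed.

Lemma qisE_id X : qisE (cid X).
Proof. by apply: ciso_qisE => i; exact: is_iso_id. Qed.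

(** Together with [qisE_surj], the clauses of [qisE] with the degree equalities left free, as
    reindexed complexes require. *)
Lemma qisE_inj X Y (f : chom X Y) i j k (e : i + 1 = j) (e' : j + 1 = k)
    (W : C) (x : hom W (X j)) (y : hom W (Y i)) :
  qisE f -> x \> dif X e' = 0 -> x \> f j = y \> dif Y e ->
  exists V (c : hom V W) (x' : hom V (X i)), epi c /\ c \> x = x' \> dif X e.
Proof.
case: k / e'; case: j / e x => x fq; rewrite !difE => xd xy.
exact: (fq i).1 xd xy.
Qed.

Lemma qisE_surj X Y (f : chom X Y) i j k (e : i + 1 = j) (e' : j + 1 = k)
    (W : C) (y : hom W (Y j)) :
  qisE f -> y \> dif Y e' = 0 ->
  exists V (c : hom V W) (x : hom V (X j)) (y' : hom V (Y i)),
  [/\ epi c, x \> dif X e' = 0 & c \> y = x \> f j + y' \> dif Y e].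
Proof.
case: k / e'; case: j / e y => y fq; rewrite !difE => yd.
exact: (fq i).2 yd.
Qed.

End Qis.

(** * Reindexed complexes *)

Section Translation.
Variables (K : fieldType) (C : klin K).
Implicit Types X Y Z W : cpx C.

(* Unlike [shift], [transl] does not change the sign of the differential. *)
Definition transl (k : int) X : cpx C.
Proof.
refine (@Cpx K C (fun i => X (i + k)) (fun i => dif X (addrAC i k 1)) _ _).
  by move=> i; exact: dif_dif.
have [r [s rs]] := cpx_bounded X; exists (r - k), (s - k) => i iP; apply: rs; lia.
Defined.

Definition ctransl k X Y (f : chom X Y) : chom (transl k X) (transl k Y).
Proof. refine (@CHom K C (transl k X) (transl k Y) (fun i => f (i + k)) _) => i.
exact: (dif_nat f). Defined.

(** Compensates the sign in [shift]: [negc (transl (- 1) (shift X))] is isomorphic to [X] through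
    casts alone. *)
Definition negc X : cpx C.
Proof.
refine (@Cpx K C (fun i => X i) (fun i => - diff X i) _ (cpx_bounded X)).
by move=> i; rewrite compNl compNr diffK !oppr0.
Defined.

Definition cnegc X Y (f : chom X Y) : chom (negc X) (negc Y).
Proof.
by refine (@CHom K C (negc X) (negc Y) (fun i => f i) _) => i; rewrite /= compNl compNr (cmapP f).
Defined.

Lemma tr_fun (O : int -> C) (g : int -> int) i j (e : i = j) :
  tr (fun k => O (g k)) e = tr O (f_equal g e).
Proof. by case: j / e. Qed.

Definition transl_transl k X : chom (transl (- k) (transl k X)) X.
Proof.
refine (@CHom K C (transl (- k) (transl k X)) X (fun i => tr X (subrK k i)) _) => i.
rewrite /= {1}/dif /= (tr_fun X (fun j => j + k)) dif_tr dif_tr -(difE X).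
by symmetry; apply: tr_dif.
Defined.

Definition negc_transl_shift X : chom (negc (transl (- 1) (shift X))) X.
Proof.
refine (@CHom K C (negc (transl (- 1) (shift X))) X (fun i => tr X (subrK 1 i)) _) => i.
rewrite /= /dif /= (tr_fun X (fun j => j + 1)) !compNl opprK -(difE X) dif_tr dif_tr -(difE X).
by symmetry; apply: tr_dif.
Defined.

Lemma transl_transl_nat k X Y (f : chom X Y) i :
  transl_transl k X i \> f i = ctransl (- k) (ctransl k f) i \> transl_transl k Y i.
Proof. by rewrite /= tr_nat. Qed.

Lemma homotopic_dif X Y (f g : chom X Y) h :
  (forall i, f (i + 1) - g (i + 1) = diff X (i + 1) \> h (i + 1) + h i \> diff Y i) ->
  forall i j k (e : i + 1 = j) (e' : j + 1 = k) (e1 : k = j + 1) (e2 : j = i + 1),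
  f j - g j = dif X e' \> (tr X e1 \> h j) + (tr X e2 \> h i) \> dif Y e.
Proof.
move=> hP i j k e; case: k / => e1 e2; case: j / e e1 e2 => e1 e2.
by rewrite !difE !tr_id !comp1m.
Qed.

Lemma homotopic_transl k X Y (f g : chom X Y) :
  homotopic f g -> homotopic (ctransl k f) (ctransl k g).
Proof.
case=> h hP; exists (fun i => tr X (addrAC i 1 k) \> h (i + k)) => i.
exact: (homotopic_dif hP).
Qed.

Lemma homotopic_negc X Y (f g : chom X Y) :
  homotopic f g -> homotopic (cnegc f) (cnegc g).
Proof.
case=> h hP; exists (fun i => - h i) => i /=.
by rewrite hP compNl !compNr compNl !opprK.
Qed.

Lemma qisE_transl k X Y (f : chom X Y) : qisE f -> qisE (ctransl k f).
Proof.
move=> fq i; split=> [W x y xd xy | W y yd].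
  exact: (@qisE_inj _ _ X Y f _ _ _ _ (addrAC (i + 1) k 1) W x y fq xd xy).
exact: (@qisE_surj _ _ X Y f _ _ _ _ (addrAC (i + 1) k 1) W y fq yd).
Qed.

Lemma qisE_negc X Y (f : chom X Y) : qisE f -> qisE (cnegc f).
Proof.
move=> fq i; split=> [W x y | W y] /=.
  rewrite !compNr => /eqP; rewrite oppr_eq0 => /eqP xd xy.
  have {}xy : x \> f (i + 1) = (- y) \> diff Y i by rewrite compNl.
  have [V [e [x' [ee ex]]]] := (fq i).1 _ _ _ xd xy.
  by exists V, e, (- x'); rewrite compNl compNr opprK.
rewrite compNr => /eqP; rewrite oppr_eq0 => /eqP yd.
have [V [e [x [y' [ee xd ey]]]]] := (fq i).2 _ _ yd.
exists V, e, x, (- y'); split=> //; first by rewrite compNr xd oppr0.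
by rewrite compNl compNr opprK.
Qed.

End Translation.

Section Ore.
Variables (K : fieldType) (C : klin K).
Hypothesis abC : abelian C.
Implicit Types X Y Z W : cpx C.

(** Desuspension: as [shift] has an inverse only up to degree casts, the quasi-isomorphism is
    reindexed, its differential is negated, and the casts of [negc_transl_shift] bring it back to
    [X]. *)
Lemma unshift_ex X Z (w : chom Z (shift X)) : qisE w ->
  exists X' (u : chom X' X), qisE u /\
  forall Y (f : chom X Y), homotopic (ccomp w (cshift f)) (czero Z (shift Y)) ->
    homotopic (ccomp u f) (czero X' Y).
Proof.
move=> wq; exists (negc (transl (- 1) Z)).
exists (ccomp (cnegc (ctransl (- 1) w)) (negc_transl_shift X)); split.
  apply: qisE_comp => //; first exact/qisE_negc/qisE_transl.
  by apply: ciso_qisE => i; exact: tr_iso.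
move=> Y f /(homotopic_transl (- 1)) /homotopic_negc h0.
apply: homot_trans (_ : homotopic (ccomp (ccomp (cnegc (ctransl (- 1) w))
    (cnegc (ctransl (- 1) (cshift f)))) (negc_transl_shift Y)) _).
  by apply: homot_eq => i; rewrite /= !compA tr_nat.
apply: homot_comp0l; apply: homot_trans h0; exact: homot_eq.
Qed.

(** With [Y] acyclic the cone projection [w] is a quasi-isomorphism onto [shift X], and followed by
    the shift of [f] it is null homotopic; [u] is its desuspension. *)
Lemma acyclic_null X Y (f : chom X Y) : acyclic Y ->
  exists X' (u : chom X' X), qisE u /\ homotopic (ccomp u f) (czero X' Y).
Proof.
move=> Yac; have [Z [v [w [j [q [biP dP]]]]]] := cone_ex abC f.
have [X' [u [uq uP]]] := unshift_ex (cone_proj_qis biP dP Yac).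
by exists X', u; split=> //; apply: uP; exact: cone_null biP dP.
Qed.

(** The cone of [t] is acyclic, so some quasi-isomorphism [u] kills [a] followed by the inclusion
    into the cone; then [ccomp u a] lifts along [t]. *)
Lemma ore W Y Z (a : chom W Y) (t : chom Z Y) : qisE t ->
  exists W' (u : chom W' W) (b : chom W' Z),
    qisE u /\ homotopic (ccomp u a) (ccomp b t).
Proof.
move=> tq; have [E [v [w [j [q [biP dP]]]]]] := cone_ex abC t.
have [W' [u [uq u0]]] := acyclic_null (ccomp a v) (cone_acyclic biP dP tq).
have uav0 : homotopic (ccomp (ccomp u a) v) (czero W' E).
  exact: homot_trans (homot_compA _ _ _) u0.
by have [g gP] := cone_lift biP dP uav0; exists W', u, g.
Qed.

Definition csub X Y (f g : chom X Y) : chom X Y.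
Proof.
by refine (@CHom K C X Y (fun i => f i - g i) _) => i; rewrite compBl compBr !cmapP.
Defined.

Lemma csub_eq0 X Y (f g : chom X Y) :
  homotopic (csub f g) (czero X Y) <-> homotopic f g.
Proof. by split=> -[h hP]; exists h => i; rewrite -hP /= subr0. Qed.

(** The difference [a - b] and the homotopy [k] are the two components of a chain map from [shift W]
    to the cone of [t]. The cone being acyclic, a quasi-isomorphism kills this map, hence also its
    projection, the shift of [a - b]. *)
Lemma ore_cancel W Y Z (a b : chom W Y) (t : chom Y Z) : qisE t ->
  homotopic (ccomp a t) (ccomp b t) ->
  exists W' (u : chom W' W), qisE u /\ homotopic (ccomp u a) (ccomp u b).
Proof.
move=> tq [k kP]; have [E [v [w [j [q [biP dP]]]]]] := cone_ex abC t.
have cP i : diff (shift W) i \> ((a (i + 1 + 1) - b (i + 1 + 1)) \> j (i + 1)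
      - k (i + 1) \> v (i + 1)) =
    ((a (i + 1) - b (i + 1)) \> j i - k i \> v i) \> diff E i.
  rewrite compBr !compBl !compA (cone_jd biP dP) cone_vd /= !compBr.
  have := f_equal (fun z => z \> v (i + 1)) (kP i).
  rewrite /= !(compBl, compDl, compA) => kv.
  rewrite !compNl -!(compA (diff W _)) (cmapP a) (cmapP b) -!compA.
  move: kv; rewrite -!compA => kv.
  rewrite (_ : k i \> diff Z i \> v (i + 1) = a (i + 1) \> t (i + 1) \> v (i + 1)
    - b (i + 1) \> t (i + 1) \> v (i + 1) - diff W (i + 1) \> k (i + 1) \> v (i + 1));
    last by rewrite kv; zmod.
  zmod.
have [W' [u [uq u0]]] := acyclic_null (@CHom _ _ (shift W) E _ cP) (cone_acyclic biP dP tq).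
have [W2 [u2 [u2q u2P]]] := unshift_ex uq.
exists W2, u2; split=> //; apply/csub_eq0.
apply: homot_trans (_ : homotopic (ccomp u2 (csub a b)) _).
  by apply: homot_eq => i; rewrite /= compBr.
apply: u2P; apply: homot_trans (homot_comp0l w u0); apply: homot_eq => i /=.
rewrite !compA compBl !compA (cone_jw biP) (cone_vw biP) compm1 compm0.
by rewrite subr0.
Qed.

End Ore.

(** * Calculus of fractions *)

Section Roofs.
Variables (K : fieldType) (C : klin K).
Hypothesis abC : abelian C.
Implicit Types X Y Z W V : cpx C.

Record roof V Y := Roof {
  rsrc : cpx C;
  rqis : chom rsrc V;
  rqisP : qisE rqis;
  rmor : chom rsrc Y
}.

Definition roof_post V Y Z (r : roof V Y) (f : chom Y Z) : roof V Z :=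
  Roof (rqisP r) (ccomp (rmor r) f).

Definition requiv V Y (r r' : roof V Y) : Prop :=
  exists W (t : chom W (rsrc r)) (t' : chom W (rsrc r')),
    [/\ qisE t, qisE t', homotopic (ccomp t (rqis r)) (ccomp t' (rqis r')) &
        homotopic (ccomp t (rmor r)) (ccomp t' (rmor r'))].

Lemma requiv_refl V Y (r : roof V Y) : requiv r r.
Proof.
exists (rsrc r), (cid _), (cid _).
by split; do ?[exact: qisE_id | exact: homot_refl].
Qed.

Lemma requiv_sym V Y (r r' : roof V Y) : requiv r r' -> requiv r' r.
Proof.
case=> W [t [t' [tq t'q ts ta]]]; exists W, t', t.
by split=> //; exact: homot_sym.
Qed.

(** An Ore square over the middle roof joins the two refinements; its leg [b] is a quasi-isomorphism
    by two-out-of-three. *)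
Lemma requiv_trans V Y (r1 r2 r3 : roof V Y) :
  requiv r1 r2 -> requiv r2 r3 -> requiv r1 r3.
Proof.
case=> W [t1 [t2 [t1q t2q ts ta]]] [W' [t2' [t3 [t2'q t3q ts' ta']]]].
have [U [u [b [uq ub]]]] := ore abC t2 t2'q.
have bq : qisE b.
  apply: (qisE_left _ t2'q); apply: (qisE_homotopic ub).
  exact: qisE_comp.
have step Q (x1 : chom _ Q) (x2 : chom _ Q) (x3 : chom _ Q) :
    homotopic (ccomp t1 x1) (ccomp t2 x2) ->
    homotopic (ccomp t2' x2) (ccomp t3 x3) ->
    homotopic (ccomp (ccomp u t1) x1) (ccomp (ccomp b t3) x3).
  move=> h12 h23.
  apply: homot_trans (homot_compA _ _ _) _.
  apply: homot_trans (homot_compl u h12) _.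
  apply: homot_trans (homot_sym (homot_compA _ _ _)) _.
  apply: homot_trans (homot_compr x2 ub) _.
  apply: homot_trans (homot_compA _ _ _) _.
  apply: homot_trans (homot_compl b h23) _.
  exact: homot_sym (homot_compA _ _ _).
exists U, (ccomp u t1), (ccomp b t3).
by split; [exact: qisE_comp | exact: qisE_comp | exact: step ts ts' | exact: step ta ta'].
Qed.

Lemma requiv_post V Y Z (r r' : roof V Y) (f : chom Y Z) :
  requiv r r' -> requiv (roof_post r f) (roof_post r' f).
Proof.
case=> W [t [t' [tq t'q ts ta]]]; exists W, t, t'; split=> //.
apply: homot_trans (homot_sym (homot_compA _ _ _)) _.
by apply: homot_trans (homot_compr f ta) _; exact: homot_compA.
Qed.

Lemma requiv_eq V Y W (s s' : chom W V) (sq : qisE s) (sq' : qisE s') (a a' : chom W Y) :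
  homotopic s s' -> homotopic a a' -> requiv (Roof sq a) (Roof sq' a').
Proof.
move=> ss' aa'; exists W, (cid _), (cid _).
by split; do ?[exact: qisE_id | exact: homot_compl].
Qed.

Lemma requiv_post_homotopic V Y Z (r : roof V Y) (f g : chom Y Z) :
  homotopic f g -> requiv (roof_post r f) (roof_post r g).
Proof. by move=> fg; apply: requiv_eq (homot_refl _) _; exact: homot_compl. Qed.

Lemma requiv_postA V Y Z T (r : roof V Y) (f : chom Y Z) (g : chom Z T) :
  requiv (roof_post (roof_post r f) g) (roof_post r (ccomp f g)).
Proof. by apply: requiv_eq (homot_refl _) _; exact: homot_compA. Qed.

Lemma requiv_post1 V Y (r : roof V Y) : requiv (roof_post r (cid Y)) r.
Proof.
case: r => W s sq a; apply: requiv_eq (homot_refl _) _.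
by apply: homot_eq => i; rewrite /= compm1.
Qed.

(** With [requiv_lift], this makes composition with a quasi-isomorphism a bijection on classes of
    roofs, so that formal inverses can act. *)
Lemma requiv_cancel V Y Z (r r' : roof V Y) (s : chom Y Z) : qisE s ->
  requiv (roof_post r s) (roof_post r' s) -> requiv r r'.
Proof.
move=> sq [W [t [t' [tq t'q ts ta]]]].
have {}ta : homotopic (ccomp (ccomp t (rmor r)) s) (ccomp (ccomp t' (rmor r')) s).
  apply: homot_trans (homot_compA _ _ _) _; apply: homot_trans ta _.
  exact: homot_sym (homot_compA _ _ _).
have [U [u [uq uP]]] := ore_cancel abC sq ta.
exists U, (ccomp u t), (ccomp u t'); split; try by apply: qisE_comp.
  apply: homot_trans (homot_compA _ _ _) _.
  apply: homot_trans (homot_compl u ts) _.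
  exact: homot_sym (homot_compA _ _ _).
apply: homot_trans (homot_compA _ _ _) _; apply: homot_trans uP _.
exact: homot_sym (homot_compA _ _ _).
Qed.

Lemma requiv_lift V Y Z (r : roof V Z) (s : chom Y Z) : qisE s ->
  exists r' : roof V Y, requiv r (roof_post r' s).
Proof.
move=> sq; have [W [u [b [uq ub]]]] := ore abC (rmor r) sq.
exists (Roof (qisE_comp uq (rqisP r)) b), W, u, (cid W); split=> //.
- exact: qisE_id.
- by apply: homot_eq => i /=; rewrite comp1m.
- by apply: homot_trans ub _; apply: homot_eq => i /=; rewrite comp1m.
Qed.

(* Roofs modulo [requiv] are acted on by formal composites, inverses of
   quasi-isomorphisms included; evaluating at the identity roof extracts a
   homotopy from a derivation of [deq]. *)
Fixpoint roof_act V X Y (f : dhom X Y) : roof V X -> roof V Y -> Prop :=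
  match f with
  | DMor _ _ f => fun r r' => requiv (roof_post r f) r'
  | DInv _ _ s _ => fun r r' => requiv r (roof_post r' s)
  | DComp _ _ _ f g => fun r r' => exists2 m, roof_act f r m & roof_act g m r'
  end.

Lemma roof_act_requiv V X Y (f : dhom X Y) (r1 r2 : roof V X) (r1' r2' : roof V Y) :
  requiv r1 r2 -> requiv r1' r2' -> roof_act f r1 r1' -> roof_act f r2 r2'.
Proof.
elim: f r1 r2 r1' r2' => {X Y} [X Y f|X Y s sq|X Y Z f IHf g IHg] /= r1 r2 r1' r2' e e'.
- move=> h; apply: requiv_trans (requiv_sym (requiv_post f e)) _.
  exact: requiv_trans h e'.
- move=> h; apply: requiv_trans (requiv_sym e) _; apply: requiv_trans h _.
  exact: requiv_post.
- case=> m fm gm; exists m; first exact: (IHf _ _ _ _ e (requiv_refl m) fm).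
  exact: (IHg _ _ _ _ (requiv_refl m) e' gm).
Qed.

Lemma roof_act_total V X Y (f : dhom X Y) (r : roof V X) : exists r', roof_act f r r'.
Proof.
elim: f r => {X Y} [X Y f|X Y s sq|X Y Z f IHf g IHg] /= r.
- by exists (roof_post r f); exact: requiv_refl.
- by apply: requiv_lift; apply/qisP.
- by have [m fm] := IHf r; have [r' gm] := IHg m; exists r', m.
Qed.

(** Soundness of the congruence: each rule that generates [deq] preserves the action on roofs, so
    formal composites that act differently are not identified. *)
Lemma roof_act_deq V X Y (f g : dhom X Y) : deq f g ->
  forall (r : roof V X) r', roof_act f r r' <-> roof_act g r r'.
Proof.
elim=> {X Y f g}
  [X Y f|X Y f g _ IH|X Y f g h _ IH1 _ IH2|X Y Z f f' g g' _ IHf _ IHg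
  |X Y Z T f g h|X Y f|X Y f|X Y Z f g|X Y f g fg|X Y s sq|X Y s sq] r r' //=.
- by split=> /IH.
- by split=> [/IH1 /IH2 | /IH2 /IH1].
- by split=> -[m /IHf fm /IHg gm]; exists m.
- split=> [[m [n fn gm] hm] | [n fn [m gm hm]]]; first by exists n => //; exists m.
  by exists m => //; exists n.
- split=> [[m h] | h].
    apply: roof_act_requiv (requiv_refl _).
    by apply: requiv_trans (requiv_sym h) _; exact: requiv_post1.
  by exists r => //; exact: requiv_post1.
- split=> [[m fm h] | h].
    apply: (roof_act_requiv (requiv_refl _) _ fm).
    by apply: requiv_trans h; exact/requiv_sym/requiv_post1.
  by exists r' => //; exact: requiv_post1.
- split=> [[m fm h] | h].
    apply: requiv_trans h; apply: requiv_trans (requiv_post g fm).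
    exact/requiv_sym/requiv_postA.
  exists (roof_post r f); first exact: requiv_refl.
  by apply: requiv_trans h; exact: requiv_postA.
- split=> h; apply: requiv_trans h; apply: requiv_post_homotopic => //.
  exact: homot_sym.
- have sE : qisE s by apply/qisP.
  split=> [[m h1 h2] | h].
    apply: requiv_trans (requiv_post1 _) _; apply: (requiv_cancel sE).
    exact: requiv_trans h1 h2.
  exists (roof_post r s); first exact: requiv_refl.
  by apply: requiv_post; apply: requiv_trans h; exact/requiv_sym/requiv_post1.
- have sE : qisE s by apply/qisP.
  split=> [[m h1 h2] | h].
    apply: requiv_trans (requiv_post1 _) _; exact: requiv_trans h1 h2.
  have [m mP] := requiv_lift r sE; exists m => //.
  apply: requiv_trans (requiv_sym mP) _.
  by apply: requiv_trans h; exact/requiv_sym/requiv_post1.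
Qed.

Definition roof_id V : roof V V := Roof (@qisE_id K C V) (cid V).

Lemma roof_id_post V Y (f : chom V Y) :
  requiv (roof_post (roof_id V) f) (Roof (@qisE_id K C V) f).
Proof.
apply: requiv_eq (homot_refl _) _.
by apply: homot_eq => i; rewrite /= comp1m.
Qed.

(** On the identity roof, [f] and [g] act to give roofs with identity denominators; their
    equivalence forces the two refinements [t] and [t'] to be homotopic, so either one equalizes [f]
    and [g]. *)
Lemma deq_chom X Y (f g : chom X Y) : deq (DMor f) (DMor g) ->
  exists W (s : chom W X), qisE s /\ homotopic (ccomp s f) (ccomp s g).
Proof.
move=> /roof_act_deq /(_ (roof_id X)) fg.
have /fg e : roof_act (DMor f) (roof_id X) (Roof (@qisE_id K C X) f).
  exact: roof_id_post.
have [W [t [t' [tq t'q ts ta]]]] := requiv_trans (requiv_sym (roof_id_post g)) e.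
have {}ts : homotopic t t'.
  have id1 (u : chom W X) : homotopic u (ccomp u (cid X)).
    by apply: homot_eq => i /=; rewrite compm1.
  by apply: homot_trans (id1 _) _; apply: homot_trans ts _; exact/homot_sym/id1.
exists W, t'; split=> //; apply: homot_sym; apply: homot_trans ta.
by apply: homot_compr; exact: homot_sym.
Qed.

Definition dinv X Y (s : chom X Y) (sq : qisE s) : dhom Y X :=
  DInv ((qisP abC s).2 sq).

Definition roof_dhom V Y (r : roof V Y) : dhom V Y :=
  DComp (dinv (rqisP r)) (DMor (rmor r)).

Lemma deq_compl X Y Z (f : dhom X Y) (g h : dhom Y Z) :
  deq g h -> deq (DComp f g) (DComp f h).
Proof. exact/deq_comp/deq_refl. Qed.

Lemma deq_compr X Y Z (f g : dhom X Y) (h : dhom Y Z) :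
  deq f g -> deq (DComp f h) (DComp g h).
Proof. by move=> fg; apply: deq_comp => //; exact: deq_refl. Qed.

Lemma deq_VmorK X Y Z (s : chom X Y) (sq : qis s) (f : dhom Y Z) :
  deq (DComp (DInv sq) (DComp (DMor s) f)) f.
Proof.
apply: deq_trans (deq_sym (deq_compA _ _ _)) _.
apply: deq_trans (deq_compr _ (deq_Vmor _)) _; exact: deq_comp1m.
Qed.

Lemma deq_morVK X Y Z (s : chom X Y) (sq : qis s) (f : dhom X Z) :
  deq (DComp (DMor s) (DComp (DInv sq) f)) f.
Proof.
apply: deq_trans (deq_sym (deq_compA _ _ _)) _.
apply: deq_trans (deq_compr _ (deq_morV _)) _; exact: deq_comp1m.
Qed.

Lemma deq_morA X Y Z W (f : chom X Y) (g : chom Y Z) (h : dhom Z W) :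
  deq (DComp (DMor f) (DComp (DMor g) h)) (DComp (DMor (ccomp f g)) h).
Proof.
apply: deq_trans (deq_sym (deq_compA _ _ _)) _.
exact: deq_compr (deq_mor _ _).
Qed.

Lemma dmorK X Y Z (s : chom X Y) (sq : qis s) (f g : dhom Y Z) :
  deq (DComp (DMor s) f) (DComp (DMor s) g) -> deq f g.
Proof.
move=> fg; apply: deq_trans (deq_sym (deq_VmorK sq f)) _.
apply: deq_trans (deq_VmorK sq g); exact: deq_compl.
Qed.

Lemma requiv_deq V Y (r r' : roof V Y) : requiv r r' -> deq (roof_dhom r) (roof_dhom r').
Proof.
case=> W [t [t' [tq t'q ts ta]]].
have tsq := (qisP abC _).2 (qisE_comp tq (rqisP r)).
apply: (dmorK tsq).
apply: deq_trans (deq_sym (deq_morA _ _ _)) _.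
apply: deq_trans (deq_compl _ (deq_morVK _ _)) _.
apply: deq_trans (deq_mor _ _) _; apply: deq_trans (deq_homotopic ta) _.
apply: deq_sym; apply: deq_trans (deq_compr _ (deq_homotopic ts)) _.
apply: deq_trans (deq_sym (deq_morA _ _ _)) _.
apply: deq_trans (deq_compl _ (deq_morVK _ _)) _.
exact: deq_mor.
Qed.

Lemma roof_dhom_post V Y Z (r : roof V Y) (f : chom Y Z) :
  deq (DComp (roof_dhom r) (DMor f)) (roof_dhom (roof_post r f)).
Proof.
apply: deq_trans (deq_compA _ _ _) _; apply: deq_compl; exact: deq_mor.
Qed.

Lemma roof_act_dhom V X Y (f : dhom X Y) (r : roof V X) (r' : roof V Y) :
  roof_act f r r' -> deq (DComp (roof_dhom r) f) (roof_dhom r').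
Proof.
elim: f r r' => {X Y} [X Y f|X Y s sq|X Y Z f IHf g IHg] r r' /=.
- by move=> /requiv_deq; apply: deq_trans; exact: roof_dhom_post.
- move=> /requiv_deq h.
  apply: deq_trans (deq_compr _ h) _.
  apply: deq_trans (deq_compr _ (deq_sym (roof_dhom_post _ _))) _.
  apply: deq_trans (deq_compA _ _ _) _.
  apply: deq_trans (deq_compl _ (deq_morV _)) _; exact: deq_compm1.
- case=> m /IHf fm /IHg gm.
  apply: deq_trans (deq_sym (deq_compA _ _ _)) _.
  by apply: deq_trans gm; exact: deq_compr.
Qed.

(** The roof is obtained by letting [f] act on the identity roof. *)
Lemma dhom_roof X Y (f : dhom X Y) : exists r : roof X Y, deq f (roof_dhom r).
Proof.
have [r fr] := roof_act_total f (roof_id X); exists r.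
apply: deq_trans (roof_act_dhom fr).
apply: deq_trans (deq_sym (deq_comp1m _)) _; apply: deq_compr.
apply: deq_sym.
apply: deq_trans (deq_compm1 _) _.
apply: deq_trans (deq_sym (deq_comp1m _)) _.
exact: deq_morV.
Qed.

End Roofs.

(** * The derived category *)

Section Derived.
Variables (K : fieldType) (C : klin K).
Implicit Types X Y Z W V Q : cpx C.

Definition dzero X Y : dhom X Y := DMor (czero X Y).
Definition did X : dhom X X := DMor (cid X).

Lemma deq_chom_eq X Y (f g : chom X Y) : (forall i, f i = g i) -> deq (DMor f) (DMor g).
Proof. by move=> fg; apply: deq_homotopic; exact: homot_eq. Qed.

Lemma deq_mor0r X Y Z (f : chom X Y) : deq (DComp (DMor f) (dzero Y Z)) (dzero X Z).
Proof.
apply: deq_trans (deq_mor _ _) _; apply: deq_chom_eq => i; exact: compm0.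
Qed.

Lemma deq_mor0l X Y Z (f : chom Y Z) : deq (DComp (dzero X Y) (DMor f)) (dzero X Z).
Proof.
apply: deq_trans (deq_mor _ _) _; apply: deq_chom_eq => i; exact: comp0m.
Qed.

Lemma deq_comp0r X Y Z (f : dhom X Y) : deq (DComp f (dzero Y Z)) (dzero X Z).
Proof.
elim: f => {X Y} [X Y f|X Y s sq|X Y T f IHf g IHg].
- exact: deq_mor0r.
- apply: deq_trans (deq_compl _ (deq_sym (deq_mor0r _ s))) _.
  exact: deq_VmorK.
- apply: deq_trans (deq_compA _ _ _) _.
  by apply: deq_trans IHf; exact: deq_compl.
Qed.

Lemma deq_comp0l X Y Z (g : dhom Y Z) : deq (DComp (dzero X Y) g) (dzero X Z).
Proof.
elim: g => {Y Z} [Y Z g|Y Z s sq|Y T Z f IHf g IHg].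
- exact: deq_mor0l.
- apply: deq_trans (deq_compr _ (deq_sym (deq_mor0l _ s))) _.
  apply: deq_trans (deq_compA _ _ _) _.
  apply: deq_trans (deq_compl _ (deq_morV _)) _; exact: deq_compm1.
- apply: deq_trans (deq_sym (deq_compA _ _ _)) _.
  by apply: deq_trans IHg; exact: deq_compr.
Qed.

Definition diso X Y := exists f : dhom X Y, d_iso f.

Lemma diso_refl X : diso X X.
Proof. by exists (did X), (did X); split; exact: deq_comp1m. Qed.

Lemma diso_sym X Y : diso X Y -> diso Y X.
Proof. by case=> f [g [fg gf]]; exists g, f. Qed.

Lemma diso_trans X Y Z : diso X Y -> diso Y Z -> diso X Z.
Proof.
have cancel4 (X' Y' Z' : cpx C) (f : dhom X' Y') (g : dhom Y' X') (f' : dhom Y' Z')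
    (g' : dhom Z' Y') : deq (DComp f g) (did _) -> deq (DComp f' g') (did _) ->
    deq (DComp (DComp f f') (DComp g' g)) (did _).
  move=> fg fg'; apply: deq_trans (deq_compA _ _ _) _.
  apply: deq_trans fg; apply: deq_compl.
  apply: deq_trans (deq_sym (deq_compA _ _ _)) _.
  by apply: deq_trans (deq_compr _ fg') _; exact: deq_comp1m.
case=> f [g [fg gf]] [f' [g' [fg' gf']]].
by exists (DComp f f'), (DComp g' g); split; exact: cancel4.
Qed.

Lemma diso_qis X Y (s : chom X Y) : qis s -> diso X Y.
Proof.
by move=> sq; exists (DMor s), (DInv sq); split; [exact: deq_morV | exact: deq_Vmor].
Qed.

Definition hom0 X Y := forall f : dhom X Y, deq f (dzero X Y).

Lemma hom0_diso X X' Y Y' : diso X X' -> diso Y Y' -> hom0 X' Y' -> hom0 X Y.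
Proof.
case=> f [f' [ff' _]] [g [g' [gg' _]]] h0 u.
have := h0 (DComp f' (DComp u g)) => u0.
have u1 : deq u (DComp f (DComp (DComp f' (DComp u g)) g')).
  apply: deq_sym; apply: deq_trans (deq_sym (deq_compA _ _ _)) _.
  apply: deq_trans (deq_compr _ (deq_sym (deq_compA _ _ _))) _.
  apply: deq_trans (deq_compr _ (deq_compr _ ff')) _.
  apply: deq_trans (deq_compr _ (deq_comp1m _)) _.
  apply: deq_trans (deq_compA _ _ _) _.
  by apply: deq_trans (deq_compl _ gg') _; exact: deq_compm1.
apply: deq_trans u1 _; apply: deq_trans (deq_compl _ (deq_compr _ u0)) _.
apply: deq_trans (deq_compl _ (deq_comp0l _ _)) _; exact: deq_comp0r.
Qed.

Lemma hom0_tgt X Y : deq (did Y) (dzero Y Y) -> hom0 X Y.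
Proof.
move=> Y0 f; apply: deq_trans (deq_sym (deq_compm1 _)) _.
by apply: deq_trans (deq_compl _ Y0) _; exact: deq_comp0r.
Qed.

(** Replaces indecomposability: it passes through full and faithful functors and avoids sums, for
    which [dhom] has no operation. Zero objects satisfy it too, hence the separate nonvanishing
    hypotheses below. *)
Definition trivial_idem X := forall e : dhom X X, deq (DComp e e) e ->
  deq e (dzero X X) \/ deq e (did X).

Lemma trivial_idem_diso X Y : diso X Y -> trivial_idem X -> trivial_idem Y.
Proof.
case=> f [g [fg gf]] tX e ee.
have conj (u : dhom X X) : deq (DComp f (DComp e g)) u ->
    deq e (DComp g (DComp u f)).
  move=> fu; apply: deq_sym; apply: deq_trans (deq_compl _ (deq_compr _ (deq_sym fu))) _.
  apply: deq_trans (deq_sym (deq_compA _ _ _)) _.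
  apply: deq_trans (deq_compr _ (deq_sym (deq_compA _ _ _))) _.
  apply: deq_trans (deq_compr _ (deq_compr _ gf)) _.
  apply: deq_trans (deq_compr _ (deq_comp1m _)) _.
  apply: deq_trans (deq_compA _ _ _) _.
  by apply: deq_trans (deq_compl _ gf) _; exact: deq_compm1.
have idem : deq (DComp (DComp f (DComp e g)) (DComp f (DComp e g)))
                (DComp f (DComp e g)).
  apply: deq_trans (deq_compA _ _ _) _; apply: deq_compl.
  apply: deq_trans (deq_compA _ _ _) _.
  apply: deq_trans (deq_compl _ (deq_sym (deq_compA _ _ _))) _.
  apply: deq_trans (deq_compl _ (deq_compr _ gf)) _.
  apply: deq_trans (deq_compl _ (deq_comp1m _)) _.
  by apply: deq_trans (deq_sym (deq_compA _ _ _)) _; exact: deq_compr.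
have [e0|e1] := tX _ idem; [left | right].
  apply: deq_trans (conj _ e0) _; apply: deq_trans (deq_compl _ (deq_comp0l _ _)) _.
  exact: deq_comp0r.
apply: deq_trans (conj _ e1) _; apply: deq_trans gf.
exact: deq_compl (deq_comp1m _).
Qed.

Lemma dshift_deq X Y (f g : dhom X Y) : deq f g -> deq (dshift f) (dshift g).
Proof.
elim=> {X Y f g} /=.
- by move=> X Y f; exact: deq_refl.
- by move=> X Y f g _; exact: deq_sym.
- by move=> X Y f g h _ fg _ gh; exact: deq_trans fg gh.
- by move=> X Y Z f f' g g' _ ff' _ gg'; exact: deq_comp.
- by move=> X Y Z T f g h; exact: deq_compA.
- move=> X Y f; apply: deq_trans (deq_comp1m _); apply: deq_compr.
  by apply: deq_chom_eq => i.
- move=> X Y f; apply: deq_trans (deq_compm1 _); apply: deq_compl.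
  by apply: deq_chom_eq => i.
- move=> X Y Z f g; apply: deq_trans (deq_mor _ _) _.
  by apply: deq_chom_eq => i.
- by move=> X Y f g fg; apply: deq_homotopic; exact: homot_shift.
- move=> X Y s sq; apply: deq_trans (deq_morV _) _; exact: deq_chom_eq.
- move=> X Y s sq; apply: deq_trans (deq_Vmor _) _; exact: deq_chom_eq.
Qed.

Lemma diso_shift X Y : diso X Y -> diso (shift X) (shift Y).
Proof.
case=> f [g [/dshift_deq fg /dshift_deq gf]].
exists (dshift f), (dshift g); split.
  by apply: deq_trans fg _; exact: deq_chom_eq.
by apply: deq_trans gf _; exact: deq_chom_eq.
Qed.

Lemma exact_zero (O1 O2 O3 : C) (f : hom O1 O2) (g : hom O2 O3) :
  is_zero O2 -> exact_at f g.
Proof.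
move=> O0 W y _; exists W, (idm W), 0; split; first exact: epi_id.
by rewrite comp0m (is_zero_tgt y O0) compm0.
Qed.

Definition sconc X n := forall j, j <> n -> is_zero (X j).

Definition conc X n := exists Q, sconc Q n /\ diso X Q.

Lemma conc_diso X Y n : diso X Y -> conc X n -> conc Y n.
Proof.
move=> XY [Q [Qn XQ]]; exists Q; split=> //.
exact: diso_trans (diso_sym XY) XQ.
Qed.

Lemma sconc_shift X n : sconc X n -> sconc (shift X) (n - 1).
Proof. by move=> Xn j jn; apply: Xn => jn1; apply: jn; rewrite -jn1 addrK. Qed.

Lemma conc_shift X n : conc X n -> conc (shift X) (n - 1).
Proof.
case=> Q [Qn XQ]; exists (shift Q); split; first exact: sconc_shift.
exact: diso_shift.
Qed.

Lemma conc_iter_shift X n k : conc X n -> conc (iter k (@shift K C) X) (n - k%:Z).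
Proof.
move=> Xn; elim: k => [|k /conc_shift]; first by rewrite subr0.
by have -> : n - k%:Z - 1 = n - k.+1%:Z by lia.
Qed.

(** With the degree given by a hypothesis [j = n], the clause applies in degrees such as [n - 1 + 1]
    without transport. *)
Definition concO X n (O : C) := sconc X n /\ forall j, j = n -> isomorphic (X j) O.

Lemma concO_shift X n O : concO X n O -> concO (shift X) (n - 1) O.
Proof.
case=> Xn XO; split; first exact: sconc_shift.
by move=> j jn; apply: XO; rewrite jn subrK.
Qed.

Lemma concO_iter_shift X n O k :
  concO X n O -> concO (iter k (@shift K C) X) (n - k%:Z) O.
Proof.
move=> Xn; elim: k => [|k /concO_shift]; first by rewrite subr0.
by have -> : n - k%:Z - 1 = n - k.+1%:Z by lia.
Qed.

Lemma isomorphic_refl (O : C) : isomorphic O O.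
Proof. by exists (idm O); exact: is_iso_id. Qed.

Lemma isomorphic_sym (O O' : C) : isomorphic O O' -> isomorphic O' O.
Proof. by case=> f [g [fg gf]]; exists g, f. Qed.

Lemma isomorphic_trans (O O' O'' : C) :
  isomorphic O O' -> isomorphic O' O'' -> isomorphic O O''.
Proof.
case=> f [g [fg gf]] [f' [g' [fg' gf']]]; exists (f \> f'), (g' \> g); split.
  by rewrite compA -(compA f') fg' comp1m.
by rewrite compA -(compA g) gf comp1m.
Qed.

Lemma concO_stalk O : concO (stalk O) 0 O.
Proof.
split=> [j /eqP/negbTE /= -> | j -> /=]; first exact: zobjP.
exact: isomorphic_refl.
Qed.

Lemma concO_transl X n k O : concO X n O -> concO (transl k X) (n - k) O.
Proof.
case=> Xn XO; split=> [j jn | j jn]; first by apply: Xn => /= e; apply: jn; rewrite -e addrK.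
by apply: XO; rewrite jn subrK.
Qed.

Lemma sconc_concO X n : sconc X n -> concO X n (X n).
Proof. by move=> Xn; split=> // j ->; exact: isomorphic_refl. Qed.

Lemma sconc_diff X n i : sconc X n -> diff X i = 0.
Proof.
move=> Xn; have [e | ne] := eqVneq i n; last by apply/is_zero_src/Xn/eqP.
apply/is_zero_tgt/Xn; lia.
Qed.

Lemma concO_ciso X X' n O : concO X n O -> concO X' n O ->
  exists f : chom X X', forall i, is_iso (f i).
Proof.
case=> Xn XO [X'n X'O].
have iso i : exists f : hom (X i) (X' i), is_iso f.
  have [e | /eqP ne] := eqVneq i n.
    exact: isomorphic_trans (XO i e) (isomorphic_sym (X'O i e)).
  exists 0; apply: is_iso_zero; [exact: Xn | exact: X'n].
pose f i := sval (boolp.cid (iso i)).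
have fP i : diff X i \> f (i + 1) = f i \> diff X' i.
  by rewrite (sconc_diff _ Xn) (sconc_diff _ X'n) comp0m compm0.
by exists (CHom fP) => i; exact: (svalP (boolp.cid (iso i))).
Qed.

End Derived.

Section DerivedAbelian.
Variables (K : fieldType) (C : klin K).
Hypothesis abC : abelian C.
Implicit Types X Y Z W V Q : cpx C.

Lemma diso_qisE X Y (s : chom X Y) : qisE s -> diso X Y.
Proof. by move=> /(qisP abC); exact: diso_qis. Qed.

Lemma concO_diso X X' n O : concO X n O -> concO X' n O -> diso X X'.
Proof.
by move=> XO X'O; have [f /ciso_qisE/diso_qisE] := concO_ciso XO X'O.
Qed.

(** The zero endomorphism is then a quasi-isomorphism, hence invertible. *)
Lemma acyclic_did X : acyclic X -> deq (did X) (dzero X X).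
Proof.
move=> Xac.
have q0 : qis (czero X X).
  apply/(qisP abC) => i; split=> [W x y xd _ | W y yd]; first exact: Xac.
  have [V [e [x [ee ex]]]] := Xac _ _ _ yd.
  by exists V, e, 0, x; rewrite !comp0m add0r.
apply: deq_trans (deq_sym (deq_morV q0)) _; exact: deq_comp0l.
Qed.

(** Some quasi-isomorphism onto [X] is null homotopic, and it is surjective on cohomology. *)
Lemma did_acyclic X : deq (did X) (dzero X X) -> acyclic X.
Proof.
move=> /(deq_chom abC) [W [s [sq [h hP]]]] i O y yd.
have [V [e [x [y' [ee xd ey]]]]] := (sq i).2 _ _ yd.
exists V, e, (x \> h i + y'); split=> //.
have := hP i; rewrite /= compm1 compm0 subr0 => si.
by rewrite ey si compDl compDr -compA xd comp0m add0r compA.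
Qed.

Fixpoint dtransl k X Y (f : dhom X Y) : dhom (transl k X) (transl k Y) :=
  match f with
  | DMor _ _ f => DMor (ctransl k f)
  | DInv _ _ s sq => DInv ((qisP abC _).2 (qisE_transl k ((qisP abC s).1 sq)))
  | DComp _ _ _ f g => DComp (dtransl k f) (dtransl k g)
  end.

Lemma dtransl_deq k X Y (f g : dhom X Y) : deq f g -> deq (dtransl k f) (dtransl k g).
Proof.
elim=> {X Y f g} /=.
- by move=> X Y f; exact: deq_refl.
- by move=> X Y f g _; exact: deq_sym.
- by move=> X Y f g h _ fg _ gh; exact: deq_trans fg gh.
- by move=> X Y Z f f' g g' _ ff' _ gg'; exact: deq_comp.
- by move=> X Y Z T f g h; exact: deq_compA.
- move=> X Y f; apply: deq_trans (deq_comp1m _); apply: deq_compr.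
  by apply: deq_chom_eq => i.
- move=> X Y f; apply: deq_trans (deq_compm1 _); apply: deq_compl.
  by apply: deq_chom_eq => i.
- move=> X Y Z f g; apply: deq_trans (deq_mor _ _) _.
  by apply: deq_chom_eq => i.
- by move=> X Y f g fg; apply: deq_homotopic; exact: homotopic_transl.
- move=> X Y s sq; apply: deq_trans (deq_morV _) _; exact: deq_chom_eq.
- move=> X Y s sq; apply: deq_trans (deq_Vmor _) _; exact: deq_chom_eq.
Qed.

Lemma transl_transl_qis k X : qisE (transl_transl k X).
Proof. by apply: ciso_qisE => i; exact: tr_iso. Qed.

Lemma dinv_square X Y X' Y' (s : chom X Y) (s' : chom X' Y') (sq : qis s) (sq' : qis s')
    (a : dhom X' X) (b : dhom Y' Y) :
  deq (DComp (DMor s') b) (DComp a (DMor s)) ->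
  deq (DComp b (DInv sq)) (DComp (DInv sq') a).
Proof.
move=> ab; apply: (dmorK sq'); apply: deq_trans (deq_sym (deq_morVK sq' a)).
apply: deq_trans (deq_sym (deq_compA _ _ _)) _.
apply: deq_trans (deq_compr _ ab) _.
apply: deq_trans (deq_compA _ _ _) _.
by apply: deq_trans (deq_compl _ (deq_morV _)) _; exact: deq_compm1.
Qed.

Lemma dtransl_nat k X Y (f : dhom X Y) :
  deq (DComp (DMor (transl_transl k X)) f)
      (DComp (dtransl (- k) (dtransl k f)) (DMor (transl_transl k Y))).
Proof.
elim: f => {X Y} [X Y f|X Y s sq|X Y Z f IHf g IHg] /=.
- apply: deq_trans (deq_mor _ _) _; apply: deq_trans (deq_sym (deq_mor _ _)).
  by apply: deq_chom_eq => i; rewrite [LHS]/= transl_transl_nat.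
- apply: dinv_square; apply: deq_trans (deq_mor _ _) _.
  apply: deq_trans (deq_sym (deq_mor _ _)).
  by apply: deq_chom_eq => i; rewrite [RHS]/= transl_transl_nat.
- apply: deq_trans (deq_sym (deq_compA _ _ _)) _.
  apply: deq_trans (deq_compr _ IHf) _.
  apply: deq_trans (deq_compA _ _ _) _.
  apply: deq_trans (deq_compl _ IHg) _.
  exact: deq_sym (deq_compA _ _ _).
Qed.

(** Translating back recovers [f] up to the natural isomorphism [transl_transl], so [f] vanishes
    with its translate. *)
Lemma hom0_transl k X Y : hom0 (transl k X) (transl k Y) -> hom0 X Y.
Proof.
move=> h0 f; have /(dtransl_deq (- k)) fk := h0 (dtransl k f).
apply: (dmorK ((qisP abC _).2 (transl_transl_qis k X))).
apply: deq_trans (dtransl_nat k f) _.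
apply: deq_trans (deq_compr _ fk) _.
apply: deq_trans (deq_sym (deq_comp0r _ _)); apply: deq_trans (deq_mor _ _) _.
by apply: deq_chom_eq => i; exact: comp0m.
Qed.

End DerivedAbelian.

(** * Truncation *)

Section Truncation.
Variables (K : fieldType) (C : klin K).
Hypothesis abC : abelian C.
Implicit Types X Y Z W V Q : cpx C.

Lemma subcomplex Y (S : int -> C) (m : forall j, hom (S j) (Y j)) :
  (forall j, mono (m j)) ->
  (forall j, exists u, u \> m (j + 1) = m j \> diff Y j) ->
  exists (d : forall j, hom (S j) (S (j + 1))) dd bnd,
    let X := @Cpx K C S d dd bnd in forall j, d j \> m (j + 1) = m j \> diff Y j.
Proof.
move=> mm mu; pose d j := sval (boolp.cid (mu j)).
have dm j : d j \> m (j + 1) = m j \> diff Y j := svalP (boolp.cid (mu j)).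
have dd j : d j \> d (j + 1) = 0.
  by apply: mm; rewrite compA dm -compA dm compA diffK compm0 comp0m.
have bnd : exists r s : int, forall i, ~~ ((r <= i) && (i <= s)) -> is_zero (S i).
  have [r [s rs]] := cpx_bounded Y; exists r, s => i /rs Yi.
  by apply: mm; rewrite comp0m; exact: is_zero_tgt.
by exists d, dd, bnd.
Qed.

Lemma kernel_complex Y Q (p : chom Y Q) :
  exists X (i : chom X Y), forall j, is_kernel (i j) (p j).
Proof.
have ex j : exists S : {O : C & hom O (Y j)}, is_kernel (projT2 S) (p j).
  by have [O [k kP]] := kernel_ex abC (p j); exists (existT _ O k).
pose S j := projT1 (sval (boolp.cid (ex j))).
pose m j : hom (S j) (Y j) := projT2 (sval (boolp.cid (ex j))).
have mP j : is_kernel (m j) (p j) := svalP (boolp.cid (ex j)).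
have [||d [dd [bnd dm]]] := @subcomplex Y S m.
- by move=> j; exact: kernel_mono (mP j).
- move=> j; apply: (kernel_lift (mP (j + 1))).
  by rewrite compA cmapP -compA (mP j).1 comp0m.
by exists (Cpx dd bnd), (@CHom K C (Cpx dd bnd) Y m dm).
Qed.

(** The canonical truncation: [Y] below degree [n], the cocycles in degree [n], zero above. *)
Lemma trunc_ex Y (n : int) : exists X (m : chom X Y),
  [/\ forall j, mono (m j),
      forall j, n < j -> is_zero (X j),
      forall j (W : C) (y : hom W (Y j)), j <= n -> y \> diff Y j = 0 ->
        exists x, x \> m j = y &
      forall j (W : C) (y : hom W (Y j)), j < n -> exists x, x \> m j = y].
Proof.
have ex j : exists S : {O : C & hom O (Y j)},
    [/\ mono (projT2 S), n < j -> is_zero (projT1 S),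
        j = n -> is_kernel (projT2 S) (diff Y j) & j < n -> is_iso (projT2 S)].
  have [jn|jn|jn] := Num.Theory.ltrgtP j n.
  - exists (existT _ (Y j) (idm _)); split=> //=; try lia.
      exact/is_iso_mono/is_iso_id.
    by move=> _; exact: is_iso_id.
  - exists (existT _ (zobj C) (0 : hom (zobj C) (Y j))); split=> //=; try lia.
      by move=> W f g _; rewrite (is_zero_tgt f (zobjP C)) (is_zero_tgt g (zobjP C)).
    by move=> _; exact: zobjP.
  - have [O [k kP]] := kernel_ex abC (diff Y j).
    exists (existT _ O k); split=> //=; try lia; exact: kernel_mono kP.
pose S j := projT1 (sval (boolp.cid (ex j))).
pose m j : hom (S j) (Y j) := projT2 (sval (boolp.cid (ex j))).
have mm j : mono (m j) by have [] := svalP (boolp.cid (ex j)).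
have mz j : n < j -> is_zero (S j) by have [] := svalP (boolp.cid (ex j)).
have mk j : j = n -> is_kernel (m j) (diff Y j) by have [] := svalP (boolp.cid (ex j)).
have mi j : j < n -> is_iso (m j) by have [] := svalP (boolp.cid (ex j)).
have ml j (W : C) (y : hom W (Y j)) : j < n -> exists x, x \> m j = y.
  by move=> /mi [g [_ gm]]; exists (y \> g); rewrite compA gm compm1.
have mc j (W : C) (y : hom W (Y j)) : j <= n -> y \> diff Y j = 0 ->
    exists x, x \> m j = y.
  rewrite Order.POrderTheory.le_eqVlt => /orP[/eqP jn | /ml //] yd.
  exact: (kernel_lift (mk j jn) yd).
have [|j|d [dd [bnd dm]]] := @subcomplex Y S m; first exact: mm.
  have [jn | jn] := Num.Theory.lerP (j + 1) n.
    by apply: mc => //; rewrite compA diffK compm0.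
  exists 0; rewrite comp0m; have [jn' | ne] := eqVneq j n.
    by rewrite (mk j jn').1.
  by rewrite (is_zero_src (m j \> _)) //; apply: mz; lia.
by exists (Cpx dd bnd), (@CHom K C (Cpx dd bnd) Y m dm).
Qed.

(** Exactness at index [i] concerns the cohomology in degree [i + 1], so the hypothesis says that
    none is left above degree [n]. *)
Lemma trunc_qis_ex Y (n : int) :
  (forall i, n <= i -> exact_at (diff Y i) (diff Y (i + 1))) ->
  exists X (m : chom X Y),
  [/\ qisE m, forall j, n < j -> is_zero (X j) &
      forall j (W : C) (y : hom W (Y j)), j <= n -> y \> diff Y j = 0 ->
        exists x, x \> m j = y].
Proof.
move=> Yex; have [X [m [mm mz mc ml]]] := trunc_ex Y n.
exists X, m; split=> // i; split=> [W x y xd xy | W y yd].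
  have [ni | ni] := Num.Theory.lerP n i.
    exists W, (idm W), 0; split; first exact: epi_id.
    by rewrite comp0m comp1m (is_zero_tgt x) //; apply: mz; lia.
  have [x' x'm] := ml _ _ y ni; exists W, (idm W), x'; split; first exact: epi_id.
  by apply: mm; rewrite comp1m xy -x'm !compA cmapP.
have [ni | ni] := Num.Theory.lerP n i.
  have [V [e [y' [ee ey]]]] := Yex i ni _ _ yd.
  by exists V, e, 0, y'; rewrite !comp0m add0r.
have [||x xm] := mc (i + 1) _ y; [lia | by [] |].
exists W, (idm W), x, 0; split; first exact: epi_id.
  by apply: mm; rewrite compA cmapP -compA xm yd comp0m.
by rewrite comp1m comp0m addr0.
Qed.

(** When [Y] stops in degree [n + 1], this quotient is its top cohomology; when [Y] starts there, it
    is its lowest term. Both cases are used. *)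
Lemma topq_ex Y n : exists Q (p : chom Y Q),
  [/\ sconc Q (n + 1), forall j, epi (p j) & is_cokernel (p (n + 1)) (diff Y n)].
Proof.
have ex j : exists S : {O : C & hom (Y j) O},
    [/\ epi (projT2 S), j <> n + 1 -> is_zero (projT1 S) &
        forall e : n + 1 = j, is_cokernel (projT2 S) (dif Y e)].
  have [jn | /eqP jn] := eqVneq j (n + 1).
    rewrite jn; have [O [k kP]] := cokernel_ex abC (diff Y n).
    exists (existT _ O k); split=> //=; first exact: cokernel_epi kP.
    by move=> e; rewrite (eq_irrelevance e (erefl _)) difE.
  exists (existT _ (zobj C) (0 : hom (Y j) (zobj C))); split=> //=.
  - by move=> W f g _; rewrite (is_zero_src f (zobjP C)) (is_zero_src g (zobjP C)).
  - by move=> _; exact: zobjP.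
  - by move=> e; case: jn.
pose S j := projT1 (sval (boolp.cid (ex j))).
pose p j : hom (Y j) (S j) := projT2 (sval (boolp.cid (ex j))).
have pe j : epi (p j) by have [] := svalP (boolp.cid (ex j)).
have pz j : j <> n + 1 -> is_zero (S j) by have [] := svalP (boolp.cid (ex j)).
have pc : is_cokernel (p (n + 1)) (diff Y n).
  have [_ _ /(_ (erefl _))] := svalP (boolp.cid (ex (n + 1))).
  by rewrite difE.
have bnd : exists r s : int, forall i, ~~ ((r <= i) && (i <= s)) -> is_zero (S i).
  by exists (n + 1), (n + 1) => i ni; apply: pz; lia.
pose Q := @Cpx K C S (fun=> 0) (fun=> comp0m _ _) bnd.
have pP j : diff Y j \> p (j + 1) = p j \> diff Q j.
  rewrite /= compm0; have [-> | /eqP jn] := eqVneq j n; first exact: pc.1.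
  by apply: is_zero_tgt; apply: pz; lia.
by exists Q, (@CHom K C Y Q p pP).
Qed.

(** A degreewise short exact sequence yields a triangle: its quotient [Q] replaces the cone of [i],
    through [q] followed by [p]. *)
Lemma ses_qis X Y Q Z (i : chom X Y) (p : chom Y Q) (v : chom Y Z)
    (w : chom Z (shift X)) : is_cone i v w ->
  (forall j, is_kernel (i j) (p j)) -> (forall j, epi (p j)) ->
  exists s : chom Z Q, qisE s /\ forall j, v j \> s j = p j.
Proof.
move=> [jj [q [biP dP]]] ik pe.
have sP j : diff Z j \> (q (j + 1) \> p (j + 1)) = q j \> p j \> diff Q j.
  rewrite -compA (cone_dq biP dP) compDl !compA (ik _).1 compm0 add0r.
  by rewrite cmapP.
have im j : mono (i j) := kernel_mono (ik j).
exists (CHom sP); split=> [|j /=]; last by rewrite -compA (cone_vq biP) comp1m.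
move=> k; split=> [W z c zd /= zc | W c cd].
  have [V [e [y' [ee ey]]]] := epi_pullback abC c (pe k).
  set x := z \> w (k + 1); set y := z \> q (k + 1).
  have xy : x \> i (k + 1 + 1) = - (y \> diff Y (k + 1)).
    apply/eqP; rewrite -addr_eq0 /x /y !compA -compDr -(cone_dq biP dP).
    by rewrite -compA zd comp0m.
  have yp : y \> p (k + 1) = c \> diff Q k by rewrite /y compA.
  have zE : z = x \> jj (k + 1) + y \> v (k + 1) by exact: cone_elt.
  clearbody x y.
  have y0 : (e \> y - y' \> diff Y k) \> p (k + 1) = 0.
    by rewrite compBl !compA yp cmapP -!compA ey subrr.
  have [x' x'E] := kernel_lift (ik (k + 1)) y0.
  exists V, e, (x' \> jj k + y' \> v k); split=> //.
  have xx' : e \> x = - (x' \> diff X (k + 1)).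
    apply: im; rewrite compNl !compA cmapP -(compA x') x'E compBl !compA diffK.
    by rewrite compm0 subr0 xy compNr.
  rewrite zE compDr -(compA e) xx' compDl !compA (cone_jd biP dP) cone_vd.
  rewrite -(compA e y) -[e \> y](subrK (y' \> diff Y k)) -x'E.
  by rewrite compBr compDl compNl !compA; zmod.
have [V [e [y [ee ey]]]] := epi_pullback abC c (pe (k + 1)).
have yd : y \> diff Y (k + 1) \> p (k + 1 + 1) = 0.
  by rewrite compA cmapP -compA -ey compA cd compm0.
have [x xE] := kernel_lift (ik _) yd.
have xd : x \> diff X (k + 1 + 1) = 0.
  by apply: im; rewrite compA cmapP -compA xE compA diffK compm0 comp0m.
exists V, e, (y \> v (k + 1) - x \> jj (k + 1)), 0; split=> //.
  rewrite compBl !compA cone_vd (cone_jd biP dP) compBr -!(compA x) xd xE.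
  by rewrite comp0m subr0 !compA subrr.
rewrite /= comp0m addr0 compBl !compA -!(compA _ (q _)) (cone_jq biP) (cone_vq biP).
by rewrite comp0m compm0 subr0 comp1m.
Qed.

End Truncation.

(** * Hereditary categories *)

Section Triangles.
Variables (K : fieldType) (C : klin K).
Hypothesis abC : abelian C.
Implicit Types X Y Z W V Q : cpx C.

Lemma deq_roof_post0 V Y Z (r : roof V Y) (f : chom Y Z) :
  deq (DComp (roof_dhom abC r) (DMor f)) (dzero V Z) ->
  exists W (t : chom W (rsrc r)),
    qisE t /\ homotopic (ccomp (ccomp t (rmor r)) f) (czero W Z).
Proof.
move=> rf0.
have rf : deq (DMor (ccomp (rmor r) f)) (DMor (czero (rsrc r) Z)).
  apply: (@deq_trans _ _ _ _ _ (DComp (DMor (rqis r)) (dzero V Z))); last exact: deq_mor0r.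
  apply: deq_trans (deq_compl _ rf0).
  apply: deq_trans (deq_sym (deq_mor _ _)) _; apply: deq_sym.
  apply: deq_trans (deq_compl _ (deq_compA _ _ _)) _; exact: deq_morVK.
have [W [t [tq tP]]] := deq_chom abC rf; exists W, t; split=> //.
apply: homot_trans (homot_compA _ _ _) _; apply: homot_trans tP _.
by apply: homot_eq => i; exact: compm0.
Qed.

Lemma roof_dhom_pre V Y (r : roof V Y) W (t : chom W (rsrc r)) (tq : qisE t) :
  deq (roof_dhom abC r)
      (roof_dhom abC (Roof (qisE_comp tq (rqisP r)) (ccomp t (rmor r)))).
Proof.
apply: requiv_deq; exists W, t, (cid W); split=> //; first exact: qisE_id.
  by apply: homot_eq => i; rewrite /= comp1m.
by apply: homot_eq => i; rewrite /= comp1m.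
Qed.

(** With [Q] replaced by the cone of [i], a roof for [f] becomes null homotopic in the cone after
    refinement, and [cone_lift] lifts its numerator to [X]. *)
Lemma ses_lift V X Y Q (i : chom X Y) (p : chom Y Q) (f : dhom V Y) :
  (forall j, is_kernel (i j) (p j)) -> (forall j, epi (p j)) ->
  deq (DComp f (DMor p)) (dzero V Q) ->
  exists g : dhom V X, deq f (DComp g (DMor i)).
Proof.
move=> ik pe fp0; have [Z [v [w ZP]]] := cone_ex abC i.
have [s [sq vs]] := ses_qis abC ZP ik pe.
have sE : qis s by apply/(qisP abC).
have [r fr] := dhom_roof abC f.
have fv0 : deq (DComp (roof_dhom abC r) (DMor v)) (dzero V Z).
  apply: deq_trans (deq_sym (deq_compm1 _)) _.
  apply: deq_trans (deq_compl _ (deq_sym (deq_morV sE))) _.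
  apply: deq_trans (deq_sym (deq_compA _ _ _)) _.
  apply: deq_trans (deq_comp0l _ (DInv sE)); apply: deq_compr.
  apply: deq_trans (deq_compA _ _ _) _.
  apply: deq_trans fp0; apply: deq_comp; first exact: deq_sym.
  by apply: deq_trans (deq_mor _ _) _; exact: deq_chom_eq.
have [W [t [tq t0]]] := deq_roof_post0 fv0.
case: ZP => jj [q [biP dP]].
have [g gP] := cone_lift biP dP t0.
exists (roof_dhom abC (Roof (qisE_comp tq (rqisP r)) g)).
apply: deq_trans fr _; apply: deq_trans (roof_dhom_pre tq) _.
apply: deq_sym; apply: deq_trans (roof_dhom_post _ _ _) _; apply: requiv_deq.
apply: requiv_eq (homot_refl _) _; exact: homot_sym.
Qed.

(** The connecting morphism from [Q] to [shift X] vanishes, so [w] becomes null homotopic after a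
    quasi-isomorphism [t]; [cone_colift] factors [t] through [v], and inverting [ccomp t s] gives
    the section. *)
Lemma ses_section X Y Q (i : chom X Y) (p : chom Y Q) :
  (forall j, is_kernel (i j) (p j)) -> (forall j, epi (p j)) ->
  hom0 Q (shift X) ->
  exists g : dhom Q Y, deq (DComp g (DMor p)) (did Q).
Proof.
move=> ik pe h0; have [Z [v [w ZP]]] := cone_ex abC i.
have [s [sq vs]] := ses_qis abC ZP ik pe.
have sE : qis s by apply/(qisP abC).
have w0 : deq (DMor w) (dzero Z (shift X)).
  apply: deq_trans (deq_sym (deq_morVK sE _)) _.
  apply: deq_trans (deq_compl _ (h0 _)) _; exact: deq_mor0r.
have [W [t [tq tP]]] := deq_chom abC w0.
have {}tP : homotopic (ccomp t w) (czero W (shift X)).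
  by apply: homot_trans tP _; apply: homot_eq => j; exact: compm0.
case: ZP => jj [q [biP dP]].
have [u uP] := cone_colift biP dP tP.
have tsE : qis (ccomp t s) by apply/(qisP abC)/qisE_comp.
exists (DComp (DInv tsE) (DMor u)).
apply: deq_trans (deq_compA _ _ _) _; apply: deq_trans (deq_Vmor tsE).
apply: deq_compl; apply: deq_trans (deq_mor _ _) _; apply: deq_homotopic.
apply: homot_sym; apply: homot_trans (homot_compr s uP) _.
by apply: homot_eq => j; rewrite /= compA vs.
Qed.

End Triangles.

(** * Objects concentrated in one degree *)

Section Concentrated.
Variables (K : fieldType) (C : klin K).
Hypothesis abC : abelian C.
Implicit Types X Y Z W V Q : cpx C.

(** As [s] is injective on cohomology, [W] has none above [n] and can be truncated there. *)
Lemma sub_qis_src X W (s : chom W X) (n : int) : qisE s ->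
  (forall j, n < j -> is_zero (X j)) ->
  exists W' (t : chom W' W), qisE t /\ forall j, n < j -> is_zero (W' j).
Proof.
move=> sq Xz; have [|W' [t [tq W'z _]]] := @trunc_qis_ex _ _ abC W n.
  move=> i ni U x xd.
  have xs : x \> s (i + 1) = 0 \> diff X i.
    by rewrite comp0m; apply: is_zero_tgt; apply: Xz; lia.
  exact: (sq i).1 xd xs.
by exists W', t.
Qed.

Lemma dhom_roof_le X Y (f : dhom X Y) (n : int) :
  (forall j, n < j -> is_zero (X j)) ->
  exists r : roof X Y, deq f (roof_dhom abC r) /\
    forall j, n < j -> is_zero (rsrc r j).
Proof.
move=> Xz; have [r fr] := dhom_roof abC f.
have [W [t [tq Wz]]] := sub_qis_src (rqisP r) Xz.
exists (Roof (qisE_comp tq (rqisP r)) (ccomp t (rmor r))); split=> //.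
exact: deq_trans fr (roof_dhom_pre abC tq).
Qed.

Lemma deq_chom_le X Y (f g : chom X Y) (n : int) :
  (forall j, n < j -> is_zero (X j)) -> deq (DMor f) (DMor g) ->
  exists W (s : chom W X), [/\ qisE s, forall j, n < j -> is_zero (W j) &
    homotopic (ccomp s f) (ccomp s g)].
Proof.
move=> Xz /(deq_chom abC) [W [s [sq sfg]]].
have [W' [t [tq W'z]]] := sub_qis_src sq Xz.
exists W', (ccomp t s); split=> //; first exact: qisE_comp.
apply: homot_trans (homot_compA _ _ _) _.
apply: homot_trans (homot_compl t sfg) _; exact: homot_sym (homot_compA _ _ _).
Qed.

(** Negative extensions vanish: a roof whose source is zero above [n] has only zero components to a
    complex living in degree [k > n]. *)
Lemma sconc_hom0_lt X Y n k : sconc X n -> sconc Y k -> n < k -> hom0 X Y.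
Proof.
move=> Xn Yk nk f; have [|r [fr rz]] := @dhom_roof_le _ _ f n.
  by move=> j jn; apply: Xn; lia.
apply: deq_trans fr _; apply: deq_trans (deq_comp0r _ (dinv abC (rqisP r))).
apply: deq_compl; apply: deq_chom_eq => j.
have [jk | /eqP jk] := eqVneq j k; last exact/is_zero_tgt/Yk.
by apply: is_zero_src; apply: rz; rewrite jk.
Qed.

(** As [W] stops in degree [n], its cohomology there is the cokernel of the incoming differential,
    and [s] identifies this cokernel with [X n]. *)
Lemma top_epi X W (s : chom W X) n : qisE s -> sconc X n ->
  (forall j, n < j -> is_zero (W j)) ->
  epi (s n) /\ forall Y (a : chom W Y), sconc Y n -> exists g, s n \> g = a n.
Proof.
move=> + Xn Wz; have [i ni] := int_succ n; move: Xn Wz.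
rewrite ni => Xn Wz sq.
have Xi : is_zero (X i) by apply: Xn; lia.
have se : epi (s (i + 1)).
  have [V [e [x [y' [ee _ ey]]]]] := (sq i).2 _ (idm (X (i + 1)))
    (is_zero_tgt _ (Xn (i + 1 + 1) ltac:(lia))).
  apply: epiI => U g sg; apply: (epi_eq0 ee).
  rewrite -(compm1 e) ey (is_zero_tgt y' Xi) comp0m addr0 compA sg.
  by rewrite compm0.
split=> // Y a Yn.
have [O [k kP]] := kernel_ex abC (s (i + 1)).
have Yi : is_zero (Y i) by apply: Yn; lia.
apply: (epi_desc abC se kP).
have kd : k \> diff W (i + 1) = 0 by apply: is_zero_tgt; apply: Wz; lia.
have ks : k \> s (i + 1) = 0 \> diff X i by rewrite kP.1 comp0m.
have [V [e [x' [ee ex]]]] := (sq i).1 _ _ _ kd ks.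
apply: (epi_eq0 ee); rewrite -compA ex compA cmapP.
by rewrite (is_zero_tgt (a i) Yi) comp0m compm0.
Qed.

(** By [top_epi], the numerator of a roof factors through its denominator. *)
Lemma sconc_full X Y n (f : dhom X Y) : sconc X n -> sconc Y n ->
  exists g : chom X Y, deq f (DMor g).
Proof.
move=> Xn Yn; have [|r [fr rz]] := @dhom_roof_le _ _ f n.
  by move=> j jn; apply: Xn; lia.
have [se sg] := top_epi (rqisP r) Xn rz.
have gex j : exists g : hom (X j) (Y j), rqis r j \> g = rmor r j.
  have [-> | /eqP jn] := eqVneq j n; first exact: sg.
  by exists 0; rewrite compm0 (is_zero_tgt (rmor r j)) //; exact: Yn.
pose g j := sval (boolp.cid (gex j)).
have gP j : rqis r j \> g j = rmor r j := svalP (boolp.cid (gex j)).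
have gC j : diff X j \> g (j + 1) = g j \> diff Y j.
  by rewrite (sconc_diff _ Xn) (sconc_diff _ Yn) comp0m compm0.
exists (CHom gC); apply: deq_trans fr _.
have rE : deq (DMor (rmor r)) (DComp (DMor (rqis r)) (DMor (CHom gC))).
  apply: deq_sym; apply: deq_trans (deq_mor _ _) _; exact: deq_chom_eq.
apply: deq_trans (deq_compl _ rE) _; exact: deq_VmorK.
Qed.

(** There is no room for a homotopy: in degree [n] one component starts above the top of [W], the
    other ends below the support of [Y]. *)
Lemma sconc_faithful X Y n (f g : chom X Y) : sconc X n -> sconc Y n ->
  deq (DMor f) (DMor g) -> forall j, f j = g j.
Proof.
move=> Xn Yn fg j.
have [|W [s [sq Wz [h hP]]]] := @deq_chom_le _ _ f g n _ fg.
  by move=> k kn; apply: Xn; lia.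
have [se _] := top_epi sq Xn Wz.
have [-> | /eqP jn] := eqVneq j n; last first.
  by rewrite (is_zero_src (f j)) ?(is_zero_src (g j)) //; exact: Xn.
apply: se; apply/eqP; rewrite -subr_eq0; apply/eqP.
have [i ni] := int_succ n; move: Xn Yn Wz; rewrite ni => Xn Yn Wz.
have := hP i; rewrite /= => ->.
rewrite (is_zero_src (h (i + 1))); last by apply: Wz; lia.
by rewrite (is_zero_tgt (h i)) ?compm0 ?comp0m ?addr0 //; apply: Yn; lia.
Qed.

(** The kernels of [idm O - e] and of [e] are complementary summands of [O]. *)
Lemma indec_idem (O : C) (e : hom O O) : indecomposable O -> e \> e = e ->
  e = 0 \/ e = idm O.
Proof.
case=> _ ind ee.
have [O1 [k1 k1P]] := kernel_ex abC (idm O - e).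
have [O2 [k2 k2P]] := kernel_ex abC e.
have [p1 p1k] : exists p1, p1 \> k1 = e.
  by apply: (kernel_lift k1P); rewrite compBr compm1 ee subrr.
have [p2 p2k] : exists p2, p2 \> k2 = idm O - e.
  by apply: (kernel_lift k2P); rewrite compBl comp1m ee subrr.
have m1 := kernel_mono k1P; have m2 := kernel_mono k2P.
have k1e : k1 \> e = k1.
  by apply/eqP; rewrite eq_sym -subr_eq0 -{1}(compm1 k1) -compBr k1P.1.
have b : is_biprod k1 k2 p1 p2.
  split.
  - by apply: m1; rewrite compA p1k comp1m.
  - by apply: m2; rewrite compA p2k comp1m compBr compm1 k2P.1 subr0.
  - by apply: m2; rewrite compA p2k comp0m k1P.1.
  - by apply: m1; rewrite compA p1k comp0m k2P.1.
  - by rewrite p1k p2k addrC subrK.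
have [z1 | z2] := ind _ _ _ _ _ _ b.
  by left; rewrite -p1k (is_zero_tgt p1 z1) comp0m.
right; apply/eqP; rewrite eq_sym -subr_eq0 -p2k.
by rewrite (is_zero_tgt p2 z2) comp0m.
Qed.

Lemma concO_trivial_idem X n O : concO X n O -> indecomposable O ->
  trivial_idem X.
Proof.
case=> Xn /(_ n (erefl n)) [u [u' [uu' u'u]]] indO e ee.
have [g eg] := sconc_full e Xn Xn.
have gg : g n \> g n = g n.
  apply: (@sconc_faithful X X n (ccomp g g) g Xn Xn).
  apply: deq_trans (deq_sym (deq_mor _ _)) _.
  apply: deq_trans (deq_comp (deq_sym eg) (deq_sym eg)) _.
  exact: deq_trans ee eg.
have idem : (u' \> g n \> u) \> (u' \> g n \> u) = u' \> g n \> u.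
  by rewrite !compA -(compA u u') uu' comp1m -(compA (g n) (g n)) gg.
have gE : g n = u \> (u' \> g n \> u) \> u'.
  by rewrite !compA uu' compm1 -compA uu' comp1m.
have [v0 | v1] := indec_idem indO idem; [left | right].
  apply: deq_trans eg _; apply: deq_chom_eq => j.
  have [-> | /eqP jn] := eqVneq j n; first by rewrite gE v0 compm0 comp0m.
  exact/is_zero_src/Xn.
apply: deq_trans eg _; apply: deq_chom_eq => j.
have [-> | /eqP jn] := eqVneq j n; first by rewrite gE v1 compm1 uu'.
by rewrite (is_zero_src (g j) (Xn j jn)) (is_zero_src (cid X j) (Xn j jn)).
Qed.

Hypothesis herC : hereditary C.

(** Translation by [n] turns [X] into a stalk in degree 0 and [Y] into a stalk shifted [n - k]
    times, so Hom becomes an Ext of order at least 2. *)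
Lemma sconc_hom0_gt X Y n k : sconc X n -> sconc Y k -> k + 2 <= n -> hom0 X Y.
Proof.
move=> Xn Yk kn; apply: (@hom0_transl _ _ abC n).
have [m mE] : exists m : nat, n - k = m%:Z by exists `|n - k|%N; lia.
have dX : diso (transl n X) (stalk (X n)).
  apply: (concO_diso abC) (concO_stalk _).
  by have := concO_transl n (sconc_concO Xn); rewrite subrr.
have dY : diso (transl n Y) (iter m (@shift K C) (stalk (Y k))).
  have := concO_iter_shift m (concO_stalk (Y k)).
  rewrite (_ : 0 - m%:Z = k - n); last by lia.
  exact/(concO_diso abC)/concO_transl/sconc_concO.
apply: hom0_diso dX dY _ => f; apply: herC; lia.
Qed.

(** Peels off the lowest term of [Z]: it is a quotient living in degree [r <= n - 2], so [Q] maps to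
    it by zero and every morphism lifts to the kernel, which starts in degree [r + 1]. The number
    [d] bounds how many degrees from [r] to [n - 2] remain. *)
Lemma hom0_devissage (d : nat) (Q Z : cpx C) (n r : int) : sconc Q n ->
  (forall j, n - 2 < j -> is_zero (Z j)) -> (forall j, j < r -> is_zero (Z j)) ->
  n - 1 - r <= d%:Z -> hom0 Q Z.
Proof.
move=> Qn; elim: d Z r => [|d IH] Z r Zu Zl nr.
  apply/hom0_tgt/acyclic_did => // i; apply: exact_zero.
  have [?|?] := Num.Theory.ltrP (i + 1) r; [exact: Zl | apply: Zu; lia].
have [rn|rn] := Num.Theory.ltrP (n - 2) r.
  apply/hom0_tgt/acyclic_did => // i; apply: exact_zero.
  have [?|?] := Num.Theory.ltrP (i + 1) r; [exact: Zl | apply: Zu; lia].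
have [Q' [p [Q'r pe pc]]] := topq_ex abC Z (r - 1).
rewrite subrK in Q'r.
have [X [i ik]] := kernel_complex abC p.
have im j : mono (i j) := kernel_mono (ik j).
have zX j : is_zero (Z j) -> is_zero (X j).
  by move=> Zj; apply: im; rewrite comp0m; exact: is_zero_tgt.
move=> f; have [|g fg] := ses_lift abC ik pe (f := f).
  by apply: (sconc_hom0_gt Qn Q'r); lia.
apply: deq_trans fg _; apply: deq_trans (deq_mor0l _ i); apply: deq_compr.
apply: (IH X (r + 1)); last by lia.
  by move=> j /Zu; exact: zX.
move=> j jr; have [? | ?] := Num.Theory.ltrP j r; first exact/zX/Zl.
have -> : j = r - 1 + 1 by lia.
have ip : i (r - 1 + 1) \> p (r - 1 + 1) = 0 := (ik _).1.
have [V [e [y [ee ey]]]] := cokernel_exact abC pc ip.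
apply: (epi_eq0 ee); rewrite compm1; apply: im.
rewrite comp0m ey (is_zero_tgt y) ?comp0m //; apply: Zl; lia.
Qed.

Lemma conc_hom Y Z n k (f : dhom Y Z) : conc Y n -> conc Z k ->
  ~ deq f (dzero Y Z) -> k <= n /\ n <= k + 1.
Proof.
move=> [Q [Qn YQ]] [Q' [Q'k ZQ']] f0.
suff h : ~ hom0 Q Q'.
  split.
    have [|kn] := Num.Theory.lerP k n => //; case: h.
    exact: sconc_hom0_lt Qn Q'k kn.
  have [|kn] := Num.Theory.lerP n (k + 1) => //; case: h.
  apply: sconc_hom0_gt Qn Q'k _; lia.
by move=> h; apply/f0/(hom0_diso YQ ZQ' h).
Qed.

(** The hypothesis leaves no cohomology above degree [n + 1]. Heredity gives the projection onto the
    top cohomology [Q] a section, hence an idempotent of [Y]: if it is 0 then [Q] vanishes, if it is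
    1 then [Y] is isomorphic to [Q]. *)
Lemma trivial_idem_top Y (n : int) : trivial_idem Y ->
  (forall i, n + 1 <= i -> exact_at (diff Y i) (diff Y (i + 1))) ->
  exact_at (diff Y n) (diff Y (n + 1)) \/ conc Y (n + 1).
Proof.
move=> tY Yex.
have [Y1 [m [mq Y1z mc]]] := trunc_qis_ex abC Yex.
have [Q [p [Qn pe pc]]] := topq_ex abC Y1 n.
have [X [i ik]] := kernel_complex abC p.
have im j : mono (i j) := kernel_mono (ik j).
(* Passing to the kernel of [p] removes the cohomology in degree [n + 1], so the kernel can be
   truncated at [n]. *)
have Xex k : n <= k -> exact_at (diff X k) (diff X (k + 1)).
  move=> nk; have [kn | kn] := eqVneq k n; last first.
    apply: exact_zero; apply: im; rewrite comp0m; apply: is_zero_tgt.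
    by apply: Y1z; lia.
  rewrite kn => W x xd.
  have xp : x \> i (n + 1) \> p (n + 1) = 0 by rewrite compA (ik _).1 compm0.
  have [V [e [y [ee ey]]]] := cokernel_exact abC pc xp.
  have yp : y \> p n = 0 by apply: is_zero_tgt; apply: Qn; lia.
  have [x' x'y] := kernel_lift (ik n) yp.
  exists V, e, x'; split=> //; apply: im.
  by rewrite !compA ey cmapP -(compA x') x'y.
have [X2 [t [tq X2z _]]] := trunc_qis_ex abC Xex.
have QX : hom0 Q (shift X).
  apply: hom0_diso (diso_refl Q) (diso_shift (diso_sym (diso_qisE abC tq))) _.
  have [r [s rs]] := cpx_bounded (shift X2).
  (* [X2] stops in degree [n], so its shift stops in [n - 1], two below the degree of [Q]. *)
  apply: (@hom0_devissage `|n - r|%N Q _ (n + 1) r Qn).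
  - by move=> j jn /=; apply: X2z; lia.
  - by move=> j jr; apply: rs; lia.
  - lia.
have [g gp] := ses_section abC ik pe QX.
have YY1 := diso_sym (diso_qisE abC mq).
have idem : deq (DComp (DComp (DMor p) g) (DComp (DMor p) g)) (DComp (DMor p) g).
  apply: deq_trans (deq_compA _ _ _) _; apply: deq_compl.
  apply: deq_trans (deq_sym (deq_compA _ _ _)) _.
  by apply: deq_trans (deq_compr _ gp) _; exact: deq_comp1m.
have [e0 | e1] := trivial_idem_diso YY1 tY idem; [left | right]; last first.
  exists Q; split=> //; apply: diso_trans YY1 _.
  by exists (DMor p), g.
have Q0 : acyclic Q.
  apply: (did_acyclic abC).
  apply: deq_trans (deq_sym (deq_comp1m _)) _.
  apply: deq_trans (deq_comp (deq_sym gp) (deq_sym gp)) _.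
  apply: deq_trans (deq_compA _ _ _) _.
  apply: deq_trans (deq_compl _ (deq_sym (deq_compA _ _ _))) _.
  apply: deq_trans (deq_compl _ (deq_compr _ e0)) _.
  by apply: deq_trans (deq_compl _ (deq_comp0l _ _)) _; exact: deq_comp0r.
have Qz : is_zero (Q (n + 1)).
  have d0 : idm (Q (n + 1)) \> diff Q (n + 1) = 0 by rewrite (sconc_diff _ Qn) compm0.
  have [V [e [x [ee ex]]]] := Q0 _ _ _ d0.
  apply: (epi_eq0 ee); by rewrite ex (sconc_diff _ Qn) compm0.
move=> W y yd; have [|y1 y1m] := mc (n + 1) W y _ yd; first by lia.
have y1p : y1 \> p (n + 1) = 0 by exact: is_zero_tgt.
have [V [e [y' [ee ey]]]] := cokernel_exact abC pc y1p.
by exists V, e, (y' \> m n); split=> //; rewrite -y1m -compA ey !compA cmapP.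
Qed.

(** The degree is searched for downwards from the upper bound of [Y]; running below the lower bound
    would make [Y] acyclic, hence zero. *)
Lemma trivial_idem_conc Y : trivial_idem Y -> ~ deq (did Y) (dzero Y Y) ->
  exists n, conc Y n.
Proof.
move=> tY Y0; have [r [s rs]] := cpx_bounded Y.
suff main (d : nat) (n : int) : n + 1 - r <= d%:Z ->
    (forall i, n <= i -> exact_at (diff Y i) (diff Y (i + 1))) ->
    acyclic Y \/ exists n, conc Y n.
  case: (main (absz (s + 1 - r)%R) s); first by lia.
  - by move=> i si; apply/exact_zero/rs; lia.
  - by move=> /(acyclic_did abC) /Y0.
  - by [].
elim: d n => [|d IH] n nd nex.
  left=> i; have [ni | ni] := Num.Theory.lerP n i; first exact: nex.
  by apply/exact_zero/rs; lia.
have [|e|c] := trivial_idem_top tY (n := n - 1); last by right; eexists; exact: c.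
  by move=> i; rewrite subrK; exact: nex.
apply: (IH (n - 1)); first by lia.
move=> i ni; have [-> // | ne] := eqVneq i (n - 1); apply: nex; lia.
Qed.

End Concentrated.

(** * The abelian category of modules *)

Section ModuleCategory.
Variables (K : fieldType) (A : falgType K).
Implicit Types M N P S W : rmod A.

Lemma mhom_ex M N (f : M -> N) : linear f ->
  (forall x a, f (mact x a) = mact (f x) a) ->
  exists g : mhom M N, forall x, g x = f x.
Proof.
move=> lf fa.
pose L : {linear M -> N} := HB.pack f (GRing.isLinear.Build K M N *:%R f lf).
have La : linfun L \in @is_mhom K A M N by apply/asboolP => x a; rewrite !lfunE.
by exists (MHom La) => x; rewrite lfunE.
Qed.

Lemma mcompE M N P (f : @hom K (modcat A) M N) (g : @hom K (modcat A) N P) x :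
  mhom_val (f \> g : mhom M P) x = mhom_val (g : mhom N P) (mhom_val (f : mhom M N) x).
Proof. by rewrite lfunE. Qed.

Lemma midE M x : mhom_val (@idm K (modcat A) M : mhom M M) x = x.
Proof. by rewrite lfunE. Qed.

Lemma mhomD M N (f g : mhom M N) x : (f + g) x = f x + g x.
Proof. by rewrite lfunE. Qed.

Lemma mhom0 M N x : (0 : mhom M N) x = 0.
Proof. by rewrite lfunE. Qed.

Lemma mhomZ M N k (f : mhom M N) x : (k *: f) x = k *: f x.
Proof. by rewrite lfunE. Qed.

Lemma mactB M (x y : M) a : mact (x - y) a = mact x a - mact y a.
Proof. by rewrite mactDl -scaleN1r mactZl scaleN1r. Qed.

Lemma mact_sum M I (r : seq I) (F : I -> M) a :
  mact (\sum_(i <- r) F i) a = \sum_(i <- r) mact (F i) a.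
Proof.
by apply: (big_morph (fun x => mact x a)) => [x y|]; [exact: mactDl | exact: mact0].
Qed.

Lemma is_zeroP M : @is_zero K (modcat A) M <-> forall x : M, x = 0.
Proof.
split=> [M0 x | M0]; last by apply: mhom_eq => x; rewrite (M0 x) !linear0.
have := f_equal (fun f : mhom M M => f x) M0.
by rewrite lfunE /= lfunE.
Qed.

Section Submodule.
Variables (M : rmod A) (U : {vspace M}).
Hypothesis Us : submodule U.

Definition sub_act (x : subvs_of U) a : subvs_of U := vsproj U (mact (vsval x) a).

Lemma sub_actE x a : vsval (sub_act x a) = mact (vsval x) a.
Proof. by rewrite vsprojK //; apply/Us/subvsP. Qed.

Definition sub_rmod : rmod A.
Proof.
refine (@RMod K A (subvs_of U) sub_act _ _ _ _ _ _).
- by move=> x; apply: val_inj; rewrite /= sub_actE mact1.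
- by move=> x a b; apply: val_inj; rewrite /= !sub_actE mactM.
- by move=> x y a; apply: val_inj; rewrite /= !sub_actE linearD mactDl.
- by move=> x a b; apply: val_inj; rewrite /= !sub_actE mactDr.
- by move=> k x a; apply: val_inj; rewrite /= !sub_actE linearZ mactZl.
- by move=> k x a; apply: val_inj; rewrite /= !sub_actE mactZr.
Defined.

Lemma sub_rmod_ex : exists N (i : mhom N M), (forall x, i x = 0 -> x = 0) /\
  forall x, x \in U <-> exists y, i y = x.
Proof.
exists sub_rmod.
have [||i iE] := @mhom_ex sub_rmod M (@vsval K M U).
- by move=> k x y; rewrite linearP.
- by move=> x a; rewrite /= sub_actE.
exists i; split=> [x | x].
  rewrite iE => x0; apply: val_inj; rewrite /= x0.
  exact: (esym (linear0 (@vsval K M U))).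
split=> [xU | [y <-]]; last by rewrite iE subvsP.
by exists (vsproj U x); rewrite iE vsprojK.
Qed.

End Submodule.

Section Quotient.
Variables (M : rmod A) (U : {vspace M}).
Hypothesis Us : submodule U.

(** The quotient by [U] is carried by a linear complement of [U], the image of this projection, with
    the action projected back into it. *)
Definition quo_proj : 'End(M) := (\1 - projv U)%VF.

Lemma quo_projE x : quo_proj x = x - projv U x.
Proof. by rewrite !lfunE /= !lfunE. Qed.

Lemma quo_proj_eq0 x : quo_proj x = 0 <-> x \in U.
Proof.
rewrite quo_projE; split=> [/eqP | xU]; last by rewrite projv_id // subrr.
by rewrite subr_eq0 => /eqP ->; exact: memv_proj.
Qed.

Lemma quo_projK x a : quo_proj (mact (quo_proj x) a) = quo_proj (mact x a).
Proof.
rewrite (quo_projE x) mactB linearB /=.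
by rewrite (quo_proj_eq0 (mact (projv U x) a)).2 ?subr0 //; apply/Us/memv_proj.
Qed.

Definition quo_act (y : subvs_of (limg quo_proj)) a : subvs_of (limg quo_proj) :=
  vsproj _ (quo_proj (mact (vsval y) a)).

Lemma quo_actE y a : vsval (quo_act y a) = quo_proj (mact (vsval y) a).
Proof. by rewrite vsprojK // memv_img ?memvf. Qed.

Definition quo_rmod : rmod A.
Proof.
refine (@RMod K A (subvs_of (limg quo_proj)) quo_act _ _ _ _ _ _).
- move=> y; apply: val_inj; rewrite /= quo_actE mact1.
  have /memv_imgP [x _ ->] := subvsP y.
  by rewrite -[quo_proj x in LHS]mact1 quo_projK mact1.
- by move=> x a b; apply: val_inj; rewrite /= !quo_actE quo_projK mactM.
- by move=> x y a; apply: val_inj; rewrite /= !quo_actE linearD mactDl linearD.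
- by move=> x a b; apply: val_inj; rewrite /= !quo_actE mactDr linearD.
- by move=> k x a; apply: val_inj; rewrite /= !quo_actE linearZ mactZl linearZ.
- by move=> k x a; apply: val_inj; rewrite /= !quo_actE mactZr linearZ.
Defined.

Lemma quo_rmod_ex : exists N (p : mhom M N), (forall y, exists x, p x = y) /\
    forall x, p x = 0 <-> x \in U.
Proof.
exists quo_rmod.
have im x : quo_proj x \in limg quo_proj by rewrite memv_img ?memvf.
have [||p pE] := @mhom_ex M quo_rmod
    (fun x => vsproj (limg quo_proj) (quo_proj x) : subvs_of (limg quo_proj)).
- by move=> k x y; rewrite !linearP.
- by move=> x a; apply: val_inj; rewrite /= quo_actE !vsprojK // quo_projK.
exists p; split=> [y | x].
  have /memv_imgP [x _ yx] := subvsP (y : subvs_of (limg quo_proj)).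
  by exists x; rewrite pE; apply: val_inj; rewrite /= vsprojK.
rewrite pE -quo_proj_eq0; split=> [e | ->]; last exact: linear0.
by rewrite -(vsprojK (im x)) e linear0.
Qed.

End Quotient.

(** The inverse image under [p] is chosen only linearly; the descended map still respects the action
    because [g x] depends on [p x] alone. *)
Lemma mhom_desc M N W (p : mhom M N) (g : mhom M W) :
  (forall y, exists x, p x = y) -> (forall x, p x = 0 -> g x = 0) ->
  exists u : mhom N W, mcomp p u = g.
Proof.
move=> ps pg; have pK y : p ((mhom_val p)^-1%VF y) = y.
  by have [x <-] := ps y; rewrite limg_lfunVK // memv_img ?memvf.
have g_eq x x' : p x = p x' -> g x = g x'.
  move=> pxx'; apply/eqP; rewrite -subr_eq0 -linearB; apply/eqP/pg.
  by rewrite linearB /= pxx' subrr.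
have [||u uE] := @mhom_ex N W (fun y => g ((mhom_val p)^-1%VF y)).
- by move=> k x y; rewrite !linearP.
- by move=> y a; rewrite -mhomP; apply: g_eq; rewrite mhomP !pK.
exists u; apply: mhom_eq => x; rewrite lfunE /= uE; apply: g_eq; exact: pK.
Qed.

Lemma mhom_factor M N W (i : mhom N M) (g : mhom W M) :
  (forall x, i x = 0 -> x = 0) -> (forall x, exists y, i y = g x) ->
  exists u : mhom W N, mcomp u i = g.
Proof.
move=> i0 ig; have iK x : i ((mhom_val i)^-1%VF (g x)) = g x.
  by have [y <-] := ig x; rewrite limg_lfunVK // memv_img ?memvf.
have i_inj x y : i x = i y -> x = y.
  move=> ixy; apply/eqP; rewrite -subr_eq0; apply/eqP/i0.
  by rewrite linearB /= ixy subrr.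
have [||u uE] := @mhom_ex W N (fun x => (mhom_val i)^-1%VF (g x)).
- by move=> k x y; rewrite !linearP.
- by move=> x a; apply: i_inj; rewrite /= (mhomP i) !iK mhomP.
by exists u; apply: mhom_eq => x; rewrite lfunE /= uE iK.
Qed.

Lemma limg_submodule M N (f : mhom M N) : submodule (limg f).
Proof. by move=> _ a /memv_imgP [x _ ->]; rewrite -mhomP memv_img ?memvf. Qed.

Lemma lker_submodule M N (f : mhom M N) : submodule (lker f).
Proof. by move=> x a; rewrite !memv_ker mhomP => /eqP ->; rewrite mact0. Qed.

Lemma mod_mono_inj M N (f : @hom K (modcat A) M N) :
  mono f -> forall x, mhom_val (f : mhom M N) x = 0 -> x = 0.
Proof.
move=> fm x fx; have [Z [k [_ kP]]] := sub_rmod_ex (@lker_submodule M N f).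
have [y <-] : exists y, k y = x by apply/kP; rewrite memv_ker fx.
suff -> : k = 0 by rewrite mhom0.
apply: (mono_eq0 (C := modcat A) fm); apply: mhom_eq => z.
rewrite mcompE mhom0; apply/eqP; rewrite -memv_ker; apply/kP; by exists z.
Qed.

Lemma mod_epi_surj M N (f : @hom K (modcat A) M N) :
  epi f -> forall y, exists x, mhom_val (f : mhom M N) x = y.
Proof.
move=> fe y; have [Q [p [_ pP]]] := quo_rmod_ex (@limg_submodule M N f).
suff : y \in limg (f : mhom M N) by case/memv_imgP => x _ ->; exists x.
apply/pP; suff -> : p = 0 by rewrite mhom0.
apply: (epi_eq0 (C := modcat A) fe); apply: mhom_eq => z.
by rewrite mcompE mhom0; apply/pP; rewrite memv_img ?memvf.
Qed.

Lemma mod_inj_mono M N (f : @hom K (modcat A) M N) :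
  (forall x, mhom_val (f : mhom M N) x = 0 -> x = 0) -> mono f.
Proof.
move=> f0; apply: monoI => W h hf; apply: mhom_eq => x; rewrite mhom0; apply: f0.
by have := f_equal (fun g : mhom W N => g x) hf; rewrite mcompE mhom0.
Qed.

Lemma mod_surj_epi M N (f : @hom K (modcat A) M N) :
  (forall y, exists x, mhom_val (f : mhom M N) x = y) -> epi f.
Proof.
move=> fs; apply: epiI => W h hf; apply: mhom_eq => y; rewrite mhom0.
have [x <-] := fs y.
by have := f_equal (fun g : mhom M W => g x) hf; rewrite mcompE mhom0.
Qed.

Lemma mod_is_kernel M N Z (k : @hom K (modcat A) Z M) (f : @hom K (modcat A) M N) :
  (forall z, mhom_val (k : mhom Z M) z = 0 -> z = 0) ->
  (forall x, mhom_val (f : mhom M N) x = 0 <-> exists z, mhom_val (k : mhom Z M) z = x) ->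
  is_kernel k f.
Proof.
move=> k0 kf; split=> [|W g gf].
  by apply: mhom_eq => z; rewrite mcompE mhom0; apply/kf; exists z.
have [x|u uk] := @mhom_factor _ _ _ (k : mhom Z M) (g : mhom W M) k0.
  apply/kf; by have := f_equal (fun g : mhom W N => g x) gf; rewrite mcompE mhom0.
exists u; split=> // u' u'k.
by apply: (mod_inj_mono k0); rewrite u'k.
Qed.

Lemma mod_is_cokernel M N Z (p : @hom K (modcat A) N Z) (f : @hom K (modcat A) M N) :
  (forall z, exists y, mhom_val (p : mhom N Z) y = z) ->
  (forall y, mhom_val (p : mhom N Z) y = 0 <-> exists x, mhom_val (f : mhom M N) x = y) ->
  is_cokernel p f.
Proof.
move=> ps pf; split=> [|W g gf].
  by apply: mhom_eq => z; rewrite mcompE mhom0; apply/pf; exists z.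
have [y|u uk] := @mhom_desc _ _ _ (p : mhom N Z) (g : mhom N W) ps.
  case/pf => x <-.
  by have := f_equal (fun g : mhom M W => g x) gf; rewrite mcompE mhom0.
exists u; split=> // u' u'k.
by apply: (mod_surj_epi ps); rewrite u'k.
Qed.

Definition prod_rmod M N : rmod A.
Proof.
refine (@RMod K A (M * N)%type (fun x a => (mact x.1 a, mact x.2 a)) _ _ _ _ _ _).
- by case=> x y; rewrite /= !mact1.
- by case=> x y a b; rewrite /= !mactM.
- by case=> x y [x' y'] a; rewrite /= !mactDl.
- by case=> x y a b; rewrite /= !mactDr.
- by move=> k [x y] a; rewrite /= !mactZl.
- by move=> k [x y] a; rewrite /= !mactZr.
Defined.

Lemma prod_rmod_biprod M N : exists (i1 : @hom K (modcat A) M (prod_rmod M N))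
    (i2 : @hom K (modcat A) N (prod_rmod M N))
    (p1 : @hom K (modcat A) (prod_rmod M N) M)
    (p2 : @hom K (modcat A) (prod_rmod M N) N), is_biprod i1 i2 p1 p2.
Proof.
have [||i1 i1E] := @mhom_ex M (prod_rmod M N) (fun x => (x, 0 : N)).
- by move=> k x y; apply: injective_projections; rewrite /= ?scaler0 ?addr0.
- by move=> x a; rewrite /= mact0.
have [||i2 i2E] := @mhom_ex N (prod_rmod M N) (fun x => (0 : M, x)).
- by move=> k x y; apply: injective_projections; rewrite /= ?scaler0 ?addr0.
- by move=> x a; rewrite /= mact0.
have [||p1 p1E] := @mhom_ex (prod_rmod M N) M fst; try by [].
have [||p2 p2E] := @mhom_ex (prod_rmod M N) N snd; try by [].
exists i1, i2, p1, p2; split; apply: mhom_eq => x.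
- by rewrite mcompE p1E i1E midE.
- by rewrite mcompE p2E i2E midE.
- by rewrite mcompE p2E i1E mhom0.
- by rewrite mcompE p1E i2E mhom0.
- rewrite mhomD !mcompE i1E i2E p1E p2E midE; case: x => x y.
  by congr pair; rewrite /= ?addr0 ?add0r.
Qed.

Lemma modcat_abelian : abelian (modcat A).
Proof.
split.
- by move=> M N; exists (prod_rmod M N); exact: prod_rmod_biprod.
- move=> M N f; have [Z [k [k0 kP]]] := sub_rmod_ex (@lker_submodule M N f).
  exists Z, k; apply: mod_is_kernel => // x; rewrite -kP memv_ker.
  by split=> /eqP.
- move=> M N f; have [Z [p [ps pP]]] := quo_rmod_ex (@limg_submodule M N f).
  exists Z, p; apply: mod_is_cokernel => // y; rewrite pP.
  split=> [/memv_imgP [x _ ->] | [x <-]]; first by exists x.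
  by rewrite memv_img ?memvf.
- move=> M N f fm; have [Z [p [ps pP]]] := quo_rmod_ex (@limg_submodule M N f).
  exists Z, p; apply: mod_is_kernel => [|y]; first exact: mod_mono_inj.
  rewrite pP; split=> [/memv_imgP [x _ ->] | [x <-]]; first by exists x.
  by rewrite memv_img ?memvf.
- move=> M N f fe; have [Z [k [k0 kP]]] := sub_rmod_ex (@lker_submodule M N f).
  exists Z, k; apply: mod_is_cokernel => [|x]; first exact: mod_epi_surj.
  by rewrite -kP memv_ker; split=> /eqP.
Qed.

Lemma regular_projective : projective (regular_mod A).
Proof.
move=> M N g f gs; have [x gx] := gs (f (1 : A)).
have [||h hE] := @mhom_ex (regular_mod A) M (fun a => mact x a).
- by move=> k a b; rewrite mactDr mactZr.
- by move=> a b; rewrite /= mactM.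
exists h; apply: mhom_eq => a; rewrite lfunE /= hE mhomP gx -mhomP /=.
by rewrite mul1r.
Qed.

Lemma maximal_submodule_ex M : ~ @is_zero K (modcat A) M ->
  exists U : {vspace M}, maximal_submodule U.
Proof.
move=> M0; pose Pr n := `[< exists U : {vspace M}, [/\ submodule U, U <> fullv & \dim U = n] >].
have Pex : exists n, Pr n.
  exists 0%N; apply/asboolP; exists 0%VS; split; last exact: dimv0.
    by move=> x a; rewrite !memv0 => /eqP ->; rewrite mact0.
  move=> e; apply/M0/is_zeroP => x; apply/eqP; by rewrite -memv0 e memvf.
have Pub n : Pr n -> (n <= \dim (fullv : {vspace M}))%N.
  by case/asboolP => U [_ _ <-]; exact/dimvS/subvf.
case: (ex_maxnP Pex Pub) => n /asboolP [U [Us Uf Ud]] nmax.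
exists U; split=> // V Vs UV; have [->|Vf] := pselect (V = fullv); [by right | left].
apply/eqP; rewrite eq_sym eqEdim UV Ud; apply: nmax; apply/asboolP.
by exists V.
Qed.

Lemma lpreim_submodule M N (f : mhom M N) (V : {vspace N}) :
  submodule V -> submodule (f @^-1: V)%VS.
Proof. by move=> Vs x a; rewrite -!memv_preim mhomP => /Vs. Qed.

Lemma limg_sub_submodule M N (f : mhom M N) (V : {vspace M}) :
  submodule V -> submodule (f @: V)%VS.
Proof. by move=> Vs _ a /memv_imgP [x xV ->]; rewrite -mhomP memv_img //; exact: Vs. Qed.

Lemma simple_quotient M (U : {vspace M}) : maximal_submodule U ->
  exists S (p : mhom M S), [/\ simple_mod S, forall y, exists x, p x = y &
    forall x, p x = 0 <-> x \in U].
Proof.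
case=> Us Uf Umax; have [S [p [ps pP]]] := quo_rmod_ex Us.
exists S, p; split=> //; split=> [S0 | V Vs].
  apply: Uf; apply/vspaceP => x; rewrite memvf; apply/pP/eqP.
  by rewrite -memv0 -S0 memvf.
have UV : (U <= p @^-1: V)%VS.
  by apply/subvP => x /pP px; rewrite -memv_preim px mem0v.
case: (Umax _ (lpreim_submodule Vs) UV) => e; [left | right].
  apply/eqP; rewrite -subv0; apply/subvP => y yV; rewrite memv0; apply/eqP.
  have [x xy] := ps y; rewrite -xy; apply/pP; rewrite -e -memv_preim xy.
  exact: yV.
apply/vspaceP => y; rewrite memvf; have [x <-] := ps y.
by rewrite memv_preim e memvf.
Qed.

End ModuleCategory.

(** * Polynomials in an endomorphism and projective complexes *)

Section EndomorphismPolynomials.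
Variables (K : fieldType) (C : klin K).
Implicit Types (p q : {poly K}).

Lemma comp_suml (X Y Z : C) n (F : 'I_n -> hom X Y) (g : hom Y Z) :
  (\sum_(k < n) F k) \> g = \sum_(k < n) (F k \> g).
Proof.
by apply: (big_morph (fun f => f \> g)) => [f f'|]; [exact: compDl | exact: comp0m].
Qed.

Lemma comp_sumr (X Y Z : C) n (F : 'I_n -> hom Y Z) (f : hom X Y) :
  f \> (\sum_(k < n) F k) = \sum_(k < n) (f \> F k).
Proof.
by apply: (big_morph (fun g => f \> g)) => [g g'|]; [exact: compDr | exact: compm0].
Qed.

Definition hpow (X : C) (e : hom X X) k := iter k (fun f => f \> e) (idm X).

(** Evaluation is spelled out because [hom X X] carries only a vector space structure, composition
    being a separate operation. *)
Definition hpev (X : C) (e : hom X X) p := \sum_(k < size p) p`_k *: hpow e k.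

Section OneObject.
Variables (X : C) (e : hom X X).

Lemma hpev_widen p n : (size p <= n)%N -> hpev e p = \sum_(k < n) p`_k *: hpow e k.
Proof.
move=> pn; rewrite /hpev (big_ord_widen n (fun k => p`_k *: hpow e k)) // big_mkcond.
apply: eq_bigr => k _; case: ltnP => // kp.
by rewrite nth_default // scale0r.
Qed.

Lemma hpevD p q : hpev e (p + q) = hpev e p + hpev e q.
Proof.
rewrite (hpev_widen (size_polyD p q)).
rewrite (@hpev_widen p (maxn (size p) (size q))) ?leq_maxl //.
rewrite (@hpev_widen q (maxn (size p) (size q))) ?leq_maxr // -big_split.
by apply: eq_bigr => k _; rewrite coefD scalerDl.
Qed.

Lemma hpevZ c p : hpev e (c *: p) = c *: hpev e p.
Proof.
rewrite (hpev_widen (size_scale_leq c p)) /hpev scaler_sumr.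
by apply: eq_bigr => k _; rewrite coefZ scalerA.
Qed.

Lemma hpevN p : hpev e (- p) = - hpev e p.
Proof. by rewrite -[- p]scaleN1r hpevZ scaleN1r. Qed.

Lemma hpevC c : hpev e c%:P = c *: idm X.
Proof.
by rewrite (@hpev_widen _ 1) ?size_polyC_leq1 // big_ord1 coefC.
Qed.

Lemma hpevMX p : hpev e (p * 'X) = hpev e p \> e.
Proof.
rewrite (@hpev_widen _ (size p).+1); last first.
  by apply: leq_trans (size_polyMleq _ _) _; rewrite size_polyX addn2.
rewrite big_ord_recl coefMX /= scale0r add0r /hpev comp_suml.
by apply: eq_bigr => k _; rewrite coefMX /= compZl.
Qed.

Lemma hpevM p q : hpev e (p * q) = hpev e p \> hpev e q.
Proof.
elim/poly_ind: q => [|q c IH].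
  by rewrite mulr0 -[0]/(0%:P : {poly K}) hpevC scale0r compm0.
rewrite mulrDr mulrA !hpevD !hpevMX IH [p * c%:P]mulrC mul_polyC hpevZ hpevC.
by rewrite compDr compZr compm1 compA.
Qed.

End OneObject.

Lemma hpev_nat (X Y : C) (e : hom X X) (e' : hom Y Y) (f : hom X Y) p :
  f \> e' = e \> f -> f \> hpev e' p = hpev e p \> f.
Proof.
move=> fe; rewrite /hpev comp_sumr comp_suml; apply: eq_bigr => k _.
rewrite compZr compZl; congr (_ *: _).
elim: (nat_of_ord k) => [|n IH] /=; first by rewrite compm1 comp1m.
by rewrite -compA IH compA fe -compA.
Qed.

Definition cpev (P : cpx C) (e : chom P P) p : chom P P.
Proof.
refine (@CHom K C P P (fun i => hpev (e i) p) _) => i.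
by apply: hpev_nat; rewrite cmapP.
Defined.

(** Modulo the relation [e \> e = e], a polynomial equals its affine interpolation at 0 and 1. *)
Lemma cpev_homotopic (P : cpx C) (e : chom P P) p : homotopic (ccomp e e) e ->
  homotopic (cpev e p) (fun i => p.[0] *: idm (P i) + (p.[1] - p.[0]) *: e i).
Proof.
case=> k kP; elim/poly_ind: p => [|p c [h hP]].
  exists (fun=> 0) => i; rewrite /= -[0 : {poly K}]/(0%:P) hpevC !hornerC.
  by rewrite subr0 !scale0r addr0 subr0 compm0 comp0m addr0.
exists (fun i => h i \> e i + (p.[1] - p.[0]) *: k i) => i.
rewrite /= hpevD hpevMX hpevC !hornerE /=.
have {hP} hE := hP i; have kE := kP i; rewrite /= in hE kE.
have pE : hpev (e (i + 1)) p = p.[0] *: idm (P (i + 1)) +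
    (p.[1] - p.[0]) *: e (i + 1) +
    (diff P (i + 1) \> h (i + 1) + h i \> diff P i) by rewrite -hE; zmod.
rewrite pE.
have eE : e (i + 1) \> e (i + 1) = e (i + 1) +
  (diff P (i + 1) \> k (i + 1) + k i \> diff P i) by rewrite -kE; zmod.
rewrite !(compDl, compDr, compZl, compZr, comp1m) eE !compA -!cmapP !scalerDr.
rewrite addrK !scalerBl; zmod.
Qed.

End EndomorphismPolynomials.

Section SplitIdempotent.
Variables (K : fieldType) (C : klin K).
Hypothesis abC : abelian C.

Lemma split_idempotent_cpx (P : cpx C) (e : chom P P) :
  (forall j, e j \> e j = e j) ->
  exists (Q : cpx C) (i : chom Q P) (p : chom P Q),
    (forall j, i j \> p j = idm (Q j)) /\ (forall j, p j \> i j = e j).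
Proof.
move=> ee; have kex j : exists S : {O : C & hom O (P j)},
    is_kernel (projT2 S) (idm (P j) - e j).
  by have [O [k kP]] := kernel_ex abC (idm (P j) - e j); exists (existT _ O k).
pose S j := projT1 (sval (boolp.cid (kex j))).
pose m j : hom (S j) (P j) := projT2 (sval (boolp.cid (kex j))).
have mP j : is_kernel (m j) (idm (P j) - e j) := svalP (boolp.cid (kex j)).
have mm j : mono (m j) := kernel_mono (mP j).
have me j : m j \> e j = m j.
  by apply/eqP; rewrite eq_sym -subr_eq0 -{1}(compm1 (m j)) -compBr (mP j).1.
have pex j : exists p, p \> m j = e j.
  by apply: (kernel_lift (mP j)); rewrite compBr compm1 ee subrr.
pose p j := sval (boolp.cid (pex j)).
have pm j : p j \> m j = e j := svalP (boolp.cid (pex j)).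
have mp j : m j \> p j = idm (S j) by apply: mm; rewrite compA pm me comp1m.
have [||d [dd [bnd dm]]] := @subcomplex _ _ P S m; first exact: mm.
  move=> j; exists (m j \> diff P j \> p (j + 1)).
  by rewrite compA pm !compA cmapP -compA me.
have pC j : diff P j \> p (j + 1) = p j \> diff (Cpx dd bnd) j.
  by apply: mm; rewrite !compA dm pm -compA pm -cmapP.
by exists (Cpx dd bnd), (@CHom K C (Cpx dd bnd) P m dm), (@CHom K C P (Cpx dd bnd) p pC).
Qed.

End SplitIdempotent.

(** * Complexes of projectives *)

Section ProjectiveComplexes.
Variables (K : fieldType) (C : klin K).
Hypothesis abC : abelian C.
Implicit Types (P Q Y W : cpx C).

Definition pobj (M : C) := forall (V W : C) (e : hom V W) (f : hom M W),
  epi e -> exists h, h \> e = f.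

Definition pcpx P := forall i, pobj (P i).

Lemma retract_pobj (M N : C) (s : hom M N) (r : hom N M) :
  s \> r = idm M -> pobj N -> pobj M.
Proof.
move=> sr Np V W e f ee; have [h hE] := Np V W e (r \> f) ee.
by exists (s \> h); rewrite compA hE -compA sr comp1m.
Qed.

Lemma projective_lift (M X Y Z : C) (f : hom X Y) (g : hom Y Z) (y : hom M Y) :
  pobj M -> exact_at f g -> y \> g = 0 -> exists x : hom M X, x \> f = y.
Proof.
move=> Mp fg yg; have [V [e [x [ee ex]]]] := fg _ _ yg.
have [s sE] := Mp V M e (idm M) ee.
by exists (s \> x); rewrite compA -ex -compA sE comp1m.
Qed.

(** The homotopy is built downwards from the upper bound [s] of [P]: what is left of [f] after the
    known component is a cocycle of [Y], and it lifts along the differential since [P (i + 1)] is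
    projective. *)
Lemma proj_null P Y (f : chom P Y) : pcpx P -> acyclic Y ->
  homotopic f (czero P Y).
Proof.
move=> Pp Yac; have [r [s rs]] := cpx_bounded P.
have step (n : nat) : exists h : forall i, hom (P (i + 1)) (Y i), forall i, s - n%:Z <= i ->
    f (i + 1) = diff P (i + 1) \> h (i + 1) + h i \> diff Y i.
  elim: n => [|n [h hP]].
    exists (fun=> 0) => i si; rewrite compm0 comp0m addr0.
    apply/is_zero_src/rs; lia.
  (* Only the component of index [s - n.+1] is redefined; the equations already established involve
     higher indices alone. *)
  have mex i : exists m : hom (P (i + 1)) (Y i),
      (i <> s - n.+1%:Z -> m = h i) /\
      (i = s - n.+1%:Z -> f (i + 1) = diff P (i + 1) \> h (i + 1) + m \> diff Y i).
    have [i0 | /eqP ne] := eqVneq i (s - n.+1%:Z); last by exists (h i).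
    have yd : (f (i + 1) - diff P (i + 1) \> h (i + 1)) \> diff Y (i + 1) = 0.
      have hE : f (i + 1 + 1) = _ := hP (i + 1) ltac:(lia).
      rewrite compBl -cmapP hE compDr -compA diffK comp0m add0r compA.
      by rewrite subrr.
    have [m mE] := projective_lift (Pp (i + 1)) (Yac i) yd.
    by exists m; split=> // _; rewrite mE; zmod.
  pose m i := sval (boolp.cid (mex i)).
  have m1 i : i <> s - n.+1%:Z -> m i = h i := (svalP (boolp.cid (mex i))).1.
  have m2 i : i = s - n.+1%:Z -> f (i + 1) = diff P (i + 1) \> h (i + 1) + m i \> diff Y i
    := (svalP (boolp.cid (mex i))).2.
  exists m => i si; rewrite (m1 (i + 1)); last by lia.
  have [/m2 // | /eqP ne] := eqVneq i (s - n.+1%:Z).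
  by rewrite m1 //; apply: hP; lia.
have [h hP] := step (absz (s + 1 - r)%R).
exists h => i; rewrite /= subr0.
have [si | si] := Num.Theory.lerP (s - (absz (s + 1 - r)%R)%:Z) i; first exact: hP.
have P0 : is_zero (P (i + 1)) by apply: rs; lia.
rewrite (is_zero_src (f (i + 1)) P0) (is_zero_src (diff P (i + 1)) P0).
by rewrite (is_zero_src (h i) P0) !comp0m addr0.
Qed.

(** The inclusion of [P] into the acyclic cone of [s] is null homotopic, so the identity of [P]
    lifts along [s]. *)
Lemma proj_section P W (s : chom W P) : pcpx P -> qisE s ->
  exists t : chom P W, homotopic (ccomp t s) (cid P).
Proof.
move=> Pp sq; have [Z [v [w [j [q [biP dP]]]]]] := cone_ex abC s.
have v0 := proj_null (ccomp (cid P) v) Pp (cone_acyclic biP dP sq).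
by have [t tP] := cone_lift biP dP v0; exists t; exact: homot_sym.
Qed.

(** Denominators over [P] split by [proj_section], so fractions reduce to chain maps;
    [proj_faithful] uses the same splitting. *)
Lemma proj_full P Y (f : dhom P Y) : pcpx P -> exists g : chom P Y, deq f (DMor g).
Proof.
move=> Pp; have [r fr] := dhom_roof abC f.
have [t ts] := proj_section Pp (rqisP r).
exists (ccomp t (rmor r)); apply: deq_trans fr _.
apply: deq_trans (deq_sym (deq_comp1m _)) _.
apply: deq_trans (deq_compr _ (deq_homotopic (homot_sym ts))) _.
apply: deq_trans (deq_sym (deq_morA _ _ _)) _.
by apply: deq_trans (deq_compl _ (deq_morVK _ _)) _; exact: deq_mor.
Qed.

Lemma proj_faithful P Y (f g : chom P Y) : pcpx P ->
  deq (DMor f) (DMor g) -> homotopic f g.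
Proof.
move=> Pp /(deq_chom abC) [W [s [sq sfg]]].
have [t ts] := proj_section Pp sq.
have reduce (h : chom P Y) : homotopic h (ccomp t (ccomp s h)).
  apply: homot_sym; apply: homot_trans (homot_sym (homot_compA _ _ _)) _.
  apply: homot_trans (homot_compr h ts) _.
  by apply: homot_eq => i; rewrite /= comp1m.
apply: homot_trans (reduce f) _; apply: homot_trans (homot_compl t sfg) _.
exact: homot_sym (reduce g).
Qed.

Hypothesis annP : forall (M : C) (e : hom M M), exists2 p : {poly K}, p != 0 & hpev e p = 0.

(** Boundedness leaves finitely many degrees, and the product of their annihilating polynomials
    serves for all of them. *)
Lemma annihilating_poly_cpx P (e : chom P P) :
  exists2 p : {poly K}, p != 0 & forall i, hpev (e i) p = 0.
Proof.
have [r [s rs]] := cpx_bounded P.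
pose a i := sval (boolp.cid2 (annP (e i))).
have a0 i : a i != 0 := s2valP (boolp.cid2 (annP (e i))).
have aP i : hpev (e i) (a i) = 0 := s2valP' (boolp.cid2 (annP (e i))).
pose n := absz (s + 1 - r)%R.
exists (\prod_(k < n) a (r + (val k)%:Z)); first by apply/prodf_neq0 => k _.
move=> i; have [ri | ri] := boolP ((r <= i) && (i <= s)); last first.
  exact: (is_zero_src _ (rs i ri)).
have kn : (absz (i - r)%R < n)%N by rewrite /n; lia.
rewrite (bigD1 (Ordinal kn)) //= (_ : r + _ = i); last by lia.
by rewrite hpevM aP comp0m.
Qed.

(** Let [m] annihilate [e] strictly and write it as [q * 'X^k] with [q] nonzero at 0. The Bezout
    relation [u * q + v * 'X^k = 1] makes [w = v * 'X^k] idempotent modulo [m], so [w] evaluated at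
    [e] is strictly idempotent. It is homotopic to [e] when [w] takes the values 0 at 0 and 1 at
    1. *)
Lemma idempotent_lift P (e : chom P P) : homotopic (ccomp e e) e ->
  homotopic e (czero P P) \/
  exists e0 : chom P P, (forall j, e0 j \> e0 j = e0 j) /\ homotopic e0 e.
Proof.
move=> ee.
have [m0 m0n m0P] := annihilating_poly_cpx e.
(* The extra factor makes 0 a root, so that [k] is positive and [w] vanishes at 0. *)
pose m := m0 * 'X.
have mn : m != 0 by rewrite mulf_neq0 // polyX_eq0.
have mP i : hpev (e i) m = 0 by rewrite hpevMX m0P comp0m.
have m00 : m.[0] = 0 by rewrite hornerMX mulr0.
have [k [q]] := multiplicity_XsubC m 0.
rewrite mn /= polyC0 subr0 => q0 mE.
have [[u v] /= uv] : exists u, u.1 * q + u.2 * 'X^k = 1.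
  apply/Bezout_eq1_coprimepP; rewrite coprimep_expr //.
  by rewrite -['X]subr0 -polyC0 coprimep_XsubC.
pose w := v * 'X^k.
have k0 : k != 0%N.
  apply: contraNneq q0 => k0; move: m00; rewrite mE k0 expr0 mulr1.
  by move/eqP.
have w0 : w.[0] = 0 by rewrite hornerM hornerXn expr0n (negbTE k0) mulr0.
(* If [m] is nonzero at 1, then [m] evaluated at [e], which is zero, is homotopic to a nonzero
   multiple of [e]. *)
have [m1 | m1] := eqVneq m.[1] 0; last first.
  left; have [h hP] := cpev_homotopic m ee.
  exists (fun i => - (m.[1])^-1 *: h i) => i.
  have := hP i; rewrite /= mP m00 scale0r add0r subr0 => hE.
  rewrite compZr compZl -scalerDr -hE subr0 add0r scaleNr scalerN opprK.
  by rewrite scalerA mulVf // scale1r.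
have w1 : w.[1] = 1.
  have q1 : q.[1] = 0.
    by move: m1; rewrite mE hornerM hornerXn expr1n mulr1.
  by have := f_equal (fun p => p.[1]) uv; rewrite hornerD hornerM q1 mulr0 add0r hornerC.
have e0e : homotopic (cpev e w) e.
  have [h hP] := cpev_homotopic w ee; exists h => i; rewrite -hP w0 w1.
  by rewrite scale0r add0r subr0 scale1r.
have idem j : cpev e w j \> cpev e w j = cpev e w j.
  rewrite /= -hpevM; apply/eqP; rewrite -subr_eq0 -hpevN -hpevD.
  rewrite (_ : w * w - w = (- u * v) * m); first by rewrite hpevM mP compm0.
  have wE : w - 1 = - (u * q) by rewrite -uv -/w; ring.
  rewrite -[X in _ - X]mulr1 -mulrBr wE mE /w; ring.
by right; exists (cpev e w).
Qed.

End ProjectiveComplexes.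

Section ModuleComplexes.
Variables (K : fieldType) (A : falgType K).
Implicit Types (M N : rmod A) (P Q : cpx (modcat A)).

Lemma mhom_sum M N n (F : 'I_n -> mhom M N) x :
  (\sum_(k < n) F k) x = \sum_(k < n) F k x.
Proof.
by apply: (big_morph (fun f : mhom M N => f x)) => [f g|]; [exact: mhomD | exact: mhom0].
Qed.

Lemma annihilating_poly M (e : @hom K (modcat A) M M) :
  exists2 p : {poly K}, p != 0 & hpev e p = 0.
Proof.
set n := (dim 'Hom(M, M)).+1.
pose X := [tuple (mhom_val (hpow e (val k) : mhom M M)) | k < n].
have /freeP nf : ~~ free X.
  apply: contraTN isT => /eqP; rewrite size_tuple => Xd.
  by have := dimvS (subvf <<X>>); rewrite Xd dimvf ltnn.
have [c [cX [i ci]]] : exists c : 'I_n -> K,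
    \sum_(i < n) c i *: X`_i = 0 /\ exists i, c i <> 0.
  apply: contrapT => h; apply: nf => c cX i; apply: contrapT => ci.
  by apply: h; exists c; split=> //; exists i.
exists (\poly_(k < n) c (inord k)).
  apply/eqP => p0; apply: ci; have := f_equal (fun p : {poly K} => p`_i) p0.
  by rewrite coef_poly ltn_ord inord_val coef0.
rewrite (@hpev_widen _ _ _ _ _ n) ?size_poly //; apply: mhom_eq => x.
rewrite mhom_sum mhom0; have := f_equal (fun f : 'End(M) => f x) cX.
rewrite sum_lfunE lfunE /= => cX0; apply: etrans cX0; apply: eq_bigr => k _.
by rewrite mhomZ !lfunE /= coef_poly ltn_ord inord_val (nth_mktuple _ _ k).
Qed.

End ModuleComplexes.

(** * Equivalences of derived categories *)

Section HomotopyIndecomposable.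
Variables (K : fieldType) (C : klin K).
Hypothesis abC : abelian C.
Hypothesis annP : forall (M : C) (e : hom M M),
  exists2 p : {poly K}, p != 0 & hpev e p = 0.
Implicit Types (P Q R : cpx C).

(** [Kb_indecomposable] over a general category, with categorical projectivity [pobj] in place of
    [projective]. *)
Definition hindec P :=
  ~ homotopic (cid P) (czero P P) /\
  forall Q R, pcpx Q -> pcpx R ->
  forall (i1 : chom Q P) (i2 : chom R P) (p1 : chom P Q) (p2 : chom P R),
    homotopic (ccomp i1 p1) (cid Q) ->
    homotopic (ccomp i2 p2) (cid R) ->
    homotopic (ccomp i1 p2) (czero Q R) ->
    homotopic (ccomp i2 p1) (czero R Q) ->
    homotopic (fun i => ccomp p1 i1 i + ccomp p2 i2 i) (cid P) ->
    homotopic (cid Q) (czero Q Q) \/ homotopic (cid R) (czero R R).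

Lemma hindec_idem P (e : chom P P) : pcpx P -> hindec P ->
  (forall j, e j \> e j = e j) ->
  homotopic e (czero P P) \/ homotopic e (cid P).
Proof.
move=> Pp [_ Pind] ee.
have [Q [i1 [p1 [ip1 pi1]]]] := split_idempotent_cpx abC ee.
pose e' := csub (cid P) e.
have e'e' j : e' j \> e' j = e' j.
  by rewrite /= compBl comp1m compBr compm1 ee subrr subr0.
have [R [i2 [p2 [ip2 pi2]]]] := split_idempotent_cpx abC e'e'.
have ie1 j : i1 j \> e j = i1 j by rewrite -pi1 -compA ip1 comp1m.
have ie2 j : i2 j \> e' j = i2 j by rewrite -pi2 -compA ip2 comp1m.
have ep1 j : e j \> p1 j = p1 j by rewrite -pi1 compA ip1 compm1.
have ep2 j : e' j \> p2 j = p2 j by rewrite -pi2 compA ip2 compm1.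
have ee'0 j : e j \> e' j = 0 by rewrite /= compBr compm1 ee subrr.
have e'e0 j : e' j \> e j = 0 by rewrite /= compBl comp1m ee subrr.
have [||||||| z1 | z2] := Pind Q R _ _ i1 i2 p1 p2.
- by move=> j; exact: retract_pobj (ip1 j) (Pp j).
- by move=> j; exact: retract_pobj (ip2 j) (Pp j).
- exact: homot_eq.
- exact: homot_eq.
- apply: homot_eq => j; rewrite [LHS]/= -ie1 -ep2 compA -(compA (e j)) ee'0.
  by rewrite comp0m compm0.
- apply: homot_eq => j; rewrite [LHS]/= -ie2 -ep1 compA -(compA (e' j)) e'e0.
  by rewrite comp0m compm0.
- exists (fun=> 0) => j; rewrite /= pi1 pi2 compm0 comp0m addr0 /=; zmod.
- left; apply: homot_trans (_ : homotopic (ccomp p1 (ccomp (cid Q) i1)) _).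
    by apply: homot_eq => j; rewrite /= comp1m pi1.
  exact/homot_comp0r/homot_comp0l.
right; apply: homot_sym; apply/csub_eq0.
apply: homot_trans (_ : homotopic (ccomp p2 (ccomp (cid R) i2)) _).
  by apply: homot_eq => j; rewrite [RHS]/= comp1m pi2.
exact/homot_comp0r/homot_comp0l.
Qed.

(** Fullness turns [E] into a chain map and faithfulness turns its idempotency into a homotopy;
    [idempotent_lift] makes it strict, so that it splits degreewise and indecomposability
    applies. *)
Lemma hindec_trivial_idem P : pcpx P -> hindec P -> trivial_idem P.
Proof.
move=> Pp Pind E EE; have [e Ee] := proj_full abC E Pp.
have ee : homotopic (ccomp e e) e.
  apply: (proj_faithful abC) => //; apply: deq_trans (deq_sym (deq_mor _ _)) _.
  apply: deq_trans (deq_comp (deq_sym Ee) (deq_sym Ee)) _.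
  exact: deq_trans EE Ee.
have reduce (g : chom P P) : homotopic e g -> deq E (DMor g).
  by move=> eg; apply: deq_trans Ee _; exact: deq_homotopic.
have [e0 | [e0 [e0e0 e0e]]] := idempotent_lift annP ee; first by left; exact: reduce.
have [h | h] := hindec_idem Pp Pind e0e0; [left | right]; apply: reduce;
  exact: homot_trans (homot_sym e0e) h.
Qed.

Lemma hindec_neq0 P : pcpx P -> hindec P -> ~ deq (did P) (dzero P P).
Proof. by move=> Pp [P0 _] /(proj_faithful abC Pp). Qed.

Lemma concO_pcpx X n (O : C) : pobj O -> concO X n O -> pcpx X.
Proof.
move=> Op [Xn XO] j; have [/XO [u [u' [uu' u'u]]] | /eqP jn] := eqVneq j n.
  exact: retract_pobj uu' Op.
move=> V W e f _; exists 0; rewrite comp0m; symmetry.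
exact/is_zero_src/Xn.
Qed.

(** A cocycle that is no boundary, seen as a map from [O] placed in one degree. That complex is
    projective, so if the map vanished it would be null homotopic, and the homotopy would exhibit
    [f] as a boundary. *)
Lemma point_to Q n (O : C) (f : hom O (Q (n + 1))) : pobj O ->
  f \> diff Q (n + 1) = 0 -> (forall h, f <> h \> diff Q n) ->
  exists X, concO X (n + 1) O /\ exists u : dhom X Q, ~ deq u (dzero X Q).
Proof.
move=> Op fd fh.
have ex j : exists S : {O' : C & hom O' (Q j)},
    (j <> n + 1 -> is_zero (projT1 S)) /\ forall e : n + 1 = j,
      exists u : hom O (projT1 S), is_iso u /\ u \> projT2 S = f \> tr Q e.
  have [jn | /eqP jn] := eqVneq j (n + 1).
    rewrite jn; exists (existT _ O f); split=> // e; exists (idm O).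
    by rewrite tr_id compm1 comp1m; split=> //; exact: is_iso_id.
  exists (existT _ (zobj C) (0 : hom (zobj C) (Q j))).
  by split=> [_ | e]; [exact: zobjP | case: jn].
pose S j := projT1 (sval (boolp.cid (ex j))).
pose g j : hom (S j) (Q j) := projT2 (sval (boolp.cid (ex j))).
have Sz j : j <> n + 1 -> is_zero (S j) by case: (svalP (boolp.cid (ex j))).
have [u [ui ug]] : exists u : hom O (S (n + 1)), is_iso u /\ u \> g (n + 1) = f.
  have [_ /(_ (erefl _)) [u]] := svalP (boolp.cid (ex (n + 1))).
  by rewrite tr_id compm1; exists u.
have bnd : exists r s : int, forall i, ~~ ((r <= i) && (i <= s)) -> is_zero (S i).
  by exists (n + 1), (n + 1) => i ni; apply: Sz; lia.
pose X := @Cpx K C S (fun=> 0) (fun=> comp0m _ _) bnd.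
have gC j : diff X j \> g (j + 1) = g j \> diff Q j.
  rewrite comp0m; have [-> | /eqP jn] := eqVneq j (n + 1); last first.
    symmetry; exact/is_zero_src/Sz.
  by symmetry; apply: (epi_eq0 (is_iso_epi ui)); rewrite -compA ug.
have XO : concO X (n + 1) O.
  by split=> // j ->; apply: isomorphic_sym; exists u.
exists X; split=> //; exists (DMor (@CHom K C X Q g gC)).
move=> /(proj_faithful abC (concO_pcpx Op XO)) [h hP].
apply: (fh (u \> h n)); have := hP n; rewrite /= comp0m add0r subr0 => gE.
by rewrite compA -gE ug.
Qed.

(** Dual to [point_to]; here the projectivity of [Q] turns vanishing into a null homotopy. *)
Lemma point_from Q n (O : C) (f : hom (Q (n + 1)) O) : pcpx Q ->
  diff Q n \> f = 0 -> (forall h, f <> diff Q (n + 1) \> h) ->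
  exists X, concO X (n + 1) O /\ exists u : dhom Q X, ~ deq u (dzero Q X).
Proof.
move=> Qp fd fh.
have ex j : exists S : {O' : C & hom (Q j) O'},
    (j <> n + 1 -> is_zero (projT1 S)) /\ forall e : j = n + 1,
      exists u : hom (projT1 S) O, is_iso u /\ projT2 S \> u = tr Q e \> f.
  have [jn | /eqP jn] := eqVneq j (n + 1).
    rewrite jn; exists (existT _ O f); split=> // e; exists (idm O).
    by rewrite tr_id compm1 comp1m; split=> //; exact: is_iso_id.
  exists (existT _ (zobj C) (0 : hom (Q j) (zobj C))).
  by split=> [_ | e]; [exact: zobjP | case: jn].
pose S j := projT1 (sval (boolp.cid (ex j))).
pose g j : hom (Q j) (S j) := projT2 (sval (boolp.cid (ex j))).
have Sz j : j <> n + 1 -> is_zero (S j) by case: (svalP (boolp.cid (ex j))).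
have [u [ui gu]] : exists u : hom (S (n + 1)) O, is_iso u /\ g (n + 1) \> u = f.
  have [_ /(_ (erefl _)) [u]] := svalP (boolp.cid (ex (n + 1))).
  by rewrite tr_id comp1m; exists u.
have bnd : exists r s : int, forall i, ~~ ((r <= i) && (i <= s)) -> is_zero (S i).
  by exists (n + 1), (n + 1) => i ni; apply: Sz; lia.
pose X := @Cpx K C S (fun=> 0) (fun=> comp0m _ _) bnd.
have gC j : diff Q j \> g (j + 1) = g j \> diff X j.
  rewrite compm0; have [-> | /eqP jn] := eqVneq j n; last first.
    apply/is_zero_tgt/Sz => jn1; apply: jn; exact: addIr jn1.
  by apply: (mono_eq0 (is_iso_mono ui)); rewrite compA gu.
have XO : concO X (n + 1) O by split=> // j ->; exists u.
exists X; split=> //; exists (DMor (@CHom K C Q X g gC)).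
move=> /(proj_faithful abC Qp) [h hP].
apply: (fh (h (n + 1) \> u)); have := hP n; rewrite /= compm0 addr0 subr0 => gE.
by rewrite -compA -gE gu.
Qed.

End HomotopyIndecomposable.

Section Equivalence.
Variables (K : fieldType) (C D : klin K).
Hypothesis (abC : abelian C) (abD : abelian D) (herD : hereditary D).
Variable F : triangle_functor C D.
Hypothesis FE : triangle_equivalence F.
Implicit Types X Y : cpx C.

(** Linearity under scalars suffices: zero is 0 times itself, and scaling by 0 means composing with
    a zero map. *)
Lemma tmap_zero X Y : deq (tmap F (dzero X Y)) (dzero (F X) (F Y)).
Proof.
apply: (@deq_trans _ _ _ _ _ (tmap F (dscale 0 (dzero X Y)))).
  by apply: tmap_deq; exact/deq_sym/deq_comp0l.
apply: deq_trans (tmap_scale F 0 _) _.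
apply: deq_trans (deq_comp0r _ (tmap F (dzero X Y))); apply: deq_compl.
by apply: deq_chom_eq => i; exact: scale0r.
Qed.

Lemma tmap_neq0 X Y (f : dhom X Y) : ~ deq f (dzero X Y) ->
  ~ deq (tmap F f) (dzero (F X) (F Y)).
Proof.
move=> f0 Ff0; case: FE => faithF _ _; apply/f0/faithF.
exact: deq_trans Ff0 (deq_sym (tmap_zero X Y)).
Qed.

Lemma tobj_diso X Y : diso X Y -> diso (F X) (F Y).
Proof.
case=> f [g [fg gf]]; exists (tmap F f), (tmap F g); split.
  apply: deq_trans (deq_sym (tmap_comp F f g)) _.
  by apply: deq_trans (tmap_deq F fg) _; exact: tmap_id.
apply: deq_trans (deq_sym (tmap_comp F g f)) _.
by apply: deq_trans (tmap_deq F gf) _; exact: tmap_id.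
Qed.

Lemma tobj_trivial_idem X : trivial_idem X -> trivial_idem (F X).
Proof.
move=> tX e ee; case: FE => faithF fullF _; have [f fe] := fullF X X e.
have ff : deq (DComp f f) f.
  apply: faithF; apply: deq_trans (tmap_comp F f f) _.
  apply: deq_trans (deq_comp fe fe) _; apply: deq_trans ee _; exact: deq_sym.
have [f0 | f1] := tX f ff; [left | right].
  apply: deq_trans (deq_sym fe) _; apply: deq_trans (tmap_deq F f0) _.
  exact: tmap_zero.
apply: deq_trans (deq_sym fe) _; apply: deq_trans (tmap_deq F f1) _.
exact: tmap_id.
Qed.

Lemma tobj_conc X : trivial_idem X -> ~ deq (did X) (dzero X X) ->
  exists n, conc (F X) n.
Proof.
move=> tX X0; apply: (trivial_idem_conc abD herD); first exact: tobj_trivial_idem.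
move=> FX0; apply: (tmap_neq0 X0); apply: deq_trans FX0.
exact: tmap_id.
Qed.

Lemma tobj_iter_shift X k : diso (F (iter k (@shift K C) X)) (iter k (@shift K D) (F X)).
Proof.
elim: k => [|k IH] /=; first exact: diso_refl.
apply: diso_trans (diso_shift IH).
by exists (tshift F (iter k (@shift K C) X)); exact: tshift_iso.
Qed.

Lemma tobj_hom_degree X Y (f : dhom X Y) n k : ~ deq f (dzero X Y) ->
  conc (F X) n -> conc (F Y) k -> k <= n /\ n <= k + 1.
Proof. by move=> /tmap_neq0 f0 Xn Yk; exact: (conc_hom abD herD Xn Yk f0). Qed.

Lemma concO_neq0 X n (O : C) : concO X n O -> indecomposable O ->
  ~ deq (did X) (dzero X X).
Proof.
case=> Xn /(_ n (erefl n)) [u [u' [uu' u'u]]] [O0 _] X0; apply: O0.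
have e0 := sconc_faithful abC Xn Xn X0 n.
by rewrite /is_zero -u'u -(compm1 u') [idm (X n)]e0 compm0 comp0m.
Qed.

Lemma concO_conc X n (O : C) : concO X n O -> indecomposable O ->
  exists k, conc (F X) k.
Proof.
move=> XO indO; apply: tobj_conc; last exact: concO_neq0 XO indO.
exact: (concO_trivial_idem abC XO indO).
Qed.

(** [shift] only lowers degrees. For [c < c'], some degree [n'] of [F X'] exists anyway; shifting
    down gives [F X] a second degree, which equals [n] because the identity of [X] is nonzero. *)
Lemma conc_tobj_degree X X' c c' (O : C) n : indecomposable O ->
  concO X c O -> concO X' c' O -> conc (F X) n -> conc (F X') (n + c' - c).
Proof.
move=> indO.
have down Y Y' d d' m : d' <= d -> concO Y d O -> concO Y' d' O ->
    conc (F Y) m -> conc (F Y') (m + d' - d).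
  move=> dd' YO Y'O Ym; have [k kE] : exists k : nat, d - d' = k%:Z.
    by exists (absz (d - d')%R); lia.
  have YY' : diso (iter k (@shift K C) Y) Y'.
    have := concO_iter_shift k YO; rewrite (_ : d - k%:Z = d'); last by lia.
    by move=> kO; exact: (concO_diso abC kO Y'O).
  apply: conc_diso (tobj_diso YY') _.
  apply: conc_diso (diso_sym (tobj_iter_shift Y k)) _.
  rewrite (_ : m + d' - d = m - k%:Z); last by lia.
  exact: conc_iter_shift.
move=> XO X'O Xn; have [cc | cc] := Num.Theory.lerP c' c; first exact: down cc XO X'O Xn.
have [n' X'n'] := concO_conc X'O indO.
have Xn' : conc (F X) (n' + c - c') by apply: down X'O XO X'n'; lia.
have X0 := concO_neq0 XO indO.
have h1 := tobj_hom_degree X0 Xn Xn'; have h2 := tobj_hom_degree X0 Xn' Xn.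
by rewrite (_ : n + c' - c = n'); last lia.
Qed.

End Equivalence.

(** * The strong global dimension *)

Section ProjectiveModules.
Variables (K : fieldType) (A : falgType K).
Implicit Types (M N P S : rmod A).

Let abA : abelian (modcat A) := @modcat_abelian K A.

Lemma projective_pobj P : projective P -> @pobj K (modcat A) P.
Proof.
move=> Pp V W e f ee; have [h hE] := Pp V W e f (mod_epi_surj ee).
by exists h.
Qed.

Lemma pobj_projective P : @pobj K (modcat A) P -> projective P.
Proof.
move=> Pp M N g f gs; have [h hE] := Pp M N g f (mod_surj_epi gs).
by exists h.
Qed.

Lemma regular_pobj : @pobj K (modcat A) (regular_mod A).
Proof. exact/projective_pobj/regular_projective. Qed.

Lemma Kb_indecomposable_hindec (P : cpx (modcat A)) :
  Kb_indecomposable P -> hindec P.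
Proof.
case=> P0 Pind; split=> // Q R Qp Rp; apply: Pind => j; apply: pobj_projective.
  exact: Qp.
exact: Rp.
Qed.

Lemma regular_map_ex M (x : M) : exists f : mhom (regular_mod A) M,
  forall a : A, f a = mact x a.
Proof.
apply: (@mhom_ex _ _ (regular_mod A) M (fun a => mact x a)).
- by move=> k a b; rewrite mactDr mactZr.
- by move=> a b; rewrite /= mactM.
Qed.

Lemma exists_notin_proper M (U : {vspace M}) : U <> fullv -> exists x, x \notin U.
Proof.
move=> Uf; apply: contrapT => h; apply: Uf; apply/vspaceP => x; rewrite memvf.
by apply/negPn/negP => xU; apply: h; exists x.
Qed.

Definition free_rmod (m : nat) : rmod A.
Proof.
refine (@RMod K A {ffun 'I_m -> A} (fun f a => [ffun i => f i * a]) _ _ _ _ _ _).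
- by move=> f; apply/ffunP => i; rewrite !ffunE mulr1.
- by move=> f a b; apply/ffunP => i; rewrite !ffunE mulrA.
- by move=> f g a; apply/ffunP => i; rewrite !ffunE mulrDl.
- by move=> f a b; apply/ffunP => i; rewrite !ffunE mulrDr.
- by move=> k f a; apply/ffunP => i; rewrite !ffunE scalerAl.
- by move=> k f a; apply/ffunP => i; rewrite !ffunE scalerAr.
Defined.

(** The dual basis lemma: the functionals [c] are the coordinates of a section of the free cover
    given by a vector space basis of [M]. It reduces maps out of [M] to maps into the regular
    module. *)
Lemma dual_basis M : projective M -> exists m (b : 'I_m -> M)
    (c : 'I_m -> mhom M (regular_mod A)),
  forall x, x = \sum_(k < m) mact (b k) (c k x : A).
Proof.
move=> Mp; pose m := \dim (fullv : {vspace M}).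
pose b (k : 'I_m) : M := (vbasis (fullv : {vspace M}))`_k.
exists m, b.
have [||F FE] := @mhom_ex _ _ (free_rmod m) M
    (fun f : {ffun 'I_m -> A} => \sum_(k < m) mact (b k) (f k)).
- move=> k f g; rewrite scaler_sumr -big_split; apply: eq_bigr => i _.
  by rewrite !ffunE mactDr mactZr.
- by move=> f a; rewrite mact_sum; apply: eq_bigr => i _; rewrite ffunE mactM.
have Fs y : exists f, F f = y.
  exists ([ffun k => coord (vbasis (fullv : {vspace M})) k y *: 1] : {ffun 'I_m -> A}).
  rewrite FE [RHS](coord_vbasis (memvf y)); apply: eq_bigr => k _.
  by rewrite ffunE mactZr mact1.
have [s sF] := Mp _ _ F (mid M) Fs.
have cex (k : 'I_m) : exists c : mhom M (regular_mod A),
    forall x, c x = (s x : {ffun 'I_m -> A}) k.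
  apply: (@mhom_ex _ _ M (regular_mod A) (fun x => (s x : {ffun 'I_m -> A}) k)).
  - by move=> a x y; rewrite linearP !ffunE.
  - by move=> x a; rewrite mhomP /= ffunE.
exists (fun k => sval (boolp.cid (cex k))) => x.
have := f_equal (fun f : mhom M M => f x) sF.
rewrite lfunE /= FE lfunE /= => {1}<-; apply: eq_bigr => k _.
by rewrite (svalP (boolp.cid (cex k))).
Qed.

Section Basic.
Variables (n : nat) (P : 'I_n -> modcat A).
Variables (e : forall i, @hom K (modcat A) (P i) (regular_mod A)).
Variables (p : forall i, @hom K (modcat A) (regular_mod A) (P i)).
Hypothesis ep : forall i, e i \> p i = idm (P i).
Hypothesis pe : \sum_(i < n) (p i \> e i) = idm (regular_mod A : modcat A).

Lemma basic_pobj i : pobj (P i).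
Proof. exact: retract_pobj (ep i) regular_pobj. Qed.

Lemma regular_sum (a : A) :
  a = \sum_(i < n) mhom_val (e i : mhom (P i) (regular_mod A))
        (mhom_val (p i : mhom (regular_mod A) (P i)) a).
Proof.
have := f_equal (fun f : mhom (regular_mod A) (regular_mod A) => f a) pe.
rewrite midE mhom_sum => {1}<-; apply: eq_bigr => i _.
exact: (mcompE (p i) (e i) a).
Qed.

(** Take [x] outside a maximal submodule [U]. Decomposing 1 in the regular module puts some
    component of [x] outside [U] as well; boundaries lie in the radical, hence in [U], so this
    component is no boundary. *)
Lemma point_to_top (Q : cpx (modcat A)) k : radical_cpx Q ->
  ~ is_zero (Q (k + 1)) -> is_zero (Q (k + 1 + 1)) ->
  exists i X, concO X (k + 1) (P i) /\ exists u : dhom X Q, ~ deq u (dzero X Q).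
Proof.
move=> Qrad Q0 Qz; have [U Umax] := maximal_submodule_ex Q0.
have [x xU] : exists x, x \notin U by apply: exists_notin_proper; case: Umax.
have [f fE] := regular_map_ex x.
pose f' : @hom K (modcat A) (regular_mod A) (Q (k + 1)) := f.
have [i fi] : exists i : 'I_n,
    f (mhom_val (e i : mhom (P i) (regular_mod A))
        (mhom_val (p i : mhom (regular_mod A) (P i)) (1 : A))) \notin U.
  apply: contrapT => h; move/negP: xU; apply.
  rewrite -(mact1 x) -fE [X in f X](regular_sum 1) linear_sum; apply: memv_suml => i _.
  by apply/negPn/negP => fi; apply: h; exists i.
exists i; apply: (point_to abA (f := e i \> f') (@basic_pobj i)).
  exact: is_zero_tgt.
move=> h fh; move/negP: fi; apply.
have := f_equal (fun g : mhom (P i) (Q (k + 1)) =>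
  g (mhom_val (p i : mhom (regular_mod A) (P i)) (1 : A))) fh.
by rewrite !mcompE => ->; apply: Qrad.
Qed.

(** If [f \> g] were the identity, [g] would be onto and the preimage of a maximal submodule [U]
    under [g] would be maximal. It would contain the radical image of [f], so [U] would be all of
    [M]. *)
Lemma radical_not_split M N (f : @hom K (modcat A) M N) (g : @hom K (modcat A) N M) :
  ~ @is_zero K (modcat A) M ->
  (forall x, in_radical (mhom_val (f : mhom M N) x)) -> f \> g <> idm (M : modcat A).
Proof.
move=> M0 frad fg; have [U [Us Uf Umax]] := maximal_submodule_ex M0.
have [x xU] := exists_notin_proper Uf.
have gf y : mhom_val (g : mhom N M) (mhom_val (f : mhom M N) y) = y.
  have := f_equal (fun h : mhom M M => h y) fg.
  by rewrite mcompE midE.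
pose G := mhom_val (g : mhom N M).
suff Vmax : maximal_submodule (G @^-1: U)%VS.
  have := frad x _ Vmax; rewrite -memv_preim /G gf => xU'; by rewrite xU' in xU.
split; first exact: lpreim_submodule.
  move=> Vf; have : mhom_val (f : mhom M N) x \in (G @^-1: U)%VS by rewrite Vf memvf.
  by rewrite -memv_preim /G gf => xU'; rewrite xU' in xU.
move=> V Vs UV.
have UGV : (U <= G @: V)%VS.
  apply/subvP => u uU; rewrite -(gf u); apply: memv_img; apply: (subvP UV).
  by rewrite -memv_preim /G gf.
have [GV | GV] := Umax _ (@limg_sub_submodule _ _ _ _ (g : mhom N M) V Vs) UGV.
  left; apply/eqP; rewrite eqEsubv UV andbT; apply/subvP => v vV.
  by rewrite -memv_preim -GV; exact: memv_img.
right; apply/vspaceP => y; rewrite memvf.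
have : G y \in (G @: V)%VS by rewrite GV memvf.
case/memv_imgP => v vV Gyv; rewrite -(subrK v y) memvD //; apply: (subvP UV).
by rewrite -memv_preim linearB /= Gyv subrr mem0v.
Qed.

(** If all maps from the lowest term to the [P i] factored through the differential, so would all
    maps to the regular module, and by a dual basis the identity; the differential would then split,
    against [radical_not_split]. *)
Lemma point_from_bottom (Q : cpx (modcat A)) k : proj_cpx Q -> radical_cpx Q ->
  ~ is_zero (Q (k + 1)) -> is_zero (Q k) ->
  exists i X, concO X (k + 1) (P i) /\ exists u : dhom Q X, ~ deq u (dzero Q X).
Proof.
move=> Qp Qrad Q0 Qz.
suff [i [f fh]] : exists i (f : hom (Q (k + 1)) (P i)),
    forall h, f <> diff Q (k + 1) \> h.
  exists i; apply: (point_from abA (f := f)) => //.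
    by move=> j; exact: projective_pobj.
  exact: is_zero_src.
apply: contrapT => none.
have fac (f : @hom K (modcat A) (Q (k + 1)) (regular_mod A)) :
    exists h, f = diff Q (k + 1) \> h.
  have hex i : exists h, f \> p i = diff Q (k + 1) \> h.
    apply: contrapT => hn; apply: none; exists i, (f \> p i) => h fh.
    by apply: hn; exists h.
  exists (\sum_(i < n) (sval (boolp.cid (hex i)) \> e i)).
  rewrite comp_sumr -{1}(compm1 f) -pe comp_sumr; apply: eq_bigr => i _.
  by rewrite -!compA; congr (_ \> _); exact: (svalP (boolp.cid (hex i))).
have [m [b [c bc]]] := dual_basis (Qp (k + 1)).
pose h j := sval (boolp.cid (fac (c j))).
have hP j : c j = diff Q (k + 1) \> h j := svalP (boolp.cid (fac (c j))).
have [||g gE] := @mhom_ex _ _ (Q (k + 1 + 1)) (Q (k + 1))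
    (fun y => \sum_(j < m)
       mact (b j) (mhom_val (h j : mhom (Q (k + 1 + 1)) (regular_mod A)) y : A)).
- move=> a x y; rewrite scaler_sumr -big_split; apply: eq_bigr => j _.
  by rewrite linearP mactDr mactZr.
- by move=> y a; rewrite mact_sum; apply: eq_bigr => j _; rewrite mhomP -mactM.
apply: (@radical_not_split (Q (k + 1)) (Q (k + 1 + 1)) (diff Q (k + 1)) g Q0).
  by move=> x; exact: Qrad.
apply: mhom_eq => x; rewrite mcompE midE gE [RHS]bc; apply: eq_bigr => j _.
by rewrite hP mcompE.
Qed.

(** The top [S] of [P i] is a composition factor of [M]. A preimage [v] in [M] of its generator [s0]
    defines the map sending [a] to [v] times [a]; restricted to [P i], it induces the projection
    onto [S], so it is nonzero. *)
Lemma sincere_map M i : indecomposable (P i) ->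
  (forall S, simple_mod S -> composition_factor M S) ->
  exists f : @hom K (modcat A) (P i) M, f <> 0.
Proof.
move=> [P0 _] Msin; have [U Umax] := maximal_submodule_ex P0.
have [S [f [Ss fs fU]]] := simple_quotient Umax.
have [m [V [_ [k km [Vs Vs' _ [g [ga gV _]]]]]]] := Msin S Ss.
pose s0 : S := f (mhom_val (p i : mhom (regular_mod A) (P i)) (1 : A)).
have : s0 \in (g @: V k.+1)%VS by rewrite gV memvf.
case/memv_imgP => v vV s0v; have [h hE] := regular_map_ex v.
exists (e i \> (h : @hom K (modcat A) (regular_mod A) M)) => eh0.
have [x xU] : exists x, x \notin U by apply: exists_notin_proper; case: Umax.
move/negP: xU; apply; apply/fU.
have px : mhom_val (p i : mhom (regular_mod A) (P i))
    (mhom_val (e i : mhom (P i) (regular_mod A)) x) = x.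
  have := f_equal (fun h : mhom (P i) (P i) => h x) (ep i).
  by rewrite mcompE midE.
set a : A := mhom_val (e i : mhom (P i) (regular_mod A)) x in px.
have ha : h a = 0.
  have := f_equal (fun h : mhom (P i) M => h x) eh0.
  by rewrite mcompE mhom0.
have : g (h a) = 0 by rewrite ha linear0.
(* [g] respects the action only on [V k.+1], which contains [v]. *)
rewrite hE ga // -s0v /s0 -mhomP -mhomP => <-.
by rewrite -{1}px; congr (f (_ _)); rewrite /= mul1r.
Qed.

End Basic.

Lemma stalk_map (O : modcat A) M (f : @hom K (modcat A) O M) : pobj O -> f <> 0 ->
  exists X, concO X 0 O /\ exists u : dhom X (stalk (M : modcat A)),
    ~ deq u (dzero _ _).
Proof.
move=> Op f0; have [Sz /(_ (-1 + 1) (addNr 1)) [v [v' [vv' v'v]]]] := concO_stalk (M : modcat A).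
(* [point_to] speaks of a degree [n + 1]; here [n = -1], where the stalk vanishes and so leaves no
   boundaries. *)
have -> : (0 : int) = -1 + 1 by [].
apply: (point_to abA (f := f \> v')) => //.
  apply: is_zero_tgt; apply: Sz; lia.
move=> h fh; apply: f0; rewrite -(compm1 f) -v'v -compA fh.
by rewrite (is_zero_tgt h) ?comp0m //; apply: Sz; lia.
Qed.

End ProjectiveModules.

Lemma Kb_isomorphic_diso (K : fieldType) (A : falgType K) (P Q : cpx (modcat A)) :
  Kb_isomorphic P Q -> diso P Q.
Proof.
case=> f [g [fg gf]]; exists (DMor f), (DMor g); split.
  by apply: deq_trans (deq_mor _ _) _; exact: deq_homotopic.
by apply: deq_trans (deq_mor _ _) _; exact: deq_homotopic.
Qed.

Lemma indec_length_le3 (K : fieldType) (A : falgType K) (l : nat) :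
  basic A -> sincere A -> piecewise_hereditary A -> indec_length A l -> (l <= 3)%N.
Proof.
move=> [n [P [e [p [indP ep _ pe _]]]]] [M [indM Msin]].
move=> [H [abH herH _ _ [_ [F FE]]]].
have abA := @modcat_abelian K A.
move=> [P0 [P0p P0ind [Q [Qp Qrad P0Q [r [s [rs Qz Qr Qs srl]]]]]]].
have hind := Kb_indecomposable_hindec P0ind.
have P0pc : pcpx P0 by move=> j; exact: projective_pobj.
have P0t := hindec_trivial_idem abA (@annihilating_poly K A) P0pc hind.
have [q qP] := tobj_conc abH herH FE P0t (hindec_neq0 abA P0pc hind).
(* The degree is moved to the radical representative [Q], from which the length is read. *)
have {}qP : conc (F Q) q := conc_diso (tobj_diso F (Kb_isomorphic_diso P0Q)) qP.
have [m mP] := concO_conc abA abH herH FE (concO_stalk M) indM.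
have degree i : exists X t, [/\ concO X 0 (P i), conc (F X) t, m <= t & t <= m + 1].
  have [f f0] := sincere_map ep (indP i) Msin.
  have [X [XO [u u0]]] := stalk_map (basic_pobj ep (i := i)) f0.
  have [t tP] := concO_conc abA abH herH FE XO (indP i).
  have [mt tm] := tobj_hom_degree abH herH FE u0 tP mP.
  by exists X, t.
have [s' sE] := int_succ s; have [r' rE] := int_succ r.
have [i [X [XO [u u0]]]] : exists i X, concO X s (P i) /\
    exists u : dhom X Q, ~ deq u (dzero X Q).
  rewrite sE; apply: (point_to_top ep pe Qrad); first by rewrite -sE.
  by apply: Qz; right; lia.
have [j [Y [YO [v v0]]]] : exists j Y, concO Y r (P j) /\
    exists v : dhom Q Y, ~ deq v (dzero Q Y).
  rewrite rE; apply: (point_from_bottom pe Qp Qrad); first by rewrite -rE.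
  by apply: Qz; left; lia.
have [Xi [ti [XiO tiP mti tim]]] := degree i.
have [Xj [tj [XjO tjP mtj tjm]]] := degree j.
have XP := conc_tobj_degree abA abH herH FE (indP i) XiO XO tiP.
have YP := conc_tobj_degree abA abH herH FE (indP j) XjO YO tjP.
have := tobj_hom_degree abH herH FE u0 XP qP.
have := tobj_hom_degree abH herH FE v0 qP YP.
lia.
Qed.

Theorem theorem5p8 (K : closedFieldType) (A : falgType K)
    (A_basic : basic A) (A_sincere : sincere A)
    (A_pwh : piecewise_hereditary A) :
  exists n : nat, strong_gldim A = Some n /\ (n <= 3)%N.
Proof.
have le3 l : indec_length A l -> (l <= 3)%N by exact: indec_length_le3.
rewrite /strong_gldim; case: pselect => [bnd | unb]; last first.
  by case: unb; exists 3%N.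
exists (ex_minn (asbool_ex bnd)); split=> //.
by case: ex_minnP => k _; apply; apply/asboolP.
Qed.
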